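(* Let $H=U(\mathfrak{g}^s_1)$ and $A=F(G^s_2)$ be the super Hopf algebras over $\mathbb{R}$, with the left action $\rhd$ of $H$ on $A$ and the right coaction $\nabla_r:H\to H\otimes A$ described in the context. Write $\nabla_r(h)=h^{(1)}\otimes h^{(2)}$. Then for all homogeneous $a\in A$ and $g,h\in H$: $$\Delta(h\rhd a)=(-1)^{|a_{(1)}|(|{h_{(1)}}^{(2)}|+|h_{(2)}|)}\;{h_{(1)}}^{(1)}\rhd a_{(1)}\otimes {h_{(1)}}^{(2)}(h_{(2)}\rhd a_{(2)}),$$ $$\varepsilon(h\rhd a)=\varepsilon(h)\varepsilon(a),$$ $$\nabla_r(gh)=(-1)^{|h^{(1)}|(|{g_{(1)}}^{(2)}|+|g_{(2)}|)}\;{g_{(1)}}^{(1)}h^{(1)}\otimes {g_{(1)}}^{(2)}(g_{(2)}\rhd h^{(2)}),\qquad \nabla_r(1)=1\otimes 1,$$ $$(-1)^{|h_{(1)}||{h_{(2)}}^{(1)}|+|a||{h_{(2)}}^{(2)}|}\;{h_{(2)}}^{(1)}\otimes(h_{(1)}\rhd a){h_{(2)}}^{(2)}={h_{(1)}}^{(1)}\otimes{h_{(1)}}^{(2)}(h_{(2)}\rhd a).$$ Therefore $F(G^s_2)\otimes U(\mathfrak{g}^s_1)$ is a super Hopf algebra (the bicrossproduct super Hopf algebra of $F(G^s_2)$ and $U(\mathfrak{g}^s_1)$) with unit $1\otimes1$ and the structures $$(a\otimes h)(b\otimes g)=(-1)^{|h_{(2)}||b|}\;a(h_{(1)}\rhd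 b)\otimes h_{(2)}g,$$ $$\Delta(a\otimes h)=(-1)^{|{h_{(1)}}^{(1)}||a_{(2)}|}\;a_{(1)}\otimes{h_{(1)}}^{(1)}\otimes a_{(2)}{h_{(1)}}^{(2)}\otimes h_{(2)},$$ $$\varepsilon(a\otimes h)=\varepsilon(a)\varepsilon(h),$$ $$S(a\otimes h)=(-1)^{|h^{(1)}||a|}\;(1\otimes S(h^{(1)}))(S(ah^{(2)})\otimes1),$$ for homogeneous $a,b\in F(G^s_2)$ and $g,h\in U(\mathfrak{g}^s_1)$.
   Context: Conventions. Super means $\mathbb{Z}/2$-graded with the Koszul sign rule; $|\cdot|$ is parity. A super Hopf algebra is a Hopf algebra object in super vector spaces; in particular $\Delta(ab)=\Delta(a)\Delta(b)$ where $(a\otimes b)(c\otimes d)=(-1)^{|b||c|}ac\otimes bd$. Sweedler notation: $\Delta(b)=b_{(1)}\otimes b_{(2)}$, summation understood. The super Lie algebra $\mathfrak{g}^s_1$ over $\mathbb{R}$ has even basis $X,Y,Z$ and odd basis $U,V,W$ with super brackets $[Y,X]=X$, $[X,Z]=[Y,Z]=0$, $[X,U]=0$, $[X,V]=-W$, $[X,W]=0$, $[Y,U]=U$, $[Y,V]=-V$, $[Y,W]=0$, $[Z,U]=-U$, $[Z,V]=V$, $[Z,W]=W$, $[U,V]=-(Y+Z)$, $[U,W]=-X$, $[V,W]=0$, and $[X,X]=[Y,Y]=[Z,Z]=[U,U]=[V,V]=[W,W]=0$. $U(\mathfrak{g}^s_1)$ is its universal enveloping super Hopf algebra (elements of $\mathfrak{g}^s_1$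 are primitive). $F(G^s_2)$ is the free supercommutative $\mathbb{R}$-superalgebra on even generators $a_n\ (n\ge2)$, $d_n\ (n\ge1)$ and odd generators $b_n\ (n\ge1)$, $c_n\ (n\ge2)$, with the conventions $a_0=0$, $a_1=d_0=1$, $b_0=c_0=c_1=0$. Put $p_{k,i}=\sum_{l_1+\cdots+l_k=i,\ l_j\ge1}a_{l_1}\cdots a_{l_k}$. The coproduct is the multiplicative extension (in the super sense) of $$\Delta(a_n)=\sum_{k=1}^n a_k\otimes p_{k,n}+\sum_{i=1}^n\sum_{k=1}^i b_k\otimes p_{k,i}c_{n-i},$$ $$\Delta(b_n)=1\otimes b_n+\sum_{i=1}^n\sum_{k=1}^i(k+1)a_{k+1}\otimes p_{k,i}b_{n-i}+\sum_{i=1}^n\sum_{k=1}^i b_k\otimes p_{k,i}d_{n-i}-\sum_{i=1}^n\Bigl(b_1\otimes b_ic_{n-i}+\sum_{j=1}^i\sum_{k=1}^j(k+1)b_{k+1}\otimes p_{k,j}b_{i-j}c_{n-i}\Bigr),$$ $$\Delta(c_n)=1\otimes c_n+\sum_{k=1}^n c_k\otimes p_{k,n}+\sum_{i=1}^n\sum_{k=1}^i d_k\otimes p_{k,i}c_{n-i},$$ $$\Delta(d_n)=1\otimes d_n+\sum_{i=1}^n\sum_{k=1}^i(k+1)c_{k+1}\otimes p_{k,i}b_{n-i}+\sum_{i=1}^n\sum_{k=1}^i d_k\otimes p_{k,i}d_{n-i}-\sum_{i=1}^n\Bigl(d_1\otimes b_ic_{n-i}+\sum_{j=1}^i\sum_{k=1}^j(k+1)d_{k+1}\otimes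 p_{k,j}b_{i-j}c_{n-i}\Bigr),$$ and $\varepsilon$ is the algebra map vanishing on all the generators. $F(G^s_2)$ is a super Hopf algebra with these structures. Action of $U(\mathfrak{g}^s_1)$ on $F(G^s_2)$: on the generators $X\rhd a_n=(n+1)a_{n+1}-2a_na_2-b_1c_n$, $X\rhd b_n=(n+1)b_{n+1}-2b_na_2-b_1d_n$, $X\rhd c_n=-2c_2a_n+(n+1)c_{n+1}-c_nd_1$, $X\rhd d_n=-2c_2b_n+(n+1)d_{n+1}-d_nd_1$; $Y\rhd a_n=(n-1)a_n$, $Y\rhd b_n=(n-1)b_n$, $Y\rhd c_n=nc_n$, $Y\rhd d_n=nd_n$; $Z\rhd a_n=0$, $Z\rhd b_n=b_n$, $Z\rhd c_n=-c_n$, $Z\rhd d_n=0$; $U\rhd a_n=c_n$, $U\rhd b_n=-(n+1)a_{n+1}+d_n$, $U\rhd c_n=0$, $U\rhd d_n=(n+1)c_{n+1}$; $V\rhd a_n=b_{n-1}$, $V\rhd b_n=0$, $V\rhd c_n=a_n-d_{n-1}$, $V\rhd d_n=b_n$; $W\rhd a_n=-b_1a_n+b_n$, $W\rhd b_n=-b_1b_n$, $W\rhd c_n=d_1a_n-d_n$, $W\rhd d_n=d_1b_n$; extended by $(gh)\rhd a=g\rhd(h\rhd a)$, $h\rhd(ab)=(-1)^{|a||h_{(2)}|}(h_{(1)}\rhd a)(h_{(2)}\rhd b)$, and $h\rhd 1=\varepsilon(h)1$. This makes $F(G^s_2)$ a super left $U(\mathfrak{g}^s_1)$-module algebra. Coaction: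 $\nabla_r(X)=2Y\otimes a_2+X\otimes1+Z\otimes d_1+U\otimes b_1+2V\otimes c_2$, $\nabla_r(Y)=Y\otimes1$, $\nabla_r(Z)=Z\otimes1$, $\nabla_r(U)=U\otimes1$, $\nabla_r(V)=V\otimes1$, $\nabla_r(W)=Y\otimes b_1+V\otimes d_1+W\otimes1$, $\nabla_r(1)=1\otimes1$, extended to products by $\nabla_r(gh)=(-1)^{|h^{(1)}|(|{g_{(1)}}^{(2)}|+|g_{(2)}|)}\,{g_{(1)}}^{(1)}h^{(1)}\otimes{g_{(1)}}^{(2)}(g_{(2)}\rhd h^{(2)})$. This makes $U(\mathfrak{g}^s_1)$ a super right $F(G^s_2)$-comodule coalgebra. *)

(* Defs.v *)
From HB Require Import structures.
From mathcomp Require Import all_boot all_order all_algebra.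
From mathcomp Require Import boolp reals.

Set Implicit Arguments.
Unset Strict Implicit.
Unset Printing Implicit Defensive.
Import GRing.Theory.
Local Open Scope ring_scope.
Local Open Scope quotient_scope.

(* A Z/2-grading is given by its two projections: [hpart false] is the
   projection onto the even part and [hpart true] the one onto the odd part. *)
HB.mixin Record Lmodule_isSuper (R : pzRingType) V of GRing.Lmodule R V := {
  hpart : bool -> V -> V;
  hpart_linear : forall p, linear (hpart p);
  hpartK : forall p q v, hpart p (hpart q v) = if p == q then hpart q v else 0;
  hpartD : forall v, hpart false v + hpart true v = v
}.
#[short(type="superModType")]
HB.structure Definition SuperModule (R : pzRingType) :=
  {V of GRing.Lmodule R V & Lmodule_isSuper R V}.

HB.instance Definition _ (R : pzRingType) (V : superModType R) (p : bool) :=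
  GRing.isLinear.Build R V V *:%R (hpart p) (@hpart_linear R V p).

Definition homogeneous (R : pzRingType) (V : superModType R) (v : V) : Prop :=
  exists p, hpart p v = v.

(* The parity of a homogeneous element, as a boolean that is true on odd ones;
   0 is given parity [false]. *)
Definition deg (R : pzRingType) (V : superModType R) (v : V) : bool :=
  (v != 0) && (hpart true v == v).

(* The ground ring is purely even. *)
Definition even_form (R : pzRingType) (V : superModType R) (e : V -> R) : Prop :=
  forall v, e (hpart true v) = 0.

Definition even_map (R : pzRingType) (V W : superModType R) (f : V -> W) : Prop :=
  forall p v, f (hpart p v) = hpart p (f v).

Definition even_bimap (R : pzRingType) (U V W : superModType R)
    (f : U -> V -> W) : Prop :=
  forall p q u v, hpart p u = u -> hpart q v = v ->
    hpart (p (+) q) (f u v) = f u v.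

Section Tensor.
Variables (R : comNzRingType) (V W : lmodType R).

Inductive tterm : Type :=
| TPure of V & W
| TZero
| TOpp of tterm
| TAdd of tterm & tterm
| TScale of R & tterm.

Inductive tcong : tterm -> tterm -> Prop :=
| tcong_refl s : tcong s s
| tcong_sym s t : tcong s t -> tcong t s
| tcong_trans s t u : tcong s t -> tcong t u -> tcong s u
| tcong_opp s t : tcong s t -> tcong (TOpp s) (TOpp t)
| tcong_add s s' t t' :
    tcong s s' -> tcong t t' -> tcong (TAdd s t) (TAdd s' t')
| tcong_scale r s t : tcong s t -> tcong (TScale r s) (TScale r t)
| tcong_addA s t u : tcong (TAdd s (TAdd t u)) (TAdd (TAdd s t) u)
| tcong_addC s t : tcong (TAdd s t) (TAdd t s)
| tcong_add0 s : tcong (TAdd TZero s) s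
| tcong_addN s : tcong (TAdd (TOpp s) s) TZero
| tcong_scaleA r r' s : tcong (TScale r (TScale r' s)) (TScale (r * r') s)
| tcong_scale1 s : tcong (TScale 1 s) s
| tcong_scaleDr r s t :
    tcong (TScale r (TAdd s t)) (TAdd (TScale r s) (TScale r t))
| tcong_scaleDl r r' s :
    tcong (TScale (r + r') s) (TAdd (TScale r s) (TScale r' s))
| tcong_pureDl v v' w : tcong (TPure (v + v') w) (TAdd (TPure v w) (TPure v' w))
| tcong_pureDr v w w' : tcong (TPure v (w + w')) (TAdd (TPure v w) (TPure v w'))
| tcong_pureZl r v w : tcong (TPure (r *: v) w) (TScale r (TPure v w))
| tcong_pureZr r v w : tcong (TPure v (r *: w)) (TScale r (TPure v w)).

HB.instance Definition _ := gen_eqMixin tterm.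
HB.instance Definition _ := gen_choiceMixin tterm.

Definition tcongb (s t : tterm) : bool := `[< tcong s t >].

Lemma tcongb_refl : reflexive tcongb.
Proof. by move=> s; apply/asboolP; exact: tcong_refl. Qed.
Lemma tcongb_sym : symmetric tcongb.
Proof. by move=> s t; apply/asboolP/asboolP; exact: tcong_sym. Qed.
Lemma tcongb_trans : transitive tcongb.
Proof.
by move=> t s u /asboolP st /asboolP tu; apply/asboolP; exact: tcong_trans tu.
Qed.

Canonical tcong_equiv := EquivRel tcongb tcongb_refl tcongb_sym tcongb_trans.

Definition tensor : Type := {eq_quot tcong_equiv}.
HB.instance Definition _ := Choice.on tensor.
HB.instance Definition _ := EqQuotient.on tensor.

Lemma tensor_pi_eq (s t : tterm) : tcong s t -> \pi_tensor s = \pi_tensor t.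
Proof. by move=> st; apply/eqmodP/asboolP. Qed.

Lemma tensor_repr (s : tterm) : tcong (repr (\pi_tensor s)) s.
Proof. by apply/asboolP/(@eqmodP _ tcong_equiv); rewrite reprK. Qed.

Definition tens (v : V) (w : W) : tensor := \pi_tensor (TPure v w).
Definition tensor0 : tensor := \pi_tensor TZero.
Definition tensor_opp (x : tensor) : tensor := \pi_tensor (TOpp (repr x)).
Definition tensor_add (x y : tensor) : tensor := \pi_tensor (TAdd (repr x) (repr y)).
Definition tensor_scale (r : R) (x : tensor) : tensor := \pi_tensor (TScale r (repr x)).

Lemma pi_tensor_opp s : \pi_tensor (TOpp s) = tensor_opp (\pi s).
Proof. by apply/tensor_pi_eq/tcong_opp/tcong_sym/tensor_repr. Qed.
Lemma pi_tensor_add s t : \pi_tensor (TAdd s t) = tensor_add (\pi s) (\pi t).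
Proof. by apply/tensor_pi_eq/tcong_add; apply/tcong_sym/tensor_repr. Qed.
Lemma pi_tensor_scale r s : \pi_tensor (TScale r s) = tensor_scale r (\pi s).
Proof. by apply/tensor_pi_eq/tcong_scale/tcong_sym/tensor_repr. Qed.

Lemma tensor_addA : associative tensor_add.
Proof.
elim/quotW=> s; elim/quotW=> t; elim/quotW=> u.
by rewrite -!pi_tensor_add; apply/tensor_pi_eq/tcong_addA.
Qed.
Lemma tensor_addC : commutative tensor_add.
Proof.
elim/quotW=> s; elim/quotW=> t.
by rewrite -!pi_tensor_add; apply/tensor_pi_eq/tcong_addC.
Qed.
Lemma tensor_add0 : left_id tensor0 tensor_add.
Proof.
by elim/quotW=> s; rewrite -pi_tensor_add; apply/tensor_pi_eq/tcong_add0.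
Qed.
Lemma tensor_addN : left_inverse tensor0 tensor_opp tensor_add.
Proof.
elim/quotW=> s; rewrite -pi_tensor_opp -pi_tensor_add.
by apply/tensor_pi_eq/tcong_addN.
Qed.
HB.instance Definition _ := GRing.isZmodule.Build tensor
  tensor_addA tensor_addC tensor_add0 tensor_addN.

Lemma tensor_scaleA r r' x :
  tensor_scale r (tensor_scale r' x) = tensor_scale (r * r') x.
Proof.
elim/quotW: x => s; rewrite -!pi_tensor_scale.
by apply/tensor_pi_eq/tcong_scaleA.
Qed.
Lemma tensor_scale1 : left_id 1 tensor_scale.
Proof.
by elim/quotW=> s; rewrite -pi_tensor_scale; apply/tensor_pi_eq/tcong_scale1.
Qed.
Lemma tensor_scaleDr : right_distributive tensor_scale +%R.
Proof.
move=> r; elim/quotW=> s; elim/quotW=> t.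
rewrite -[_ + _]pi_tensor_add -!pi_tensor_scale -[RHS]pi_tensor_add.
by apply/tensor_pi_eq/tcong_scaleDr.
Qed.
Lemma tensor_scaleDl x : {morph tensor_scale^~ x : r r' / r + r'}.
Proof.
move=> r r'; elim/quotW: x => s.
rewrite -!pi_tensor_scale -[RHS]pi_tensor_add.
by apply/tensor_pi_eq/tcong_scaleDl.
Qed.
HB.instance Definition _ := GRing.Zmodule_isLmodule.Build R tensor
  tensor_scaleA tensor_scale1 tensor_scaleDr tensor_scaleDl.

Lemma tens_is_bilinear : bilinear_for *:%R *:%R tens.
Proof.
split=> [w r v v'|v r w w'].
  transitivity (\pi_tensor (TAdd (TScale r (TPure v w)) (TPure v' w))).
    apply/tensor_pi_eq/(tcong_trans (tcong_pureDl _ _ _)).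
    by apply/tcong_add; [exact: tcong_pureZl|exact: tcong_refl].
  by rewrite pi_tensor_add pi_tensor_scale.
transitivity (\pi_tensor (TAdd (TScale r (TPure v w)) (TPure v w'))).
  apply/tensor_pi_eq/(tcong_trans (tcong_pureDr _ _ _)).
  by apply/tcong_add; [exact: tcong_pureZr|exact: tcong_refl].
by rewrite pi_tensor_add pi_tensor_scale.
Qed.
HB.instance Definition _ := bilinear_isBilinear.Build R V W tensor *:%R *:%R tens
  tens_is_bilinear.

Variable M : lmodType R.
Implicit Type f : V -> W -> M.

Fixpoint tterm_eval f (t : tterm) : M :=
  match t with
  | TPure v w => f v w
  | TZero => 0
  | TOpp t => - tterm_eval f t
  | TAdd s t => tterm_eval f s + tterm_eval f t
  | TScale r t => r *: tterm_eval f t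
  end.

(* [tlift f] sums [f v w] over a chosen expression of a tensor as a combination
   of pure tensors; it is meaningful only for bilinear [f], for which it is the
   induced linear map ([tlift_linear], [tlift_tens]). *)
Definition tlift f (x : tensor) : M := tterm_eval f (repr x).

Lemma tterm_eval_cong f : bilinear_for *:%R *:%R f ->
  forall s t, tcong s t -> tterm_eval f s = tterm_eval f t.
Proof.
case=> fl fr s t; elim=> //=.
- by move=> ? ? ? _ -> _ ->.
- by move=> ? ? _ ->.
- by move=> ? ? ? ? _ -> _ ->.
- by move=> ? ? ? _ ->.
- by move=> *; rewrite addrA.
- by move=> *; rewrite addrC.
- by move=> *; rewrite add0r.
- by move=> *; rewrite addNr.
- by move=> *; rewrite scalerA.
- by move=> *; rewrite scale1r.
- by move=> *; rewrite scalerDr.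
- by move=> *; rewrite scalerDl.
- by move=> v v' w; have := fl w 1 v v'; rewrite /= !scale1r.
- by move=> v w w'; have := fr v 1 w w'; rewrite /= !scale1r.
- move=> r v w; have := fl w r v 0; rewrite /= addr0 => ->.
  by have := fl w (-1) 0 0; rewrite /= scaler0 addr0 scaleN1r addNr => ->; rewrite addr0.
- move=> r v w; have := fr v r w 0; rewrite /= addr0 => ->.
  by have := fr v (-1) 0 0; rewrite /= scaler0 addr0 scaleN1r addNr => ->; rewrite addr0.
Qed.

Lemma tlift_tens f : bilinear_for *:%R *:%R f ->
  forall v w, tlift f (tens v w) = f v w.
Proof. by move=> fP v w; rewrite /tlift (tterm_eval_cong fP (tensor_repr _)). Qed.

Lemma tlift_linear f : bilinear_for *:%R *:%R f -> linear (tlift f).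
Proof.
move=> fP r x y; rewrite /tlift (tterm_eval_cong fP (tensor_repr _)) /=.
by rewrite (tterm_eval_cong fP (tensor_repr _)).
Qed.

End Tensor.

Notation "V ⊗ W" := (tensor V W) (at level 40, left associativity) : type_scope.
Notation "v ⊗ w" := (tens v w) (at level 40, left associativity) : ring_scope.

Lemma tensor_ind (R : comNzRingType) (V W : lmodType R) (P : V ⊗ W -> Prop) :
  (forall v w, P (v ⊗ w)) -> (forall r x y, P x -> P y -> P (r *: x + y)) ->
  forall x, P x.
Proof.
move=> Pt PD; elim/quotW=> t.
pose pi s : V ⊗ W := \pi_(V ⊗ W) s; change (P (pi t)).
have P0 : P (pi (TZero V W)).
  have -> : pi (TZero V W) = (-1) *: (0 ⊗ 0) + (0 ⊗ 0).
    by rewrite scaleN1r addNr.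
  exact: PD.
elim: t => [v w||s Ps|s Ps t Pt'|r s Ps].
- exact: Pt.
- exact: P0.
- have -> : pi (TOpp s) = (-1) *: (pi s) + pi (TZero V W).
    by rewrite scaleN1r [RHS]addr0 /pi pi_tensor_opp.
  exact: PD.
- have -> : pi (TAdd s t) = 1 *: (pi s) + pi t.
    by rewrite scale1r /pi pi_tensor_add.
  exact: PD.
- have -> : pi (TScale r s) = r *: (pi s) + pi (TZero V W).
    by rewrite [RHS]addr0 /pi pi_tensor_scale.
  exact: PD.
Qed.

Section SuperTensor.
Variables (R : comNzRingType) (V W : superModType R).

Definition tensor_hpart (p : bool) : V ⊗ W -> V ⊗ W :=
  tlift (fun v w => hpart false v ⊗ hpart p w + hpart true v ⊗ hpart (~~ p) w).

Lemma tensor_hpart_bilinear (p : bool) : bilinear_for *:%R *:%R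
  (fun (v : V) (w : W) =>
     hpart false v ⊗ hpart p w + hpart true v ⊗ hpart (~~ p) w).
Proof.
split=> [w r v v'|v r w w'] /=; rewrite !linearP ?linearPl ?linearPr.
  by rewrite scalerDr addrACA.
by rewrite scalerDr addrACA.
Qed.

Lemma tensor_hpart_tens p (v : V) (w : W) : tensor_hpart p (v ⊗ w) =
  hpart false v ⊗ hpart p w + hpart true v ⊗ hpart (~~ p) w.
Proof. exact: (tlift_tens (tensor_hpart_bilinear p)). Qed.

Lemma tensor_hpart_linear p : linear (tensor_hpart p).
Proof. exact/tlift_linear/tensor_hpart_bilinear. Qed.
HB.instance Definition _ p :=
  GRing.isLinear.Build R (V ⊗ W)%type (V ⊗ W)%type *:%R (tensor_hpart p)
    (tensor_hpart_linear p).

Lemma tensor_hpartK p q x :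
  tensor_hpart p (tensor_hpart q x) = if p == q then tensor_hpart q x else 0.
Proof.
elim/tensor_ind: x => [v w|r x y IHx IHy]; last first.
  by rewrite !linearP /= IHx IHy; case: (p == q); rewrite ?scaler0 ?addr0.
rewrite (tensor_hpart_tens q) linearD /= !tensor_hpart_tens !hpartK.
by case: p; case: q; rewrite /= ?linear0l ?linear0r ?addr0 ?add0r.
Qed.

Lemma tensor_hpartD x : tensor_hpart false x + tensor_hpart true x = x.
Proof.
elim/tensor_ind: x => [v w|r x y IHx IHy]; last first.
  by rewrite !linearP addrACA -scalerDr IHx IHy.
rewrite !tensor_hpart_tens /= addrACA [X in _ + X]addrC.
by rewrite -!linearDr /= !hpartD -linearDl /= hpartD.
Qed.

HB.instance Definition _ := Lmodule_isSuper.Build R (V ⊗ W)%type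
  tensor_hpart_linear tensor_hpartK tensor_hpartD.

(* Sweedler sums: [\sw_(x, y <- t) F] is the sum of F over a decomposition of t
   into pure tensors x ⊗ y whose two legs are homogeneous, so that F may contain
   Koszul signs in [deg x] and [deg y].  The sum does not depend on the
   decomposition if F is bilinear for fixed parities ([sweedler_linear],
   [sweedler_tens]). *)
Definition sweedler (M : lmodType R) (t : V ⊗ W) (F : V -> W -> M) : M :=
  tlift (fun v w => \sum_(p : bool) \sum_(q : bool) F (hpart p v) (hpart q w)) t.

Section SweedlerTheory.
Variables (M : lmodType R) (F : bool -> bool -> V -> W -> M).
Hypothesis Fbilin : forall p q, bilinear_for *:%R *:%R (F p q).

Let Fdeg (v : V) (w : W) : M := F (deg v) (deg w) v w.

Let deg_hpart (U : superModType R) p (u : U) :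
  hpart p u = 0 \/ deg (hpart p u) = p.
Proof.
have [->|u0] := eqVneq (hpart p u) 0; [by left|right].
rewrite /deg u0 hpartK; case: p u0 => u0 /=; first by rewrite eqxx.
by rewrite eq_sym (negPf u0).
Qed.

Let F0l p q w : F p q 0 w = 0.
Proof.
have /= := (Fbilin p q).1 w (-1) 0 0; rewrite scaler0 addr0 scaleN1r addNr.
by [].
Qed.

Let F0r p q v : F p q v 0 = 0.
Proof.
have /= := (Fbilin p q).2 v (-1) 0 0; rewrite scaler0 addr0 scaleN1r addNr.
by [].
Qed.

Let FdegE : (fun v w => \sum_(p : bool) \sum_(q : bool) Fdeg (hpart p v) (hpart q w))
  = fun v w => \sum_(p : bool) \sum_(q : bool) F p q (hpart p v) (hpart q w).
Proof.
apply/funext => v; apply/funext => w; apply: eq_bigr => p _; apply: eq_bigr => q _.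
rewrite /Fdeg; have [->|->] := deg_hpart p v; first by rewrite !F0l.
by have [->|->] := deg_hpart q w; rewrite ?F0r.
Qed.

Let sum_bilinear : bilinear_for *:%R *:%R (fun v w =>
  \sum_(p : bool) \sum_(q : bool) F p q (hpart p v) (hpart q w)).
Proof.
split=> [w r v v'|v r w w'] /=; rewrite scaler_sumr -big_split;
  apply: eq_bigr => p _; rewrite /= scaler_sumr -big_split;
  apply: eq_bigr => q _; rewrite linearP.
  exact: (Fbilin p q).1.
exact: (Fbilin p q).2.
Qed.

Lemma sweedler_tens v w :
  sweedler (v ⊗ w) (fun x y => F (deg x) (deg y) x y) =
  \sum_(p : bool) \sum_(q : bool) F p q (hpart p v) (hpart q w).
Proof. by rewrite /sweedler FdegE (tlift_tens sum_bilinear). Qed.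

Lemma sweedler_linear :
  linear (fun t => sweedler t (fun x y => F (deg x) (deg y) x y)).
Proof. by rewrite /sweedler FdegE; exact: tlift_linear. Qed.

End SweedlerTheory.

End SuperTensor.

Notation "\sw_ ( x , y <- t ) F" := (sweedler t (fun x y => F))
  (at level 41, x name, y name, t at level 200, F at level 41,
   format "'[' \sw_ ( x ,  y  <-  t ) '/  '  F ']'") : ring_scope.

Section AlgTerm.
Variables (R : comNzRingType) (G : Type).

Inductive aterm : Type :=
| AGen of G
| AZero
| AOne
| AOpp of aterm
| AAdd of aterm & aterm
| AMul of aterm & aterm
| AScale of R & aterm.

Fixpoint aterm_eval (B : algType R) (f : G -> B) (t : aterm) : B :=
  match t with
  | AGen g => f g
  | AZero => 0
  | AOne => 1
  | AOpp t => - aterm_eval f t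
  | AAdd s t => aterm_eval f s + aterm_eval f t
  | AMul s t => aterm_eval f s * aterm_eval f t
  | AScale r t => r *: aterm_eval f t
  end.

Inductive aterm_homog (gdeg : G -> bool) : bool -> aterm -> Prop :=
| ahomog_gen g : aterm_homog gdeg (gdeg g) (AGen g)
| ahomog_zero p : aterm_homog gdeg p AZero
| ahomog_one : aterm_homog gdeg false AOne
| ahomog_opp p t : aterm_homog gdeg p t -> aterm_homog gdeg p (AOpp t)
| ahomog_add p s t : aterm_homog gdeg p s -> aterm_homog gdeg p t ->
    aterm_homog gdeg p (AAdd s t)
| ahomog_mul p q s t : aterm_homog gdeg p s -> aterm_homog gdeg q t ->
    aterm_homog gdeg (p (+) q) (AMul s t)
| ahomog_scale p r t : aterm_homog gdeg p t -> aterm_homog gdeg p (AScale r t).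

(* The least congruence containing [rel] and the axioms of unital associative
   R-algebras. *)
Inductive acong (rel : aterm -> aterm -> Prop) : aterm -> aterm -> Prop :=
| acong_rel s t : rel s t -> acong rel s t
| acong_refl s : acong rel s s
| acong_sym s t : acong rel s t -> acong rel t s
| acong_trans s t u : acong rel s t -> acong rel t u -> acong rel s u
| acong_opp s t : acong rel s t -> acong rel (AOpp s) (AOpp t)
| acong_add s s' t t' : acong rel s s' -> acong rel t t' ->
    acong rel (AAdd s t) (AAdd s' t')
| acong_mul s s' t t' : acong rel s s' -> acong rel t t' ->
    acong rel (AMul s t) (AMul s' t')
| acong_scale r s t : acong rel s t -> acong rel (AScale r s) (AScale r t)
| acong_addA s t u : acong rel (AAdd s (AAdd t u)) (AAdd (AAdd s t) u)
| acong_addC s t : acong rel (AAdd s t) (AAdd t s)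
| acong_add0 s : acong rel (AAdd AZero s) s
| acong_addN s : acong rel (AAdd (AOpp s) s) AZero
| acong_mulA s t u : acong rel (AMul s (AMul t u)) (AMul (AMul s t) u)
| acong_mul1l s : acong rel (AMul AOne s) s
| acong_mul1r s : acong rel (AMul s AOne) s
| acong_mulDl s t u :
    acong rel (AMul (AAdd s t) u) (AAdd (AMul s u) (AMul t u))
| acong_mulDr s t u :
    acong rel (AMul s (AAdd t u)) (AAdd (AMul s t) (AMul s u))
| acong_scaleA r r' s : acong rel (AScale r (AScale r' s)) (AScale (r * r') s)
| acong_scale1 s : acong rel (AScale 1 s) s
| acong_scaleDr r s t :
    acong rel (AScale r (AAdd s t)) (AAdd (AScale r s) (AScale r t))
| acong_scaleDl r r' s :
    acong rel (AScale (r + r') s) (AAdd (AScale r s) (AScale r' s))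
| acong_scaleAl r s t : acong rel (AScale r (AMul s t)) (AMul (AScale r s) t)
| acong_scaleAr r s t : acong rel (AScale r (AMul s t)) (AMul s (AScale r t)).

Lemma aterm_eval_cong rel (B : algType R) (f : G -> B) :
  (forall s t, rel s t -> aterm_eval f s = aterm_eval f t) ->
  forall s t, acong rel s t -> aterm_eval f s = aterm_eval f t.
Proof.
move=> frel s t; elim=> //=.
- by move=> ? ? ? _ -> _ ->.
- by move=> ? ? _ ->.
- by move=> ? ? ? ? _ -> _ ->.
- by move=> ? ? ? ? _ -> _ ->.
- by move=> ? ? ? _ ->.
- by move=> *; rewrite addrA.
- by move=> *; rewrite addrC.
- by move=> *; rewrite add0r.
- by move=> *; rewrite addNr.
- by move=> *; rewrite mulrA.
- by move=> *; rewrite mul1r.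
- by move=> *; rewrite mulr1.
- by move=> *; rewrite mulrDl.
- by move=> *; rewrite mulrDr.
- by move=> *; rewrite scalerA.
- by move=> *; rewrite scale1r.
- by move=> *; rewrite scalerDr.
- by move=> *; rewrite scalerDl.
- by move=> *; rewrite scalerAl.
- by move=> *; rewrite scalerAr.
Qed.

End AlgTerm.

Arguments AGen {R G}.
Arguments AZero {R G}.
Arguments AOne {R G}.

(* Homogeneous relations make the quotient Z/2-graded; relations that hold when
   all the generators are sent to 0 make it nontrivial. *)
Record superPresentation (R : comNzRingType) := SuperPresentation {
  sgen : Type;
  sgdeg : sgen -> bool;
  srel : aterm R sgen -> aterm R sgen -> Prop;
  srel_homog : forall s t, srel s t ->
    exists p, aterm_homog sgdeg p s /\ aterm_homog sgdeg p t;
  srel_aug : forall s t, srel s t ->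
    aterm_eval (fun _ => 0 : R^o) s = aterm_eval (fun _ => 0 : R^o) t
}.

Section PresentedAlgebra.
Variables (R : comNzRingType) (P : superPresentation R).
Local Notation term := (aterm R (sgen P)).
Local Notation cong := (acong (@srel R P)).

HB.instance Definition _ := gen_eqMixin (aterm R (sgen P)).
HB.instance Definition _ := gen_choiceMixin (aterm R (sgen P)).

Definition acongb (s t : term) : bool := `[< cong s t >].

Lemma acongb_refl : reflexive acongb.
Proof. by move=> s; apply/asboolP; exact: acong_refl. Qed.
Lemma acongb_sym : symmetric acongb.
Proof. by move=> s t; apply/asboolP/asboolP; exact: acong_sym. Qed.
Lemma acongb_trans : transitive acongb.
Proof.
by move=> t s u /asboolP st /asboolP tu; apply/asboolP; exact: acong_trans tu.
Qed.

Canonical acong_equiv := EquivRel acongb acongb_refl acongb_sym acongb_trans.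

Definition palg : Type := {eq_quot acong_equiv}.
HB.instance Definition _ := Choice.on palg.
HB.instance Definition _ := EqQuotient.on palg.

Lemma palg_pi_eq (s t : term) : cong s t -> \pi_palg s = \pi_palg t.
Proof. by move=> st; apply/eqmodP/asboolP. Qed.

Lemma palg_repr (s : term) : cong (repr (\pi_palg s)) s.
Proof. by apply/asboolP/(@eqmodP _ acong_equiv); rewrite reprK. Qed.

Definition pgen (g : sgen P) : palg := \pi_palg (AGen g).
Definition palg0 : palg := \pi_palg AZero.
Definition palg1 : palg := \pi_palg AOne.
Definition palg_opp (x : palg) : palg := \pi_palg (AOpp (repr x)).
Definition palg_add (x y : palg) : palg := \pi_palg (AAdd (repr x) (repr y)).
Definition palg_mul (x y : palg) : palg := \pi_palg (AMul (repr x) (repr y)).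
Definition palg_scale (r : R) (x : palg) : palg := \pi_palg (AScale r (repr x)).

Lemma pi_palg_opp s : \pi_palg (AOpp s) = palg_opp (\pi s).
Proof. by apply/palg_pi_eq/acong_opp/acong_sym/palg_repr. Qed.
Lemma pi_palg_add s t : \pi_palg (AAdd s t) = palg_add (\pi s) (\pi t).
Proof. by apply/palg_pi_eq/acong_add; apply/acong_sym/palg_repr. Qed.
Lemma pi_palg_mul s t : \pi_palg (AMul s t) = palg_mul (\pi s) (\pi t).
Proof. by apply/palg_pi_eq/acong_mul; apply/acong_sym/palg_repr. Qed.
Lemma pi_palg_scale r s : \pi_palg (AScale r s) = palg_scale r (\pi s).
Proof. by apply/palg_pi_eq/acong_scale/acong_sym/palg_repr. Qed.

Lemma palg_addA : associative palg_add.
Proof.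
elim/quotW=> s; elim/quotW=> t; elim/quotW=> u.
by rewrite -!pi_palg_add; apply/palg_pi_eq/acong_addA.
Qed.
Lemma palg_addC : commutative palg_add.
Proof.
elim/quotW=> s; elim/quotW=> t.
by rewrite -!pi_palg_add; apply/palg_pi_eq/acong_addC.
Qed.
Lemma palg_add0 : left_id palg0 palg_add.
Proof. by elim/quotW=> s; rewrite -pi_palg_add; apply/palg_pi_eq/acong_add0. Qed.
Lemma palg_addN : left_inverse palg0 palg_opp palg_add.
Proof.
elim/quotW=> s; rewrite -pi_palg_opp -pi_palg_add.
by apply/palg_pi_eq/acong_addN.
Qed.
HB.instance Definition _ := GRing.isZmodule.Build palg
  palg_addA palg_addC palg_add0 palg_addN.

Lemma palg_mulA : associative palg_mul.
Proof.
elim/quotW=> s; elim/quotW=> t; elim/quotW=> u.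
by rewrite -!pi_palg_mul; apply/palg_pi_eq/acong_mulA.
Qed.
Lemma palg_mul1l : left_id palg1 palg_mul.
Proof. by elim/quotW=> s; rewrite -pi_palg_mul; apply/palg_pi_eq/acong_mul1l. Qed.
Lemma palg_mul1r : right_id palg1 palg_mul.
Proof. by elim/quotW=> s; rewrite -pi_palg_mul; apply/palg_pi_eq/acong_mul1r. Qed.
Lemma palg_mulDl : left_distributive palg_mul +%R.
Proof.
elim/quotW=> s; elim/quotW=> t; elim/quotW=> u.
rewrite -[_ + _]pi_palg_add -!pi_palg_mul -[RHS]pi_palg_add.
by apply/palg_pi_eq/acong_mulDl.
Qed.
Lemma palg_mulDr : right_distributive palg_mul +%R.
Proof.
elim/quotW=> s; elim/quotW=> t; elim/quotW=> u.
rewrite -[_ + _]pi_palg_add -!pi_palg_mul -[RHS]pi_palg_add.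
by apply/palg_pi_eq/acong_mulDr.
Qed.
Lemma palg_oner_neq0 : palg1 != 0.
Proof.
apply/eqP => /(congr1 (aterm_eval (fun _ => 0 : R^o) \o @repr _ palg)) /=.
rewrite !(aterm_eval_cong (@srel_aug R P) (palg_repr _)) /=.
by apply/eqP; exact: oner_neq0.
Qed.
HB.instance Definition _ := GRing.Zmodule_isNzRing.Build palg
  palg_mulA palg_mul1l palg_mul1r palg_mulDl palg_mulDr palg_oner_neq0.

Lemma palg_scaleA r r' x :
  palg_scale r (palg_scale r' x) = palg_scale (r * r') x.
Proof.
elim/quotW: x => s; rewrite -!pi_palg_scale.
by apply/palg_pi_eq/acong_scaleA.
Qed.
Lemma palg_scale1 : left_id 1 palg_scale.
Proof. by elim/quotW=> s; rewrite -pi_palg_scale; apply/palg_pi_eq/acong_scale1. Qed.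
Lemma palg_scaleDr : right_distributive palg_scale +%R.
Proof.
move=> r; elim/quotW=> s; elim/quotW=> t.
rewrite -[_ + _]pi_palg_add -!pi_palg_scale -[RHS]pi_palg_add.
by apply/palg_pi_eq/acong_scaleDr.
Qed.
Lemma palg_scaleDl x : {morph palg_scale^~ x : r r' / r + r'}.
Proof.
move=> r r'; elim/quotW: x => s.
rewrite -!pi_palg_scale -[RHS]pi_palg_add.
by apply/palg_pi_eq/acong_scaleDl.
Qed.
HB.instance Definition _ := GRing.Zmodule_isLmodule.Build R palg
  palg_scaleA palg_scale1 palg_scaleDr palg_scaleDl.

Lemma palg_scaleAl (r : R) (x y : palg) : r *: (x * y) = (r *: x) * y.
Proof.
elim/quotW: x => s; elim/quotW: y => t.
rewrite -[_ * _]pi_palg_mul -[LHS]pi_palg_scale -[X in _ = X * _]pi_palg_scale.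
by rewrite -[RHS]pi_palg_mul; apply/palg_pi_eq/acong_scaleAl.
Qed.
HB.instance Definition _ := GRing.Lmodule_isLalgebra.Build R palg palg_scaleAl.
Lemma palg_scaleAr (r : R) (x y : palg) : r *: (x * y) = x * (r *: y).
Proof.
elim/quotW: x => s; elim/quotW: y => t.
rewrite -[_ * _]pi_palg_mul -[LHS]pi_palg_scale -[X in _ = _ * X]pi_palg_scale.
by rewrite -[RHS]pi_palg_mul; apply/palg_pi_eq/acong_scaleAr.
Qed.
HB.instance Definition _ := GRing.Lalgebra_isAlgebra.Build R palg palg_scaleAr.

Lemma pi_aterm (t : term) : \pi_palg t = aterm_eval pgen t.
Proof.
elim: t => //=.
- by move=> t <-; rewrite -[RHS]pi_palg_opp.
- by move=> s <- t <-; rewrite -[RHS]pi_palg_add.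
- by move=> s <- t <-; rewrite -[RHS]pi_palg_mul.
- by move=> r t <-; rewrite -[RHS]pi_palg_scale.
Qed.

Lemma pgen_rel s t : srel s t -> aterm_eval pgen s = aterm_eval pgen t.
Proof. by move=> st; rewrite -!pi_aterm; apply/palg_pi_eq/acong_rel. Qed.

Fixpoint aterm_hpart (p : bool) (t : term) : palg :=
  match t with
  | AGen g => if sgdeg g == p then pgen g else 0
  | AZero => 0
  | AOne => if p then 0 else 1
  | AOpp t => - aterm_hpart p t
  | AAdd s t => aterm_hpart p s + aterm_hpart p t
  | AMul s t => aterm_hpart false s * aterm_hpart p t +
                aterm_hpart true s * aterm_hpart (~~ p) t
  | AScale r t => r *: aterm_hpart p t
  end.

Lemma aterm_hpart_homog p q t : aterm_homog (@sgdeg R P) q t ->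
  aterm_hpart p t = if q == p then aterm_eval pgen t else 0.
Proof.
move=> th; elim: th p => //=.
- by move=> ? ?; case: eqP.
- by move=> [].
- by move=> q' u _ IH p; rewrite IH; case: eqP; rewrite ?oppr0.
- by move=> q' u v _ IHu _ IHv p; rewrite IHu IHv; case: eqP; rewrite ?addr0.
- move=> q1 q2 u v _ IHu _ IHv p; rewrite !IHu !IHv.
  by case: q1 {IHu}; case: q2 {IHv}; case: p; rewrite /= ?mul0r ?mulr0 ?addr0 ?add0r.
- by move=> q' r u _ IH p; rewrite IH; case: eqP; rewrite ?scaler0.
Qed.

Lemma aterm_hpart_cong p s t : cong s t -> aterm_hpart p s = aterm_hpart p t.
Proof.
move=> st; elim: st p => //=.
- move=> {}s {}t st p; have [q [sq tq]] := srel_homog st.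
  by rewrite (aterm_hpart_homog p sq) (aterm_hpart_homog p tq) (pgen_rel st).
- by move=> ? ? ? _ + _ + p => -> ->.
- by move=> ? ? _ + p => ->.
- by move=> ? ? ? ? _ + _ + p => -> ->.
- by move=> ? ? ? ? _ + _ + p => H K; rewrite !H !K.
- by move=> ? ? ? _ + p => ->.
- by move=> *; rewrite addrA.
- by move=> *; rewrite addrC.
- by move=> *; rewrite add0r.
- by move=> *; rewrite addNr.
- move=> u v w p; rewrite !mulrDl !mulrDr !mulrA negbK [RHS]addrACA.
  by congr (_ + _); rewrite addrC.
- by move=> u p; rewrite mul1r mul0r addr0.
- by move=> u []; rewrite /= ?mulr1 ?mulr0 ?addr0 ?add0r.
- by move=> *; rewrite !mulrDl addrACA.
- by move=> *; rewrite !mulrDr addrACA.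
- by move=> *; rewrite scalerA.
- by move=> *; rewrite scale1r.
- by move=> *; rewrite scalerDr.
- by move=> *; rewrite scalerDl.
- by move=> *; rewrite scalerDr !scalerAl.
- by move=> *; rewrite scalerDr !scalerAr.
Qed.

Definition palg_hpart (p : bool) (x : palg) : palg := aterm_hpart p (repr x).

Lemma palg_hpart_pi p t : palg_hpart p (\pi t) = aterm_hpart p t.
Proof. exact/aterm_hpart_cong/palg_repr. Qed.

Lemma palg_hpart_linear p : linear (palg_hpart p).
Proof.
move=> r; elim/quotW=> s; elim/quotW=> t.
rewrite -[X in X + _]pi_palg_scale -[X in palg_hpart p X]pi_palg_add.
by rewrite !palg_hpart_pi.
Qed.

Lemma palg_hpartM p x y : palg_hpart p (x * y) =
  palg_hpart false x * palg_hpart p y + palg_hpart true x * palg_hpart (~~ p) y.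
Proof.
elim/quotW: x => s; elim/quotW: y => t.
by rewrite -[X in palg_hpart p X]pi_palg_mul !palg_hpart_pi.
Qed.

HB.instance Definition _ p :=
  GRing.isLinear.Build R palg palg *:%R (palg_hpart p) (palg_hpart_linear p).

Lemma palg_hpartK p q x :
  palg_hpart p (palg_hpart q x) = if p == q then palg_hpart q x else 0.
Proof.
elim/quotW: x => t; rewrite palg_hpart_pi.
elim: t p q => /=.
- move=> g p q; case: ifP => [/eqP<-|_]; last by rewrite raddf0 if_same.
  by rewrite /pgen palg_hpart_pi /= eq_sym.
- by move=> p q; rewrite raddf0 if_same.
- by move=> p []; rewrite ?raddf0 ?if_same // palg_hpart_pi; case: p.
- by move=> t IH p q; rewrite raddfN /= IH; case: eqP; rewrite ?oppr0.
- by move=> s IHs t IHt p q; rewrite raddfD /= IHs IHt; case: eqP; rewrite ?addr0.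
- move=> s IHs t IHt p q; rewrite raddfD /= !palg_hpartM !IHs !IHt.
  by case: p; case: q; rewrite /= ?mul0r ?mulr0 ?addr0 ?add0r.
- by move=> r t IH p q; rewrite linearZ /= IH; case: eqP; rewrite ?scaler0.
Qed.

Lemma palg_hpartD x : palg_hpart false x + palg_hpart true x = x.
Proof.
elim/quotW: x => t; rewrite !palg_hpart_pi pi_aterm.
elim: t => //=.
- by move=> g; case: (sgdeg g); rewrite ?addr0 ?add0r.
- by rewrite addr0.
- by rewrite addr0.
- by move=> t <-; rewrite opprD.
- by move=> s <- t <-; rewrite addrACA.
- by move=> s <- t <-; rewrite mulrDl !mulrDr addrACA [X in _ + X]addrC.
- by move=> r t <-; rewrite scalerDr.
Qed.

HB.instance Definition _ := Lmodule_isSuper.Build R palg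
  palg_hpart_linear palg_hpartK palg_hpartD.

End PresentedAlgebra.

Lemma mulr_is_bilinear (R : comNzRingType) (A : algType R) :
  bilinear_for *:%R *:%R (@GRing.mul A).
Proof.
by split=> [z r x y|z r x y] /=; rewrite ?mulrDl ?mulrDr -?scalerAl -?scalerAr.
Qed.
HB.instance Definition _ (R : comNzRingType) (A : algType R) :=
  bilinear_isBilinear.Build R A A A *:%R *:%R (@GRing.mul A)
    (@mulr_is_bilinear R A).

Section SuperHopf.
Variables (R : comNzRingType) (B : superModType R).

Record is_superalgebra (mul : {bilinear B -> B -> B}) (one : B) : Prop := {
  smulA : associative mul;
  smul1l : left_id one mul;
  smul1r : right_id one mul;
  smul_even : even_bimap mul;
  sone_even : hpart false one = one
}.

Record is_supercoalgebra (Delta : {linear B -> (B ⊗ B)%type}) (eps : {scalar B}) :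
    Prop := {
  scoassoc : forall b,
    \sw_(x, y <- Delta b) \sw_(x1, x2 <- Delta x) x1 ⊗ (x2 ⊗ y) =
    \sw_(x, y <- Delta b) \sw_(y1, y2 <- Delta y) x ⊗ (y1 ⊗ y2);
  scounitl : forall b, \sw_(x, y <- Delta b) eps x *: y = b;
  scounitr : forall b, \sw_(x, y <- Delta b) eps y *: x = b;
  scomul_even : even_map Delta;
  scounit_even : even_form eps
}.

Record is_super_hopf (mul : {bilinear B -> B -> B}) (one : B)
    (Delta : {linear B -> (B ⊗ B)%type}) (eps : {scalar B}) (S : {linear B -> B}) :
    Prop := {
  shopf_alg : is_superalgebra mul one;
  shopf_coalg : is_supercoalgebra Delta eps;
  scomulM : forall a b, Delta (mul a b) =
    \sw_(a1, a2 <- Delta a) \sw_(b1, b2 <- Delta b)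
      (-1) ^+ (deg a2 * deg b1) *: (mul a1 b1 ⊗ mul a2 b2);
  scomul1 : Delta one = one ⊗ one;
  scounitM : forall a b, eps (mul a b) = eps a * eps b;
  scounit1 : eps one = 1;
  santipodel : forall b, \sw_(x, y <- Delta b) mul (S x) y = eps b *: one;
  santipoder : forall b, \sw_(x, y <- Delta b) mul x (S y) = eps b *: one;
  santipode_even : even_map S
}.

End SuperHopf.

Section ActionCoaction.
Variables (R : comNzRingType) (P Q : superPresentation R).
Local Notation H := (palg P).
Local Notation A := (palg Q).
Variables (DeltaH : {linear H -> (H ⊗ H)%type}) (epsH : {scalar H}).
Variables (DeltaA : {linear A -> (A ⊗ A)%type}) (epsA : {scalar A}).

Record is_module_superalgebra (act : {bilinear H -> A -> A}) : Prop := {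
  sact_even : even_bimap act;
  sact1 : forall a, act 1 a = a;
  sactM : forall (g h : H) a, act (g * h) a = act g (act h a);
  sact_mul : forall h (a b : A), homogeneous a ->
    act h (a * b) = \sw_(h1, h2 <- DeltaH h)
      (-1) ^+ (deg a * deg h2) *: (act h1 a * act h2 b);
  sact_one : forall h, act h 1 = epsH h *: 1
}.

Record is_comodule_supercoalgebra (nabla : {linear H -> (H ⊗ A)%type}) :
    Prop := {
  scoact_even : even_map nabla;
  scoact_coassoc : forall h,
    \sw_(x, y <- nabla h) \sw_(x1, x2 <- nabla x) x1 ⊗ (x2 ⊗ y) =
    \sw_(x, y <- nabla h) \sw_(y1, y2 <- DeltaA y) x ⊗ (y1 ⊗ y2);
  scoact_counit : forall h, \sw_(x, y <- nabla h) epsA y *: x = h;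
  scoact_comul : forall h,
    \sw_(x, y <- nabla h) \sw_(x1, x2 <- DeltaH x) x1 ⊗ (x2 ⊗ y) =
    \sw_(h1, h2 <- DeltaH h) \sw_(k1, k2 <- nabla h1) \sw_(l1, l2 <- nabla h2)
      (-1) ^+ (deg k2 * deg l1) *: (k1 ⊗ (l1 ⊗ (k2 * l2)));
  scoact_eps : forall h, \sw_(x, y <- nabla h) epsH x *: y = epsH h *: 1
}.

End ActionCoaction.

Inductive g1gen := GX | GY | GZ | GU | GV | GW.

Definition g1deg (x : g1gen) : bool :=
  match x with GX | GY | GZ => false | GU | GV | GW => true end.

Section G1.
Variable R : comNzRingType.
Local Notation tm := (aterm R g1gen).

(* Each unordered pair of basis elements is listed in one order only, the other
   bracket being determined by super antisymmetry. *)
Definition g1bracket (x y : g1gen) : option tm :=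
  match x, y with
  | GY, GX => Some (AGen GX)
  | GX, GZ => Some AZero
  | GY, GZ => Some AZero
  | GX, GU => Some AZero
  | GX, GV => Some (AOpp (AGen GW))
  | GX, GW => Some AZero
  | GY, GU => Some (AGen GU)
  | GY, GV => Some (AOpp (AGen GV))
  | GY, GW => Some AZero
  | GZ, GU => Some (AOpp (AGen GU))
  | GZ, GV => Some (AGen GV)
  | GZ, GW => Some (AGen GW)
  | GU, GV => Some (AOpp (AAdd (AGen GY) (AGen GZ)))
  | GU, GW => Some (AOpp (AGen GX))
  | GV, GW => Some AZero
  | GX, GX | GY, GY | GZ, GZ | GU, GU | GV, GV | GW, GW => Some AZero
  | _, _ => None
  end.

Definition supercommutator (G : Type) (gdeg : G -> bool) (x y : G) : aterm R G :=
  AAdd (AMul (AGen x) (AGen y))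
    (AOpp (AScale ((-1) ^+ (gdeg x * gdeg y)) (AMul (AGen y) (AGen x)))).

Lemma supercommutator_homog (G : Type) (gdeg : G -> bool) (x y : G) :
  aterm_homog gdeg (gdeg x (+) gdeg y) (supercommutator gdeg x y).
Proof.
apply: ahomog_add; first by apply: ahomog_mul; exact: ahomog_gen.
apply/ahomog_opp/ahomog_scale; rewrite addbC.
by apply: ahomog_mul; exact: ahomog_gen.
Qed.

Lemma supercommutator_aug (G : Type) (gdeg : G -> bool) (x y : G) :
  aterm_eval (fun _ => 0 : R^o) (supercommutator gdeg x y) = 0.
Proof. by rewrite /= mul0r scaler0 subr0. Qed.

Inductive g1rel : tm -> tm -> Prop :=
| G1rel x y z : g1bracket x y = Some z -> g1rel (supercommutator g1deg x y) z.

Lemma g1rel_homog s t : g1rel s t ->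
  exists p, aterm_homog g1deg p s /\ aterm_homog g1deg p t.
Proof.
case=> x y z xyz; exists (g1deg x (+) g1deg y).
split; first exact: supercommutator_homog.
have gen p u : g1deg u = p -> aterm_homog g1deg p (@AGen R _ u).
  by move=> <-; exact: ahomog_gen.
case: x xyz; case: y => //= -[<-];
  by do ?[exact: ahomog_zero|exact: gen|apply: ahomog_opp|apply: ahomog_add].
Qed.

Lemma g1rel_aug s t : g1rel s t ->
  aterm_eval (fun _ => 0 : R^o) s = aterm_eval (fun _ => 0 : R^o) t.
Proof.
case=> x y z xyz; rewrite supercommutator_aug.
by case: x xyz; case: y => //= -[<-]; rewrite /= ?addr0 ?oppr0.
Qed.

Definition G1presentation : superPresentation R :=
  SuperPresentation g1rel_homog g1rel_aug.

End G1.

Notation UG1 R := (palg (G1presentation R)).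

Section UG1.
Variable R : comNzRingType.
Local Notation H := (UG1 R).

Definition g1 (x : g1gen) : H := @pgen R (G1presentation R) x.

Record is_UG1_hopf (Delta : {linear H -> (H ⊗ H)%type}) (eps : {scalar H})
    (S : {linear H -> H}) : Prop := {
  UG1_hopf : @is_super_hopf R H *%R 1 Delta eps S;
  UG1_primitive : forall x, Delta (g1 x) = g1 x ⊗ 1 + 1 ⊗ g1 x
}.

End UG1.

(* [Ga m], [Gb m], [Gc m], [Gd m] stand for a_(m+2), b_(m+1), c_(m+2), d_(m+1). *)
Inductive G2gen := Ga of nat | Gb of nat | Gc of nat | Gd of nat.

Definition G2deg (x : G2gen) : bool :=
  match x with Ga _ | Gd _ => false | Gb _ | Gc _ => true end.

Section G2.
Variable R : comNzRingType.
Local Notation tm := (aterm R G2gen).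

Inductive G2rel : tm -> tm -> Prop :=
| G2comm x y : G2rel (supercommutator R G2deg x y) AZero.

Lemma G2rel_homog s t : G2rel s t ->
  exists p, aterm_homog G2deg p s /\ aterm_homog G2deg p t.
Proof.
case=> x y; exists (G2deg x (+) G2deg y).
by split; [exact: supercommutator_homog|exact: ahomog_zero].
Qed.

Lemma G2rel_aug s t : G2rel s t ->
  aterm_eval (fun _ => 0 : R^o) s = aterm_eval (fun _ => 0 : R^o) t.
Proof. by case=> x y; rewrite supercommutator_aug. Qed.

Definition G2presentation : superPresentation R :=
  SuperPresentation G2rel_homog G2rel_aug.

End G2.

Notation FG2 R := (palg (G2presentation R)).

Section FG2.
Variable R : comNzRingType.
Local Notation A := (FG2 R).

Definition g2 (x : G2gen) : A := @pgen R (G2presentation R) x.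

Definition a_ (n : nat) : A :=
  match n with 0 => 0 | 1 => 1 | m.+2 => g2 (Ga m) end.
Definition b_ (n : nat) : A :=
  match n with 0 => 0 | m.+1 => g2 (Gb m) end.
Definition c_ (n : nat) : A :=
  match n with 0 | 1 => 0 | m.+2 => g2 (Gc m) end.
Definition d_ (n : nat) : A :=
  match n with 0 => 1 | m.+1 => g2 (Gd m) end.

Definition p_ (k i : nat) : A :=
  \sum_(l : {ffun 'I_k -> 'I_i.+1} |
      [forall j, 1 <= l j]%N && (\sum_j l j == i)%N) \prod_j a_ (l j).

Record is_FG2_hopf (Delta : {linear A -> (A ⊗ A)%type}) (eps : {scalar A})
    (S : {linear A -> A}) : Prop := {
  FG2_hopf : @is_super_hopf R A *%R 1 Delta eps S;
  FG2_counit : forall x, eps (g2 x) = 0;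
  FG2_comul_a : forall n, (2 <= n)%N -> Delta (a_ n) =
    \sum_(1 <= k < n.+1) a_ k ⊗ p_ k n +
    \sum_(1 <= i < n.+1) \sum_(1 <= k < i.+1) b_ k ⊗ (p_ k i * c_ (n - i));
  FG2_comul_b : forall n, (1 <= n)%N -> Delta (b_ n) =
    1 ⊗ b_ n +
    \sum_(1 <= i < n.+1) \sum_(1 <= k < i.+1)
      (a_ k.+1 *+ k.+1) ⊗ (p_ k i * b_ (n - i)) +
    \sum_(1 <= i < n.+1) \sum_(1 <= k < i.+1) b_ k ⊗ (p_ k i * d_ (n - i)) -
    \sum_(1 <= i < n.+1) (b_ 1 ⊗ (b_ i * c_ (n - i)) +
      \sum_(1 <= j < i.+1) \sum_(1 <= k < j.+1)
        (b_ k.+1 *+ k.+1) ⊗ (p_ k j * b_ (i - j) * c_ (n - i)));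
  FG2_comul_c : forall n, (2 <= n)%N -> Delta (c_ n) =
    1 ⊗ c_ n +
    \sum_(1 <= k < n.+1) c_ k ⊗ p_ k n +
    \sum_(1 <= i < n.+1) \sum_(1 <= k < i.+1) d_ k ⊗ (p_ k i * c_ (n - i));
  FG2_comul_d : forall n, (1 <= n)%N -> Delta (d_ n) =
    1 ⊗ d_ n +
    \sum_(1 <= i < n.+1) \sum_(1 <= k < i.+1)
      (c_ k.+1 *+ k.+1) ⊗ (p_ k i * b_ (n - i)) +
    \sum_(1 <= i < n.+1) \sum_(1 <= k < i.+1) d_ k ⊗ (p_ k i * d_ (n - i)) -
    \sum_(1 <= i < n.+1) (d_ 1 ⊗ (b_ i * c_ (n - i)) +
      \sum_(1 <= j < i.+1) \sum_(1 <= k < j.+1)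
        (d_ k.+1 *+ k.+1) ⊗ (p_ k j * b_ (i - j) * c_ (n - i)))
}.

End FG2.

Section G1G2.
Variable R : comNzRingType.
Local Notation H := (UG1 R).
Local Notation A := (FG2 R).
Local Notation a_ := (@a_ R).
Local Notation b_ := (@b_ R).
Local Notation c_ := (@c_ R).
Local Notation d_ := (@d_ R).
Local Notation X := (g1 R GX).
Local Notation Y := (g1 R GY).
Local Notation Z := (g1 R GZ).
Local Notation U := (g1 R GU).
Local Notation V := (g1 R GV).
Local Notation W := (g1 R GW).
Variables (DeltaH : {linear H -> (H ⊗ H)%type}) (epsH : {scalar H}).
Variables (DeltaA : {linear A -> (A ⊗ A)%type}) (epsA : {scalar A}).

Record is_G1_action (act : {bilinear H -> A -> A}) : Prop := {
  G1_module_algebra : is_module_superalgebra DeltaH epsH act;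
  act_Xa : forall n, (2 <= n)%N ->
    act X (a_ n) = a_ n.+1 *+ n.+1 - a_ n * a_ 2 *+ 2 - b_ 1 * c_ n;
  act_Xb : forall n, (1 <= n)%N ->
    act X (b_ n) = b_ n.+1 *+ n.+1 - b_ n * a_ 2 *+ 2 - b_ 1 * d_ n;
  act_Xc : forall n, (2 <= n)%N ->
    act X (c_ n) = - (c_ 2 * a_ n *+ 2) + c_ n.+1 *+ n.+1 - c_ n * d_ 1;
  act_Xd : forall n, (1 <= n)%N ->
    act X (d_ n) = - (c_ 2 * b_ n *+ 2) + d_ n.+1 *+ n.+1 - d_ n * d_ 1;
  act_Ya : forall n, (2 <= n)%N -> act Y (a_ n) = a_ n *+ (n - 1);
  act_Yb : forall n, (1 <= n)%N -> act Y (b_ n) = b_ n *+ (n - 1);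
  act_Yc : forall n, (2 <= n)%N -> act Y (c_ n) = c_ n *+ n;
  act_Yd : forall n, (1 <= n)%N -> act Y (d_ n) = d_ n *+ n;
  act_Za : forall n, (2 <= n)%N -> act Z (a_ n) = 0;
  act_Zb : forall n, (1 <= n)%N -> act Z (b_ n) = b_ n;
  act_Zc : forall n, (2 <= n)%N -> act Z (c_ n) = - c_ n;
  act_Zd : forall n, (1 <= n)%N -> act Z (d_ n) = 0;
  act_Ua : forall n, (2 <= n)%N -> act U (a_ n) = c_ n;
  act_Ub : forall n, (1 <= n)%N -> act U (b_ n) = - (a_ n.+1 *+ n.+1) + d_ n;
  act_Uc : forall n, (2 <= n)%N -> act U (c_ n) = 0;
  act_Ud : forall n, (1 <= n)%N -> act U (d_ n) = c_ n.+1 *+ n.+1;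
  act_Va : forall n, (2 <= n)%N -> act V (a_ n) = b_ (n - 1);
  act_Vb : forall n, (1 <= n)%N -> act V (b_ n) = 0;
  act_Vc : forall n, (2 <= n)%N -> act V (c_ n) = a_ n - d_ (n - 1);
  act_Vd : forall n, (1 <= n)%N -> act V (d_ n) = b_ n;
  act_Wa : forall n, (2 <= n)%N -> act W (a_ n) = - (b_ 1 * a_ n) + b_ n;
  act_Wb : forall n, (1 <= n)%N -> act W (b_ n) = - (b_ 1 * b_ n);
  act_Wc : forall n, (2 <= n)%N -> act W (c_ n) = d_ 1 * a_ n - d_ n;
  act_Wd : forall n, (1 <= n)%N -> act W (d_ n) = d_ 1 * b_ n
}.

Record is_G2_coaction (act : {bilinear H -> A -> A})
    (nabla : {linear H -> (H ⊗ A)%type}) : Prop := {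
  G2_comodule_coalgebra :
    is_comodule_supercoalgebra DeltaH epsH DeltaA epsA nabla;
  nabla_X : nabla X =
    (Y *+ 2) ⊗ a_ 2 + X ⊗ 1 + Z ⊗ d_ 1 + U ⊗ b_ 1 + (V *+ 2) ⊗ c_ 2;
  nabla_Y : nabla Y = Y ⊗ 1;
  nabla_Z : nabla Z = Z ⊗ 1;
  nabla_U : nabla U = U ⊗ 1;
  nabla_V : nabla V = V ⊗ 1;
  nabla_W : nabla W = Y ⊗ b_ 1 + V ⊗ d_ 1 + W ⊗ 1;
  nabla_1 : nabla 1 = 1 ⊗ 1;
  nabla_M : forall g h, nabla (g * h) =
    \sw_(g1, g2 <- DeltaH g) \sw_(k1, k2 <- nabla g1) \sw_(h1, h2 <- nabla h)
      (-1) ^+ (deg h1 * (deg k2 + deg g2)) *: ((k1 * h1) ⊗ (k2 * act g2 h2))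
}.

End G1G2.

(* Main.v *)
Require Import Defs.
From HB Require Import structures.
From mathcomp Require Import all_boot all_order all_algebra.
From mathcomp Require Import boolp reals.

Set Implicit Arguments.
Unset Strict Implicit.
Unset Printing Implicit Defensive.
Import GRing.Theory Num.Theory.
Local Open Scope ring_scope.

(* The smash product M = A # H, with A = F(G) and H = U(g), is generated by A
   and the primitive generators x of H, with x a = (x |> a) +- a x.  The coproduct
   sends a to Delta(a) and x to delta(x) = nabla(x) + 1 ⊗ x in M ⊗ M; it is
   multiplicative once the supercommutator of delta(x) and Delta(a) is
   Delta(x |> a).  As A is supercommutative, both are superderivations in a, so
   that only generators a matter.  Coassociativity and the counit axioms compare
   algebra maps and are checked on generators too; the compatibility of action
   and coaction follows from the super cocommutativity of H.
   Put a = sum a_n t^n and so on.  Every coproduct is a combination of series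
   sum_k f_k ⊗ a^k s, on which the generators of H act by the chain rule.  Since
   t b = V |> a, c = U |> a, t d = a - V |> c and X = -(U W + W U), the brackets of
   H reduce the verification to the pairs (V, a), (V, c), (U, a), (W, a), (W, c),
   (Y, a), (Z, a). *)

(** * Super modules and their tensor products *)

(** The Koszul signs of the statement depend on [deg], which is not linear. They are therefore built
    into bilinear maps on whole tensors by splitting one factor into even and odd parts. Identities
    are then checked on homogeneous pure tensors, where comparing signs is a finite case analysis. H
    enters only as an algebra generated by homogeneous primitive elements whose coaction stays in
    the span of the generators tensored with A; no basis of either algebra is used. The pairs
    computed directly are those that the brackets cannot supply. If x y = ± y x + z, the pair (x, y
    |> u) follows from x, y, z on u and from y on x |> u. Since c = U |> a, the pair (V, c) would
    lead back to (U, b), which is itself deduced from (V, c); and (W, c) would call for X on a,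
    which is obtained from U and W. Writing X as a bracket avoids comparing its five-term coaction
    with its quadratic action. Division by 2 enters through U U = 0, V V = 0 and c c = 0. *)

Section Parity.
Variables (R : comNzRingType) (V : superModType R).

Definition par (p : bool) (v : V) : Prop := hpart p v = v.

Lemma par_hpart p v : par p (hpart p v).
Proof. by rewrite /par hpartK eqxx. Qed.

Lemma par0 p : par p 0. Proof. exact: linear0. Qed.

Lemma parP p r u v : par p u -> par p v -> par p (r *: u + v).
Proof. by rewrite /par linearP /= => -> ->. Qed.

Lemma parD p u v : par p u -> par p v -> par p (u + v).
Proof. by rewrite /par linearD /= => -> ->. Qed.

Lemma parZ p r u : par p u -> par p (r *: u).
Proof. by rewrite /par linearZ /= => ->. Qed.

Lemma par_off p v : par p v -> hpart (~~ p) v = 0.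
Proof. by move=> <-; rewrite hpartK; case: p. Qed.

Lemma deg_par p v : par p v -> par (deg v) v.
Proof.
rewrite /deg; have [->|v0] := eqVneq v 0; first by move=> _; exact: par0.
case: p => pv /=; first by rewrite pv eqxx.
by have := par_off pv => /= ->; rewrite eq_sym (negPf v0).
Qed.

Lemma homogP v : homogeneous v -> par (deg v) v.
Proof. by case=> p; exact: deg_par. Qed.

(** The grading involution, (-1)^{|v|} v on homogeneous [v]. Being linear, it can carry a Koszul
    sign where [deg] cannot. *)
Definition sinv v : V := hpart false v - hpart true v.

Lemma sinv_linear : linear sinv.
Proof. by move=> r u v; rewrite /sinv !linearP /= scalerDr addrACA. Qed.
HB.instance Definition _ := GRing.isLinear.Build R V V *:%R sinv sinv_linear.

Lemma sinv_par p v : par p v -> sinv v = (-1) ^+ p *: v.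
Proof.
move=> pv; rewrite /sinv; move: (par_off pv) (pv).
by case: p {pv} => /= -> ->; rewrite ?sub0r ?subr0 ?scale1r ?scaleN1r.
Qed.

End Parity.

Section TensorExtras.
Variables (R : comNzRingType).

Lemma par_tens (V W : superModType R) p q (v : V) (w : W) :
  par p v -> par q w -> par (p (+) q) (v ⊗ w).
Proof.
move=> pv qw; rewrite /par [LHS]tensor_hpart_tens.
move: (par_off pv) (par_off qw) (pv) (qw); rewrite -/par.
by case: p {pv}; case: q {qw} => /= e1 e2 e3 e4;
  rewrite ?e1 ?e2 ?e3 ?e4 ?linear0l ?linear0r ?addr0 ?add0r.
Qed.

Lemma tens_hind (V W : superModType R) (P : V ⊗ W -> Prop) :
  (forall p q v w, par p v -> par q w -> P (v ⊗ w)) ->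
  (forall r x y, P x -> P y -> P (r *: x + y)) -> forall x, P x.
Proof.
move=> Pt PD; apply: tensor_ind => // v w.
have PDD x y : P x -> P y -> P (x + y).
  by move=> Px Py; rewrite -[x]scale1r; exact: PD.
rewrite -[v]hpartD -[w]hpartD linearDl !linearDr /=.
by apply: (PDD); apply: (PDD); apply: (Pt); exact: par_hpart.
Qed.

(** A decomposition of a tensor of parity [s] may contain pure tensors of the other parity. Proving
    the property of [hpart s x] for every [x] removes them, since the projection sends them to 0. *)
Lemma tens_pind (V W : superModType R) (P : V ⊗ W -> Prop) s :
  (forall p q v w, par p v -> par q w -> p (+) q = s -> P (v ⊗ w)) ->
  (forall r x y, P x -> P y -> P (r *: x + y)) ->
  forall x, par s x -> P x.
Proof.
move=> Pt PD.
suff H x : P (hpart s x) by move=> x <-.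
elim/tens_hind: x => [p q v w pv qw|r x y Px Py]; last first.
  by rewrite linearP; exact: PD.
have [e|ne] := eqVneq (p (+) q) s.
  by rewrite -e [hpart _ _]par_tens //; exact: Pt pv qw e.
have -> : hpart s (v ⊗ w) = 0.
  have -> : s = ~~ (p (+) q) by move: ne; case: s {Pt} (p (+) q) => [] [].
  exact/par_off/par_tens.
have -> : 0 = (0 : V) ⊗ hpart s (0 : W) by rewrite linear0l.
by apply: (Pt false s); [exact: par0|exact: par_hpart|].
Qed.

Definition tl (V W M : lmodType R) (f : {bilinear V -> W -> M}) := tlift f.
Section Tl.
Variables (V W M : lmodType R) (f : {bilinear V -> W -> M}).

Lemma bilinearP : bilinear_for *:%R *:%R f.
Proof. by split=> [w r v v'|v r w w'] /=; rewrite ?linearPl ?linearPr. Qed.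

Lemma tl_linear : linear (tl f).
Proof. exact/tlift_linear/bilinearP. Qed.
HB.instance Definition _ := GRing.isLinear.Build R (V ⊗ W)%type M *:%R (tl f)
  tl_linear.

Lemma tlE v w : tl f (v ⊗ w) = f v w.
Proof. exact/tlift_tens/bilinearP. Qed.
End Tl.

(** [F] need not be bilinear: a Sweedler sum runs over a chosen representative of [t], and [f]
    passes through it term by term. This is what allows [F] to contain signs and nested sums. *)
Lemma sw_linear (V W : superModType R) (M N : lmodType R) (f : M -> N)
    (t : V ⊗ W) (F : V -> W -> M) : linear f ->
  f (sweedler t F) = sweedler t (fun x y => f (F x y)).
Proof.
move=> lf.
have f0 : f 0 = 0.
  by have := lf (-1) 0 0; rewrite scaler0 addr0 scaleN1r addNr.
have fD u v : f (u + v) = f u + f v by rewrite -[u]scale1r lf !scale1r.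
have fZ r u : f (r *: u) = r *: f u by rewrite -[r *: u]addr0 lf f0 addr0.
have fN u : f (- u) = - f u by rewrite -scaleN1r fZ scaleN1r.
rewrite /sweedler /tlift; elim: (repr t) => //=.
- by move=> v w; rewrite !big_bool /= !fD.
- by move=> s; rewrite fN => ->.
- by move=> s IHs s' IHs'; rewrite fD IHs IHs'.
- by move=> r s; rewrite fZ => ->.
Qed.

Lemma eq_sw (V W : superModType R) (M : lmodType R) (t : V ⊗ W)
    (F G : V -> W -> M) :
  (forall x y, par (deg x) x -> par (deg y) y -> F x y = G x y) ->
  sweedler t F = sweedler t G.
Proof.
move=> FG; congr (tlift _ t); apply/funext => v; apply/funext => w.
apply: eq_bigr => p _; apply: eq_bigr => q _.
by apply: FG; apply: deg_par; exact: par_hpart.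
Qed.

Lemma sw_tens (V W : superModType R) (t : V ⊗ W) : \sw_(x, y <- t) x ⊗ y = t.
Proof.
rewrite -(@eq_sw _ _ _ t (fun v w => tl (@tens R V W) (v ⊗ w))); last first.
  by move=> x y _ _; rewrite tlE.
pose F := fun (_ _ : bool) (v : V) (w : W) => v ⊗ w.
have Fb p q : bilinear_for *:%R *:%R (F p q) by exact: tens_is_bilinear.
rewrite (@eq_sw _ _ _ t _ (fun v w => v ⊗ w)); last by move=> *; rewrite tlE.
elim/tensor_ind: t => [v w|r x y IHx IHy].
  rewrite (sweedler_tens Fb) !big_bool /= /F -!linearDr -linearDl /=.
  by rewrite [hpart true v + _]addrC [hpart true w + _]addrC !hpartD.
by rewrite (sweedler_linear Fb) IHx IHy.
Qed.

(** The bridge between the two languages: it unfolds a linear map on tensors into a Sweedler sum,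
    and is used in both directions throughout. *)
Lemma swE (V W : superModType R) (M : lmodType R) (f : V ⊗ W -> M) t :
  linear f -> f t = \sw_(x, y <- t) f (x ⊗ y).
Proof. by move=> lf; rewrite -sw_linear // sw_tens. Qed.

End TensorExtras.
Ltac sgn := by rewrite /= ?(mul0n, mul1n, muln0, muln1, add0n, addn0, exprD,
  expr0, expr1, mulr1, mul1r, mulrN, mulNr, opprK).

(** Reduces linearity of [tlift f x] in a parameter of [f] to the case of pure tensors; this is how
    the nested lifts below are shown to be bilinear. *)
Lemma tlift_comb (R : comNzRingType) (V W M : lmodType R) (f g h : V -> W -> M) r :
  bilinear_for *:%R *:%R f -> bilinear_for *:%R *:%R g ->
  bilinear_for *:%R *:%R h -> (forall v w, f v w = r *: g v w + h v w) ->
  forall x, tlift f x = r *: tlift g x + tlift h x.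
Proof.
move=> bf bg bh fgh; elim/tensor_ind=> [v w|s x y IHx IHy].
  by rewrite !tlift_tens.
rewrite !tlift_linear // IHx IHy !scalerDr !scalerA [r * s]mulrC.
by rewrite addrACA.
Qed.

(* [(m ⊗ n) (v ⊗ w) = (-1) ^ (|n| |v|) (m v) ⊗ (n w)] *)
Section TensorAction.
Variables (R : comNzRingType) (M N V W V' W' : superModType R).
Variables (al : {bilinear M -> V -> V'}) (be : {bilinear N -> W -> W'}).

(** The sign occurs only for odd [n], so [n] is split into its two parts and [v] is twisted by
    [sinv] against the odd one. The result is linear in each of the four arguments, homogeneous or
    not. *)
Definition tact_pure (m : M) (n : N) (v : V) (w : W) : V' ⊗ W' :=
  al m v ⊗ be (hpart false n) w + al m (sinv v) ⊗ be (hpart true n) w.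

Lemma tact_pure_bilinear m n : bilinear_for *:%R *:%R (tact_pure m n).
Proof.
split=> [w r v v'|v r w w'] /=; rewrite /tact_pure.
  by rewrite [sinv _]linearP !linearPr !linearPl /= scalerDr addrACA.
by rewrite !linearP !linearPr /= scalerDr addrACA.
Qed.

Lemma tact_pure_bilinearl y : bilinear_for *:%R *:%R
  (fun m n => tlift (tact_pure m n) y).
Proof.
split=> [n r m m'|m r n n'] /=;
  (apply: tlift_comb; [exact: tact_pure_bilinear..|]) => v w;
  rewrite /tact_pure.
  by rewrite !linearPl scalerDr addrACA.
by rewrite !linearP !linearPl !linearPr scalerDr addrACA.
Qed.

Definition tact (x : M ⊗ N) (y : V ⊗ W) : V' ⊗ W' :=
  tlift (fun m n => tlift (tact_pure m n) y) x.

Lemma tact_pureE m n v w : tact (m ⊗ n) (v ⊗ w) = tact_pure m n v w.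
Proof.
rewrite /tact (tlift_tens (tact_pure_bilinearl _)).
by rewrite (tlift_tens (tact_pure_bilinear _ _)).
Qed.

Lemma tact_is_bilinear : bilinear_for *:%R *:%R tact.
Proof.
split=> [y r x x'|x r y y'] /=.
  exact: (tlift_linear (tact_pure_bilinearl y)).
apply: tlift_comb; [exact: tact_pure_bilinearl..|] => m n.
exact: (tlift_linear (tact_pure_bilinear m n)).
Qed.
HB.instance Definition _ := bilinear_isBilinear.Build R (M ⊗ N)%type
  (V ⊗ W)%type (V' ⊗ W')%type *:%R *:%R tact tact_is_bilinear.

Lemma tactE p q m n v w : par p n -> par q v ->
  tact (m ⊗ n) (v ⊗ w) = (-1) ^+ (p * q) *: (al m v ⊗ be n w).
Proof.
move=> pn qv; rewrite tact_pureE /tact_pure (sinv_par qv) linearZr /=.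
rewrite linearZl_LR /=; move: (par_off pn) (pn); rewrite /par.
case: p {pn} => /= -> ->; rewrite !linear0l !linear0r.
  by rewrite add0r mul1n.
by rewrite scaler0 addr0 mul0n scale1r.
Qed.

Lemma tact_even : even_bimap al -> even_bimap be -> even_bimap tact.
Proof.
move=> ea eb p q x y px qy; rewrite -/(par _ _).
move: y qy; apply: tens_pind => [q1 q2 v w h1 h2 <-|r y y' Py Py']; last first.
  by rewrite linearPr; exact: parP.
move: x px; apply: tens_pind => [p1 p2 m n k1 k2 <-|r x x' Px Px']; last first.
  by rewrite linearPl; exact: parP.
rewrite (tactE _ _ k2 h1); apply: parZ; rewrite addbACA.
by apply: par_tens; [exact: ea|exact: eb].
Qed.

Lemma tact_sw s t : tact s t = \sw_(m, n <- s) \sw_(v, w <- t)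
  (-1) ^+ (deg n * deg v) *: (al m v ⊗ be n w).
Proof.
rewrite (@swE _ _ _ _ (tact^~ t)); last by move=> r x y; rewrite linearPl.
apply: eq_sw => m n pm pn; rewrite (@swE _ _ _ _ (tact (m ⊗ n))).
  by apply: eq_sw => v w pv pw; rewrite (tactE _ _ pn pv).
by move=> r x y; rewrite linearPr.
Qed.
End TensorAction.
Arguments tactE {R M N V W V' W' al be p q m n v w}.

Section TensorActionAssoc.
Variables (R : comNzRingType).
Variables (M1 M2 M12 V V2 V12 N1 N2 N12 W W2 W12 : superModType R).
Variables (a1 : {bilinear M1 -> M2 -> M12}) (a2 : {bilinear M12 -> V -> V12}).
Variables (a3 : {bilinear M2 -> V -> V2}) (a4 : {bilinear M1 -> V2 -> V12}).
Variables (b1 : {bilinear N1 -> N2 -> N12}) (b2 : {bilinear N12 -> W -> W12}).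
Variables (b3 : {bilinear N2 -> W -> W2}) (b4 : {bilinear N1 -> W2 -> W12}).

(** On the left the parity of [b1 n n'] decides the sign, on the right that of [a3 m' v]; these are
    the two maps required to be even. *)
Lemma tactA : even_bimap a3 -> even_bimap b1 ->
  (forall m m' v, a2 (a1 m m') v = a4 m (a3 m' v)) ->
  (forall n n' w, b2 (b1 n n') w = b4 n (b3 n' w)) ->
  forall x y z, tact a2 b2 (tact a1 b1 x y) z = tact a4 b4 x (tact a3 b3 y z).
Proof.
move=> ea eb assa assb x y z.
elim/tens_hind: x => [p1 p2 m n pm pn|r x x' Px Px']; last first.
  by rewrite !linearPl /= Px Px'.
elim/tens_hind: y => [q1 q2 m' n' qm qn|r x x' Px Px']; last first.
  by rewrite !(linearPr, linearPl) /= Px Px'.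
elim/tens_hind: z => [r1 r2 v w rv rw|r x x' Px Px']; last first.
  by rewrite !linearPr /= Px Px'.
rewrite (tactE pn qm) (tactE qn rv) linearZl_LR linearZr /=.
rewrite (tactE (eb _ _ _ _ pn qn) rv) (tactE pn (ea _ _ _ _ qm rv)).
rewrite assa assb !scalerA; congr (_ *: _).
by case: p2 {pn}; case: q1 {qm}; case: q2 {qn}; case: r1 {rv};
  sgn.
Qed.
End TensorActionAssoc.

(** * Tensor products of maps and reassociation *)

Section TensorMap.
Variables (R : comNzRingType).

Section Lmod.
Variables (V W V' W' : lmodType R) (f : {linear V -> V'}) (g : {linear W -> W'}).

Definition tmap_pure v w := f v ⊗ g w.
Lemma tmap_bilinear : bilinear_for *:%R *:%R tmap_pure.
Proof.
by split=> [w r v v'|v r w w'] /=; rewrite /tmap_pure linearP ?linearPl ?linearPr.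
Qed.
Definition tmap (x : V ⊗ W) : V' ⊗ W' := tlift tmap_pure x.
Lemma tmap_linear : linear tmap. Proof. exact: (tlift_linear tmap_bilinear). Qed.
HB.instance Definition _ := GRing.isLinear.Build R (V ⊗ W)%type (V' ⊗ W')%type
  *:%R tmap tmap_linear.
Lemma tmapE v w : tmap (v ⊗ w) = f v ⊗ g w.
Proof. exact: (tlift_tens tmap_bilinear). Qed.
End Lmod.

Lemma tmap_even (V W V' W' : superModType R) (f : {linear V -> V'})
    (g : {linear W -> W'}) : even_map f -> even_map g -> even_map (tmap f g).
Proof.
move=> ef eg p; elim/tensor_ind=> [v w|r x y Px Py]; last first.
  by rewrite !linearP /= Px Py.
rewrite [hpart p (v ⊗ w)]tensor_hpart_tens linearD /= !tmapE.
by rewrite [hpart p (_ ⊗ _)]tensor_hpart_tens !ef !eg.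
Qed.

Lemma tmap_tact (M N V W V' W' M2 N2 V2 W2 V2' W2' : superModType R)
    (al : {bilinear M -> V -> V'}) (be : {bilinear N -> W -> W'})
    (al2 : {bilinear M2 -> V2 -> V2'}) (be2 : {bilinear N2 -> W2 -> W2'})
    (f : {linear V' -> V2'}) (f1 : {linear M -> M2}) (f2 : {linear V -> V2})
    (g : {linear W' -> W2'}) (g1 : {linear N -> N2}) (g2 : {linear W -> W2}) :
  even_map f2 -> even_map g1 ->
  (forall m v, f (al m v) = al2 (f1 m) (f2 v)) ->
  (forall n w, g (be n w) = be2 (g1 n) (g2 w)) ->
  forall x y, tmap f g (tact al be x y) =
    tact al2 be2 (tmap f1 g1 x) (tmap f2 g2 y).
Proof.
move=> ef eg fM gM x y.
elim/tens_hind: x => [p1 p2 m n pm pn|r x x' Px Px']; last first.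
  by rewrite linearPl !linearP linearPl /= Px Px'.
elim/tens_hind: y => [q1 q2 v w qv qw|r x x' Px Px']; last first.
  by rewrite linearPr !linearP linearPr /= Px Px'.
rewrite (tactE pn qv) linearZ /= !tmapE fM gM.
by rewrite (@tactE _ _ _ _ _ _ _ _ _ p2 q1) // /par -?eg -?ef ?pn ?qv.
Qed.

Lemma even_mapP (V W : superModType R) (f : {linear V -> W}) :
  (forall p v, par p v -> par p (f v)) -> even_map f.
Proof.
move=> fP p v; rewrite -[v in RHS]hpartD !linearD /=.
have e q : hpart q (f (hpart q v)) = f (hpart q v) by apply/fP/par_hpart.
have ne q : hpart (~~ q) (f (hpart q v)) = 0 by apply/par_off/fP/par_hpart.
by case: p; rewrite e ?(ne false) ?(ne true) ?addr0 ?add0r.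
Qed.

Section Assoc.
Variables (U V W : lmodType R).

Definition tassoc1 (t : U ⊗ V) (w : W) : (U ⊗ (V ⊗ W))%type :=
  tlift (fun u v => u ⊗ (v ⊗ w)) t.
Lemma tassoc1_pure (w : W) : bilinear_for *:%R *:%R (fun (u : U) (v : V) => u ⊗ (v ⊗ w)).
Proof. by split=> [v r u u'|u r v v'] /=; rewrite !(linearPl, linearPr). Qed.
Lemma tassoc1_bilinear : bilinear_for *:%R *:%R tassoc1.
Proof.
split=> [w r t t'|t r w w'] /=; first exact: (tlift_linear (tassoc1_pure w)).
by apply: tlift_comb; [exact: tassoc1_pure..|] => u v; rewrite !linearPr.
Qed.
Definition tassoc (x : ((U ⊗ V) ⊗ W)%type) : (U ⊗ (V ⊗ W))%type := tlift tassoc1 x.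
Lemma tassoc_linear : linear tassoc.
Proof. exact: (tlift_linear tassoc1_bilinear). Qed.
HB.instance Definition _ := GRing.isLinear.Build R ((U ⊗ V) ⊗ W)%type
  (U ⊗ (V ⊗ W))%type *:%R tassoc tassoc_linear.
Lemma tassocE u v w : tassoc (u ⊗ v ⊗ w) = u ⊗ (v ⊗ w).
Proof.
rewrite /tassoc (tlift_tens tassoc1_bilinear) /tassoc1.
exact: (tlift_tens (tassoc1_pure w)).
Qed.
End Assoc.

Lemma tensor3_hind (U V W : superModType R) (P : ((U ⊗ V) ⊗ W)%type -> Prop) :
  (forall p q s u v w, par p u -> par q v -> par s w -> P (u ⊗ v ⊗ w)) ->
  (forall r x y, P x -> P y -> P (r *: x + y)) -> forall x, P x.
Proof.
move=> Pt PD; elim/tens_hind=> [p q t w _ qw|]; last exact: PD.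
elim/tens_hind: t => [p1 p2 u v pu pv|r x y Px Py]; first exact: (Pt p1 p2 q).
by rewrite linearPl; exact: PD.
Qed.

Lemma tassoc_tact (M1 M2 M3 V1 V2 V3 W1 W2 W3 : superModType R)
    (a : {bilinear M1 -> V1 -> W1}) (b : {bilinear M2 -> V2 -> W2})
    (c : {bilinear M3 -> V3 -> W3}) x y :
  tassoc (tact (tact a b) c x y) = tact a (tact b c) (tassoc x) (tassoc y).
Proof.
elim/tensor3_hind: x => [p1 p2 p3 m1 m2 m3 h1 h2 h3|r x x' Px Px']; last first.
  by rewrite linearPl !linearP linearPl /= Px Px'.
elim/tensor3_hind: y => [q1 q2 q3 v1 v2 v3 k1 k2 k3|r x x' Px Px']; last first.
  by rewrite linearPr !linearP linearPr /= Px Px'.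
rewrite (tactE h3 (par_tens k1 k2)) /= (tactE h2 k1) linearZl_LR !linearZ /=.
rewrite !tassocE (tactE (par_tens h2 h3) k1) /= (tactE h3 k2).
rewrite linearZr !scalerA; congr (_ *: _).
by case: p2 {h2}; case: p3 {h3}; case: q1 {k1}; case: q2 {k2};
  sgn.
Qed.

Lemma tassoc_tmap (U V W U' V' W' : lmodType R) (f : {linear U -> U'})
    (g : {linear V -> V'}) (h : {linear W -> W'}) x :
  tassoc (tmap (tmap f g) h x) = tmap f (tmap g h) (tassoc x).
Proof.
elim/tensor_ind: x => [t w|r x y Px Py]; last by rewrite !linearP /= Px Py.
elim/tensor_ind: t => [u v|r x y Px Py]; last by rewrite !(linearPl, linearP) /= Px Py.
by rewrite tassocE !tmapE /= tmapE tassocE tmapE.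
Qed.

End TensorMap.
Section Contraction.
Variables (R : comNzRingType) (V W : lmodType R).

Definition contrl (e : {scalar V}) (t : V ⊗ W) : W := tlift (fun x y => e x *: y) t.
Definition contrr (e : {scalar W}) (t : V ⊗ W) : V := tlift (fun x y => e y *: x) t.

Lemma contrl_bilinear (e : {scalar V}) :
  bilinear_for *:%R *:%R (fun x (y : W) => e x *: y).
Proof.
split=> [w r v v'|v r w w'] /=.
  by rewrite linearP scalerDl scalerA.
by rewrite linearP.
Qed.

Lemma contrr_bilinear (e : {scalar W}) :
  bilinear_for *:%R *:%R (fun (x : V) y => e y *: x).
Proof.
split=> [w r v v'|v r w w'] /=; first by rewrite linearP.
by rewrite linearP scalerDl scalerA.
Qed.

Lemma contrl_linear e : linear (contrl e).
Proof. exact/tlift_linear/contrl_bilinear. Qed.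
Lemma contrr_linear e : linear (contrr e).
Proof. exact/tlift_linear/contrr_bilinear. Qed.
HB.instance Definition _ e := GRing.isLinear.Build R (V ⊗ W)%type W *:%R
  (contrl e) (contrl_linear e).
HB.instance Definition _ e := GRing.isLinear.Build R (V ⊗ W)%type V *:%R
  (contrr e) (contrr_linear e).

Lemma contrlE e x y : contrl e (x ⊗ y) = e x *: y.
Proof. exact: (tlift_tens (contrl_bilinear e)). Qed.
Lemma contrrE e x y : contrr e (x ⊗ y) = e y *: x.
Proof. exact: (tlift_tens (contrr_bilinear e)). Qed.
End Contraction.

Lemma contrl_sw (R : comNzRingType) (V W : superModType R) (e : {scalar V})
    (t : V ⊗ W) : contrl e t = \sw_(x, y <- t) e x *: y.
Proof.
rewrite (swE t (@contrl_linear _ _ _ e)).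
by apply: eq_sw => x y _ _; rewrite contrlE.
Qed.

Lemma contrr_sw (R : comNzRingType) (V W : superModType R) (e : {scalar W})
    (t : V ⊗ W) : contrr e t = \sw_(x, y <- t) e y *: x.
Proof.
rewrite (swE t (@contrr_linear _ _ _ e)).
by apply: eq_sw => x y _ _; rewrite contrrE.
Qed.

Lemma tactE0 (R : comNzRingType) (M N V W V' W' : superModType R)
    (al : {bilinear M -> V -> V'}) (be : {bilinear N -> W -> W'}) m n v w :
  par false n -> tact al be (m ⊗ n) (v ⊗ w) = al m v ⊗ be n w.
Proof.
move=> pn; rewrite tact_pureE /tact_pure; have /= -> := par_off pn.
by rewrite [hpart false n]pn linear0l linear0r addr0.
Qed.

Lemma tassoc_tmap_sw (R : comNzRingType) (V V1 V2 W : superModType R)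
    (f : {linear V -> (V1 ⊗ V2)%type}) (t : V ⊗ W) :
  tassoc (tmap f idfun t) =
  \sw_(x, y <- t) \sw_(x1, x2 <- f x) x1 ⊗ (x2 ⊗ y).
Proof.
rewrite (@swE _ _ _ _ (fun t => tassoc (tmap f idfun t))); last first.
  by move=> r x y; rewrite !linearP.
apply: eq_sw => x y _ _; rewrite tmapE /=.
rewrite (@swE _ _ _ _ (fun u => tassoc (u ⊗ y))); last first.
  by move=> r u v; rewrite linearPl linearP.
by apply: eq_sw => u v _ _; rewrite tassocE.
Qed.

Lemma tmap_id_sw (R : comNzRingType) (V W1 W2 W : superModType R)
    (f : {linear W -> (W1 ⊗ W2)%type}) (t : V ⊗ W) :
  tmap idfun f t = \sw_(x, y <- t) \sw_(y1, y2 <- f y) x ⊗ (y1 ⊗ y2).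
Proof.
rewrite (@swE _ _ _ _ (tmap idfun f)); last by move=> r x y; rewrite !linearP.
apply: eq_sw => x y _ _; rewrite tmapE /=.
by rewrite (@swE _ _ _ _ (tens x)); last by move=> r u v; rewrite linearPr.
Qed.

Lemma tl_sw_l (R : comNzRingType) (V W U M : superModType R)
    (f : {bilinear U -> W -> M}) (g : {linear V -> U}) (t : V ⊗ W) :
  tl f (tmap g idfun t) = \sw_(x, y <- t) f (g x) y.
Proof.
rewrite (@swE _ _ _ _ (fun t => tl f (tmap g idfun t))); last first.
  by move=> r x y; rewrite !linearP.
by apply: eq_sw => x y _ _; rewrite tmapE tlE.
Qed.

Lemma tl_sw_r (R : comNzRingType) (V W U M : superModType R)
    (f : {bilinear V -> U -> M}) (g : {linear W -> U}) (t : V ⊗ W) :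
  tl f (tmap idfun g t) = \sw_(x, y <- t) f x (g y).
Proof.
rewrite (@swE _ _ _ _ (fun t => tl f (tmap idfun g t))); last first.
  by move=> r x y; rewrite !linearP.
by apply: eq_sw => x y _ _; rewrite tmapE tlE.
Qed.

Lemma tact_sw_r (R : comNzRingType) (M N V W V' W' : superModType R)
    (al : {bilinear M -> V -> V'}) (be : {bilinear N -> W -> W'}) s t :
  tact al be s t = \sw_(v, w <- t) tact al be s (v ⊗ w).
Proof. by apply: swE => r u v; rewrite linearPr. Qed.

(** Two sign rules may agree only when the parities of the legs add up to that of [t]. This
    suffices: for a pure tensor of parities [p], [q], the components with other parities vanish, so
    both summands are 0 there. *)
Lemma eq_sw_par (R : comNzRingType) (V W : superModType R) (M : lmodType R)
    (F G : bool -> bool -> V -> W -> M) s t :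
  (forall p q, bilinear_for *:%R *:%R (F p q)) ->
  (forall p q, bilinear_for *:%R *:%R (G p q)) ->
  (forall p q v w, par p v -> par q w -> p (+) q = s -> F p q v w = G p q v w) ->
  par s t ->
  \sw_(x, y <- t) F (deg x) (deg y) x y = \sw_(x, y <- t) G (deg x) (deg y) x y.
Proof.
move=> Fb Gb FG; move: t.
have b0 (K : V -> W -> M) : bilinear_for *:%R *:%R K ->
    (forall w, K 0 w = 0) /\ (forall v, K v 0 = 0).
  case=> kl kr; split=> [w|v].
    by have := kl w (-1) 0 0; rewrite /= scaler0 addr0 scaleN1r addNr.
  by have := kr v (-1) 0 0; rewrite /= scaler0 addr0 scaleN1r addNr.
apply: tens_pind => [p q v w pv qw e|r x y Px Py].
  rewrite !sweedler_tens //; apply: eq_bigr => p' _; apply: eq_bigr => q' _.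
  have [e'|ne] := eqVneq (p' (+) q') s; first by apply: FG => //; exact: par_hpart.
  have [[F0l F0r] [G0l G0r]] := (b0 _ (Fb p' q'), b0 _ (Gb p' q')).
  have [pp|pp] := eqVneq p' p; last first.
    have e' : p' = ~~ p by case: p' p pp {e pv ne F0l F0r G0l G0r} => [] [].
    by rewrite [X in hpart X v]e' (par_off pv) F0l G0l.
  have e' : q' = ~~ q.
    move: ne; rewrite -e pp.
    by case: p {pp pv e}; case: q {qw}; case: q' {F0l F0r G0l G0r}.
  by rewrite [X in hpart X w]e' (par_off qw) F0r G0r.
by rewrite !sweedler_linear // Px Py.
Qed.

Section TensorSwap.
Variables (R : comNzRingType).

Section Def.
Variables V W : superModType R.
(** The Koszul flip; only the odd part of [v] produces a sign, carried by [sinv w]. *)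
Definition tswap_pure (v : V) (w : W) : (W ⊗ V)%type :=
  w ⊗ hpart false v + sinv w ⊗ hpart true v.
Lemma tswap_bilinear : bilinear_for *:%R *:%R tswap_pure.
Proof.
split=> [w r v v'|v r w w'] /=; rewrite /tswap_pure.
  by rewrite !linearP !linearPr /= scalerDr addrACA.
by rewrite [sinv _]linearP !linearPl /= scalerDr addrACA.
Qed.
Definition tswap (t : (V ⊗ W)%type) : (W ⊗ V)%type := tlift tswap_pure t.
Lemma tswap_linear : linear tswap. Proof. exact: (tlift_linear tswap_bilinear). Qed.
HB.instance Definition _ := GRing.isLinear.Build R (V ⊗ W)%type (W ⊗ V)%type
  *:%R tswap tswap_linear.
Lemma tswapE p q v w : par p v -> par q w ->
  tswap (v ⊗ w) = (-1) ^+ (p * q) *: (w ⊗ v).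
Proof.
move=> pv qw; rewrite /tswap (tlift_tens tswap_bilinear) /tswap_pure.
rewrite (sinv_par qw) linearZl_LR /=; move: (par_off pv) (pv); rewrite /par.
case: p {pv} => /= -> ->; rewrite linear0r; first by rewrite add0r mul1n.
by rewrite scaler0 addr0 mul0n scale1r.
Qed.
End Def.

Lemma tswap_tact (V W : superModType R) (f : {bilinear V -> V -> V})
    (g : {bilinear W -> W -> W}) s t : even_bimap f -> even_bimap g ->
  tswap (tact f g s t) = tact g f (tswap s) (tswap t).
Proof.
move=> ef eg.
elim/tens_hind: s => [p1 p2 a b pa pb|r u v Pu Pv]; last first.
  by rewrite linearPl !linearP linearPl /= Pu Pv.
elim/tens_hind: t => [q1 q2 c d qc qd|r u v Pu Pv]; last first.
  by rewrite linearPr !linearP linearPr /= Pu Pv.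
rewrite (tactE pb qc) linearZ /= (tswapE (ef _ _ _ _ pa qc) (eg _ _ _ _ pb qd)).
rewrite (tswapE pa pb) (tswapE qc qd) linearZl_LR linearZr /= (tactE pa qd).
rewrite !scalerA; congr (_ *: _).
by case: p1 {pa}; case: p2 {pb}; case: q1 {qc}; case: q2 {qd}; sgn.
Qed.
End TensorSwap.

(** * The bicrossproduct of super Hopf algebras *)

Section Smash.
Variables (R : comNzRingType) (H A : superModType R).
Variables (mH : {bilinear H -> H -> H}) (eH : H).
Variables (DH : {linear H -> (H ⊗ H)%type}) (epsH : {scalar H}) (SH : {linear H -> H}).
Variables (mA : {bilinear A -> A -> A}) (eA : A).
Variables (DA : {linear A -> (A ⊗ A)%type}) (epsA : {scalar A}) (SA : {linear A -> A}).
Hypothesis hopfH : is_super_hopf mH eH DH epsH SH.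
Hypothesis hopfA : is_super_hopf mA eA DA epsA SA.
Variables (act : {bilinear H -> A -> A}) (nabla : {linear H -> (H ⊗ A)%type}).
Variables (I : Type) (x : I -> H) (dx : I -> bool).
Hypothesis par_x : forall i, par (dx i) (x i).
Hypothesis DH_x : forall i, DH (x i) = x i ⊗ eH + eH ⊗ x i.
Hypothesis H_ind : forall K : H -> Prop,
  (forall r g h, K g -> K h -> K (r *: g + h)) -> K eH ->
  (forall i h, K h -> K (mH (x i) h)) -> forall h, K h.
Hypothesis act_even : even_bimap act.
Hypothesis act_1 : forall a, act eH a = a.
Hypothesis act_M : forall g h a, act (mH g h) a = act g (act h a).
Hypothesis act_x : forall i p a b, par p a ->
  act (x i) (mA a b) = mA (act (x i) a) b + (-1) ^+ (dx i * p) *: mA a (act (x i) b).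
Hypothesis act_one : forall h, act h eA = epsH h *: eA.

Let smH := shopf_alg hopfH.
Let smA := shopf_alg hopfA.

Lemma par_eH : par false eH. Proof. exact: sone_even smH. Qed.
Lemma par_eA : par false eA. Proof. exact: sone_even smA. Qed.
Local Notation mHA := (smulA smH).
Local Notation mAA := (smulA smA).

Lemma DH_M g h : DH (mH g h) = tact mH mH (DH g) (DH h).
Proof. by rewrite (scomulM hopfH) tact_sw. Qed.
Lemma DA_M a b : DA (mA a b) = tact mA mA (DA a) (DA b).
Proof. by rewrite (scomulM hopfA) tact_sw. Qed.

Local Notation M := (A ⊗ H)%type.

(** Left multiplication by [a ⊗ h]: [DH h] acts on [A ⊗ H] through [act] on the first leg and
    multiplication on the second, then [a] multiplies the first leg. The sign of the smash product
    is the one inside [tact]. *)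
Definition smash_pure n a h : M := tact mA mH (a ⊗ eH) (tact act mH (DH h) n).
Lemma smash_bilinear n : bilinear_for *:%R *:%R (smash_pure n).
Proof.
split=> [h r a a'|a r h h'] /=; rewrite /smash_pure.
  by rewrite !linearPl.
by rewrite linearP !(linearPl, linearPr).
Qed.
Definition smash (m n : M) : M := tlift (smash_pure n) m.
Lemma smash_is_bilinear : bilinear_for *:%R *:%R smash.
Proof.
split=> [n r m m'|m r n n'] /=; first exact: (tlift_linear (smash_bilinear n)).
apply: tlift_comb; [exact: smash_bilinear..|] => a h.
by rewrite /smash_pure !linearPr.
Qed.
HB.instance Definition _ := bilinear_isBilinear.Build R M M M *:%R *:%R smash
  smash_is_bilinear.
Lemma smashE a h n : smash (a ⊗ h) n = tact mA mH (a ⊗ eH) (tact act mH (DH h) n).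
Proof. exact: (tlift_tens (smash_bilinear n)). Qed.

Definition inA (a : A) : M := a ⊗ eH.
Lemma inA_linear : linear inA. Proof. by move=> r a b; rewrite /inA linearPl. Qed.
HB.instance Definition _ := GRing.isLinear.Build R A M *:%R inA inA_linear.
Definition inH (h : H) : M := eA ⊗ h.
Lemma inH_linear : linear inH. Proof. by move=> r a b; rewrite /inH linearPr. Qed.
HB.instance Definition _ := GRing.isLinear.Build R H M *:%R inH inH_linear.

Lemma inA_par p a : par p a -> par p (inA a).
Proof. by move=> pa; rewrite -[p]addbF; apply: par_tens => //; exact: par_eH. Qed.
Lemma inH_par p h : par p h -> par p (inH h).
Proof. by move=> ph; rewrite -[p]addFb; apply: par_tens => //; exact: par_eA. Qed.
Lemma inA_even : even_map inA. Proof. by apply: even_mapP; exact: inA_par. Qed.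
Lemma inH_even : even_map inH. Proof. by apply: even_mapP; exact: inH_par. Qed.

Lemma smash_inA n a : smash (inA a) n = tact mA mH (a ⊗ eH) n.
Proof.
rewrite smashE (scomul1 hopfH); congr (tact _ _ _ _).
elim/tensor_ind: n => [b g|r m n Pm Pn]; last by rewrite linearPr /= Pm Pn.
by rewrite (tactE0 _ _ _ _ _ par_eH) act_1 (smul1l smH).
Qed.

Lemma smash_inA_tens a b g : smash (inA a) (b ⊗ g) = mA a b ⊗ g.
Proof. by rewrite smash_inA (tactE0 _ _ _ _ _ par_eH) (smul1l smH). Qed.

Lemma smash_inH n h : smash (inH h) n = tact act mH (DH h) n.
Proof.
rewrite smashE; elim/tensor_ind: (tact act mH (DH h) n) => [b g|r u v Pu Pv].
  by rewrite (tactE0 _ _ _ _ _ par_eH) (smul1l smA) (smul1l smH).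
by rewrite linearPr /= Pu Pv.
Qed.

Lemma smash_tens a h n : smash (a ⊗ h) n = smash (inA a) (smash (inH h) n).
Proof. by rewrite smash_inA smash_inH smashE. Qed.

Lemma smash_inAH a h : smash (inA a) (inH h) = a ⊗ h.
Proof. by rewrite smash_inA_tens (smul1r smA). Qed.

Lemma smash1l n : smash (eA ⊗ eH) n = n.
Proof.
rewrite -/(inA eA) smash_inA.
elim/tensor_ind: n => [b g|r u v Pu Pv]; last by rewrite linearPr /= Pu Pv.
by rewrite (tactE0 _ _ _ _ _ par_eH) (smul1l smA) (smul1l smH).
Qed.

Lemma smash_inA_M a b n : smash (inA (mA a b)) n = smash (inA a) (smash (inA b) n).
Proof.
elim/tensor_ind: n => [c g|r u v Pu Pv]; last by rewrite !linearPr /= Pu Pv.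
by rewrite !smash_inA_tens mAA.
Qed.

Lemma smash_inH_M g h n : smash (inH (mH g h)) n = smash (inH g) (smash (inH h) n).
Proof.
rewrite !smash_inH DH_M; apply: tactA => //.
- exact: smul_even smH.
- by move=> *; rewrite mHA.
Qed.

Lemma smash_x_tens i q b g : par q b -> smash (inH (x i)) (b ⊗ g) =
  act (x i) b ⊗ g + (-1) ^+ (dx i * q) *: (b ⊗ mH (x i) g).
Proof.
move=> qb; rewrite smash_inH DH_x linearDl /= (tactE0 _ _ _ _ _ par_eH).
by rewrite (tactE (par_x i) qb) act_1 (smul1l smH).
Qed.

(** The cross relation between [x i] and [a]. It is stated with a trailing factor [n] because
    associativity is not yet available: it is deduced from this relation. *)
Lemma smash_x_inA i q a n : par q a -> smash (inH (x i)) (smash (inA a) n) =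
  smash (inA (act (x i) a)) n +
  (-1) ^+ (dx i * q) *: smash (inA a) (smash (inH (x i)) n).
Proof.
move=> qa; elim/tens_hind: n => [p1 p2 b g h1 h2|r u v Pu Pv]; last first.
  by rewrite !linearPr /= Pu Pv !scalerDr !scalerA [_ * r]mulrC addrACA.
rewrite !smash_inA_tens (smash_x_tens _ _ (smul_even smA qa h1)).
rewrite (smash_x_tens _ _ h1) linearDr /= linearZr_LR /= !smash_inA_tens.
rewrite (act_x _ _ qa) linearDl linearZl_LR /= scalerDr scalerA -addrA.
congr (_ + (_ + _ *: _)).
by case: (dx i); case: q {qa}; case: p1 {h1}; sgn.
Qed.

(** Only the left factor matters. Associativity holds when it lies in A or is a generator of H; it
    passes to words in the generators by [smash_inH_M], and to [a ⊗ h] because this is the product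
    of [inA a] and [inH h]. *)
Lemma smashA m n p : smash m (smash n p) = smash (smash m n) p.
Proof.
have sA a n' p' : smash (inA a) (smash n' p') = smash (smash (inA a) n') p'.
  elim/tensor_ind: n' => [b g|r u v Pu Pv].
    by rewrite smash_inA_tens (smash_tens b g) (smash_tens (mA a b) g) smash_inA_M.
  by rewrite !(linearPr, linearPl) /= Pu Pv.
have sx i n' p' : smash (inH (x i)) (smash n' p') = smash (smash (inH (x i)) n') p'.
  elim/tens_hind: n' => [p1 p2 b g h1 h2|r u v Pu Pv]; last first.
    by rewrite !(linearPr, linearPl) /= Pu Pv.
  rewrite (smash_x_tens _ _ h1) linearDl linearZl_LR /= (smash_tens b g).
  rewrite (smash_tens (act _ _) g) (smash_tens b (mH _ _)).
  by rewrite (smash_x_inA _ _ h1) smash_inH_M.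
have sH h n' p' : smash (inH h) (smash n' p') = smash (smash (inH h) n') p'.
  elim/H_ind: h n' p' => [r g h Pg Ph|n' p'|i h Ph n' p'].
  - by move=> n' p'; rewrite linearP !linearPl /= Pg Ph.
  - by rewrite !smash1l.
  - by rewrite !smash_inH_M Ph sx.
elim/tensor_ind: m => [a h|r u v Pu Pv]; last by rewrite !linearPl /= Pu Pv.
by rewrite (smash_tens a h n) (smash_tens a h (smash n p)) sH sA.
Qed.

Lemma smash1r m : smash m (eA ⊗ eH) = m.
Proof.
elim/tensor_ind: m => [a h|r u v Pu Pv]; last by rewrite !linearPl /= Pu Pv.
rewrite smash_tens smash_inH.
(* Since h |> 1 is [epsH h] times 1, acting on the unit contracts the first leg of [DH h] with the
   counit. *)
have -> : tact act mH (DH h) (eA ⊗ eH) = eA ⊗ contrl epsH (DH h).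
  elim/tensor_ind: (DH h) => [g k|r u v Pu Pv].
    rewrite tact_pureE /tact_pure (sinv_par par_eA) scale1r -linearDr /= -linearDl /=.
    by rewrite hpartD (smul1r smH) act_one contrlE linearZl_LR linearZr.
  by rewrite linearPl linearP linearPr /= Pu Pv.
by rewrite contrl_sw (scounitl (shopf_coalg hopfH)) smash_inAH.
Qed.

Lemma smash_even : even_bimap smash.
Proof.
move=> p q m n pm qn; rewrite -/(par _ _).
move: m pm; apply: tens_pind => [p1 p2 a h pa ph <-|r u v Pu Pv]; last first.
  by rewrite linearPl; exact: parP.
rewrite smashE -addbA; apply: (tact_even (smul_even smA) (smul_even smH)).
  by rewrite -[p1]addbF; apply: par_tens => //; exact: par_eH.
apply: (tact_even act_even (smul_even smH)) => //.
by rewrite -(scomul_even (shopf_coalg hopfH)) ph.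
Qed.

Lemma smash_superalgebra : is_superalgebra smash (eA ⊗ eH).
Proof.
split; [exact: smashA|exact: smash1l|exact: smash1r|exact: smash_even|].
by apply: (par_tens par_eA par_eH).
Qed.

(** * The coproduct on the image of H *)

Hypothesis nabla_even : even_map nabla.
Hypothesis nabla_coassoc : forall h,
  tassoc (tmap nabla idfun (nabla h)) = tmap idfun DA (nabla h).
Hypothesis nabla_counit : forall h, contrr epsA (nabla h) = h.
Hypothesis nabla_eps : forall h, contrl epsH (nabla h) = epsH h *: eA.
Hypothesis nabla_1 : nabla eH = eH ⊗ eA.
Hypothesis nabla_xM : forall i h, nabla (mH (x i) h) =
  tact mH mA (nabla (x i)) (nabla h) + tact mH act (eH ⊗ x i) (nabla h).
Hypothesis nabla_x_ind : forall i (K : (H ⊗ A)%type -> Prop),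
  (forall j q b, par q b -> dx j (+) q = dx i -> K (x j ⊗ b)) ->
  (forall r s t, K s -> K t -> K (r *: s + t)) -> K (nabla (x i)).
Hypothesis mA_comm : forall p q a b, par p a -> par q b ->
  mA a b = (-1) ^+ (p * q) *: mA b a.

Local Notation MM := (M ⊗ M)%type.
Local Notation smash2 := (tact smash smash).
Local Notation inA2 := (tmap inA inA).
Local Notation inHA := (tmap inH inA).

Lemma inA_M a b : inA (mA a b) = smash (inA a) (inA b).
Proof. by rewrite smash_inA_tens. Qed.
Lemma inH_M g h : inH (mH g h) = smash (inH g) (inH h).
Proof. by rewrite -[LHS]smash1r smash_inH_M smash1r. Qed.
Lemma smash_x_inA1 i q a : par q a -> smash (inH (x i)) (inA a) =
  inA (act (x i) a) + (-1) ^+ (dx i * q) *: smash (inA a) (inH (x i)).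
Proof.
by move=> qa; have := smash_x_inA i (eA ⊗ eH) qa; rewrite !smash1r.
Qed.

Lemma smash2A u v w : smash2 u (smash2 v w) = smash2 (smash2 u v) w.
Proof.
by symmetry; apply: tactA => //; try exact: smash_even; move=> * /=; rewrite smashA.
Qed.

Local Notation one2 := ((eA ⊗ eH) ⊗ (eA ⊗ eH)).
Lemma par_one : par false (eA ⊗ eH).
Proof. exact: (par_tens par_eA par_eH). Qed.

Lemma smash2_1l w : smash2 one2 w = w.
Proof.
elim/tensor_ind: w => [m n|r u v Pu Pv]; last by rewrite linearPr /= Pu Pv.
by rewrite (tactE0 _ _ _ _ _ par_one) /= !smash1l.
Qed.

Definition inR (h : H) : MM := (eA ⊗ eH) ⊗ inH h.
Lemma inR_linear : linear inR.
Proof. by move=> r g h; rewrite /inR [inH _]linearP linearPr. Qed.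
HB.instance Definition _ := GRing.isLinear.Build R H MM *:%R inR inR_linear.

Lemma smash2_inR m n h : smash2 (m ⊗ n) (inR h) = m ⊗ smash n (inH h).
Proof.
rewrite tact_pureE /tact_pure (sinv_par par_one) scale1r /= smash1r.
by rewrite -linearDr /= -linearDl /= hpartD.
Qed.

Lemma inR_smash2 i q m n : par q m ->
  smash2 (inR (x i)) (m ⊗ n) = (-1) ^+ (dx i * q) *: (m ⊗ smash (inH (x i)) n).
Proof. by move=> qm; rewrite (tactE (inH_par (par_x i)) qm) /= smash1l. Qed.

Lemma inR_M g h : inR (mH g h) = smash2 (inR g) (inR h).
Proof. by rewrite smash2_inR -inH_M. Qed.

Definition delta_pure g h : MM := smash2 (inHA (nabla g)) (inR h).
Lemma delta_bilinear : bilinear_for *:%R *:%R delta_pure.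
Proof.
split=> [h r g g'|g r h h'] /=; rewrite /delta_pure.
  by rewrite !linearP /= linearPl.
by rewrite linearP linearPr.
Qed.
Definition delta2 (t : (H ⊗ H)%type) : MM := tlift delta_pure t.
Lemma delta2_linear : linear delta2. Proof. exact/tlift_linear/delta_bilinear. Qed.
HB.instance Definition _ := GRing.isLinear.Build R (H ⊗ H)%type MM *:%R delta2
  delta2_linear.
Lemma delta2E g h : delta2 (g ⊗ h) = smash2 (inHA (nabla g)) (inR h).
Proof. exact: (tlift_tens delta_bilinear). Qed.

(** The value on [1 ⊗ h] of the coproduct under construction, namely [nabla] of the first Sweedler
    leg of [h] multiplied on the right by [1 ⊗ h2]. *)
Definition delta (h : H) : MM := delta2 (DH h).
Lemma delta_linear : linear delta.
Proof. by move=> r g h; rewrite /delta !linearP. Qed.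
HB.instance Definition _ := GRing.isLinear.Build R H MM *:%R delta delta_linear.

Lemma delta_1 : delta eH = one2.
Proof. by rewrite /delta (scomul1 hopfH) delta2E nabla_1 tmapE smash2_1l. Qed.

Lemma delta_x i : delta (x i) = inHA (nabla (x i)) + inR (x i).
Proof.
rewrite /delta DH_x linearD /= !delta2E nabla_1 tmapE smash2_1l; congr (_ + _).
elim/tensor_ind: (inHA (nabla (x i))) => [m n|r u v Pu Pv].
  by rewrite smash2_inR smash1r.
by rewrite linearPl /= Pu Pv.
Qed.

(** In the smash product the action of [x i] on A is the supercommutator with [x i]. Hence the
    correction term of [nabla (x i * h)] becomes a supercommutator with [1 ⊗ x i]. *)
Lemma inHA_act i q t : par q t ->
  inHA (tact mH act (eH ⊗ x i) t) =
  smash2 (inR (x i)) (inHA t) - (-1) ^+ (dx i * q) *: smash2 (inHA t) (inR (x i)).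
Proof.
move: t; apply: tens_pind => [p1 p2 h a ph pa <-|r u v Pu Pv]; last first.
  rewrite linearPr [LHS]linearP /= Pu Pv [tmap _ _ (r *: u + v)]linearP.
  rewrite linearPr linearPl /= scalerBr addrACA scalerDr opprD !scalerA.
  by rewrite [_ * r]mulrC.
rewrite (tactE (par_x i) ph) linearZ /= !tmapE (smul1l smH).
rewrite (inR_smash2 _ _ (inH_par ph)) smash2_inR (smash_x_inA1 _ pa) linearDr /=.
rewrite linearZr /= scalerDr scalerA -addrA -[LHS]addr0; congr (_ + _).
apply/eqP; rewrite eq_sym subr_eq0; apply/eqP; congr (_ *: _).
by case: (dx i); case: p1 {ph}; case: p2 {pa}; sgn.
Qed.

Lemma inHA_nabla_xM i q h : par q h -> inHA (nabla (mH (x i) h)) =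
  smash2 (delta (x i)) (inHA (nabla h)) -
  (-1) ^+ (dx i * q) *: smash2 (inHA (nabla h)) (inR (x i)).
Proof.
move=> qh; rewrite nabla_xM linearD /= (@inHA_act i q); last first.
  by rewrite /par -nabla_even qh.
rewrite delta_x linearDl /= addrA; congr (_ + _ - _).
by apply: tmap_tact; [exact: inH_even|exact: inA_even|exact: inH_M|exact: inA_M].
Qed.

(** In DH (x h) = (x ⊗ 1 + 1 ⊗ x) DH h, the summand 1 ⊗ x contributes, up to the sign of moving x
    past h1, the product of nabla(h1) and 1 ⊗ x h2. It cancels the subtracted term of
    [inHA_nabla_xM]. *)
Lemma delta_xM i h : delta (mH (x i) h) = smash2 (delta (x i)) (delta h).
Proof.
rewrite {1 3}/delta DH_M.
elim/tens_hind: (DH h) => [p1 p2 g k pg pk|r u v Pu Pv]; last first.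
  by rewrite linearPr !linearP linearPr /= Pu Pv.
rewrite DH_x linearDl /= (tactE0 _ _ _ _ _ par_eH) (smul1l smH).
rewrite (tactE (par_x i) pg) (smul1l smH) linearD linearZ /= !delta2E.
rewrite (inHA_nabla_xM _ pg) linearBl linearZl_LR /= inR_M -!smash2A.
by rewrite addrNK.
Qed.

Lemma delta_M g h : delta (mH g h) = smash2 (delta g) (delta h).
Proof.
elim/H_ind: g => [r g g' Pg Pg'||i g Pg].
- by rewrite linearPl !linearP linearPl /= Pg Pg'.
- by rewrite (smul1l smH) delta_1 smash2_1l.
- by rewrite -mHA !delta_xM Pg smash2A.
Qed.

(** * The twisted diagonal action on A ⊗ A *)

Definition mact_pure b a h : A := mA a (act h b).
Lemma mact_bilinear b : bilinear_for *:%R *:%R (mact_pure b).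
Proof.
split=> [h r a a'|a r h h'] /=; rewrite /mact_pure ?linearPl //.
by rewrite linearPr.
Qed.
(** The natural representation of the smash product on A. Its tensor square lets M ⊗ M act on A ⊗ A,
    so that multiplicativity of [delta] turns into the module property [lact_M]. *)
Definition mact (m : M) (b : A) : A := tlift (mact_pure b) m.
Lemma mact_is_bilinear : bilinear_for *:%R *:%R mact.
Proof.
split=> [n r m m'|m r n n'] /=; first exact: (tlift_linear (mact_bilinear n)).
apply: tlift_comb; [exact: mact_bilinear..|] => a h.
by rewrite /mact_pure !linearPr.
Qed.
HB.instance Definition _ := bilinear_isBilinear.Build R M A A *:%R *:%R mact
  mact_is_bilinear.
Lemma mactE a h b : mact (a ⊗ h) b = mA a (act h b).
Proof. exact: (tlift_tens (mact_bilinear b)). Qed.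

Lemma mact_smash m n b : mact (smash m n) b = mact m (mact n b).
Proof.
have sA a n' : mact (smash (inA a) n') b = mA a (mact n' b).
  elim/tensor_ind: n' => [c g|r u v Pu Pv].
    by rewrite smash_inA_tens !mactE mAA.
  by rewrite !(linearPr, linearPl) /= Pu Pv.
have sH h n' : mact (smash (inH h) n') b = act h (mact n' b).
  elim/H_ind: h n' => [r g h Pg Ph n'|n'|i h Ph n'].
  - by rewrite linearP !linearPl /= Pg Ph.
  - by rewrite !smash1l act_1.
  - rewrite !smash_inH_M act_M -Ph.
    elim/tens_hind: (smash (inH h) n') => [p1 p2 c g h1 h2|r u v Pu Pv].
      rewrite (smash_x_tens _ _ h1) linearDl linearZl_LR /= !mactE (act_x _ _ h1).
      by rewrite act_M.
    by rewrite !(linearPr, linearPl) /= Pu Pv.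
elim/tensor_ind: m => [a h|r u v Pu Pv]; last by rewrite !linearPl /= Pu Pv.
by rewrite (smash_tens a h n) sA sH mactE.
Qed.

Lemma mact_even : even_bimap mact.
Proof.
move=> p q m b pm qb; rewrite -/(par _ _).
move: m pm; apply: tens_pind => [p1 p2 a h pa ph <-|r u v Pu Pv]; last first.
  by rewrite linearPl; exact: parP.
by rewrite mactE -addbA; apply: (smul_even smA) => //; exact: act_even.
Qed.

(* The diagonal action of [H] on [A ⊗ A] twisted by the coaction. *)
Definition lact (h : H) (s : (A ⊗ A)%type) : (A ⊗ A)%type :=
  tact mact mact (delta h) s.
Lemma lact_is_bilinear : bilinear_for *:%R *:%R lact.
Proof.
by split=> [s r g h|g r s t] /=; rewrite /lact ?linearP !(linearPl, linearPr).
Qed.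
HB.instance Definition _ := bilinear_isBilinear.Build R H (A ⊗ A)%type
  (A ⊗ A)%type *:%R *:%R lact lact_is_bilinear.

Lemma lact_M g h s : lact (mH g h) s = lact g (lact h s).
Proof.
rewrite /lact delta_M; apply: tactA.
- exact: mact_even.
- exact: smash_even.
- exact: mact_smash.
- exact: mact_smash.
Qed.

Lemma lact_1 s : lact eH s = s.
Proof.
rewrite /lact delta_1; elim/tensor_ind: s => [a b|r u v Pu Pv].
  by rewrite (tactE0 _ _ _ _ _ par_one) /= !mactE !act_1 !(smul1l smA).
by rewrite linearPr /= Pu Pv.
Qed.

Lemma lact_x i s : lact (x i) s =
  tact act mA (nabla (x i)) s + tact act act (eH ⊗ x i) s.
Proof.
rewrite /lact delta_x linearDl /=; congr (_ + _).
  elim/tensor_ind: (nabla (x i)) => [h a|r u v Pu Pv]; last first.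
    by rewrite linearP !linearPl /= Pu Pv.
  elim/tens_hind: s => [p1 p2 b c pb pc|r u v Pu Pv]; last first.
    by rewrite !linearPr /= Pu Pv.
  rewrite tmapE !tact_pureE /tact_pure /= -!inA_even !mactE !(smul1l smA) !act_1.
  by [].
elim/tens_hind: s => [p1 p2 b c pb pc|r u v Pu Pv]; last first.
  by rewrite !linearPr /= Pu Pv.
rewrite (tactE (par_x i) pb) (tactE (inH_par (par_x i)) pb) /= !mactE.
by rewrite !(smul1l smA).
Qed.

(** The counit of H retracts A ⊗ H onto A. Identities in A ⊗ A can therefore be checked in M ⊗ M,
    where [delta (x i)] is available as an element. *)
Lemma inA2K s : tmap (contrr epsH) (contrr epsH) (inA2 s) = s.
Proof.
elim/tensor_ind: s => [a b|r u v Pu Pv]; last by rewrite !linearP /= Pu Pv.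
by rewrite !tmapE /= !contrrE (scounit1 hopfH) !scale1r.
Qed.

Lemma inA2_inj : injective inA2. Proof. exact: can_inj inA2K. Qed.

Lemma inA2_M s t : inA2 (tact mA mA s t) = smash2 (inA2 s) (inA2 t).
Proof. by apply: tmap_tact; [exact: inA_even|exact: inA_even|exact: inA_M..]. Qed.

(** The summand [1 ⊗ x i] only uses the cross relation. In a summand [x j ⊗ c] of [nabla (x i)], the
    generator [x j] is moved past [a] by the cross relation and [c] past [b] by supercommutativity
    of A; this is why the H-legs of the coaction must be generators. *)
Lemma delta_x_inA2 i q s : par q s -> smash2 (delta (x i)) (inA2 s) =
  inA2 (lact (x i) s) + (-1) ^+ (dx i * q) *: smash2 (inA2 s) (delta (x i)).
Proof.
move: s; apply: tens_pind => [p1 p2 a b pa pb <-|r u v Pu Pv]; last first.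
  rewrite [tmap _ _ _]linearP !linearPr /= Pu Pv [tmap _ _ (_ *: _ + _)]linearP /=.
  by rewrite !linearPl /= !scalerDr !scalerA [_ * r]mulrC addrACA.
rewrite lact_x delta_x tmapE [tmap _ _ (_ + _)]linearD linearDl linearDr /=.
rewrite scalerDr [RHS]addrACA; congr (_ + _); last first.
  rewrite (inR_smash2 _ _ (inA_par pa)) (smash_x_inA1 _ pb) smash2_inR.
  rewrite (tactE (par_x i) pa) act_1 linearZ /= tmapE linearDr linearZr /=.
  rewrite scalerDr scalerA; congr (_ + _ *: _).
  by case: (dx i); case: p1 {pa}; case: p2 {pb}; sgn.
pattern (nabla (x i)); apply: nabla_x_ind => [j q0 c qc e|r u v Pu Pv]; last first.
  rewrite [tmap _ _ _]linearP !linearPl !linearPr /= Pu Pv [tmap _ _ (_ *: _ + _)]linearP /=.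
  by rewrite !scalerDr !scalerA [_ * r]mulrC addrACA.
rewrite tmapE (tactE (inA_par qc) (inA_par pa)) /= (smash_x_inA1 _ pa) -inA_M.
rewrite (tactE qc pa) linearZ /= tmapE (tactE (inA_par pb) (inH_par (par_x j))) /=.
rewrite -inA_M (mA_comm pb qc) [inA (_ *: _)]linearZ !linearDl linearZl_LR.
rewrite !linearZr /= scalerDr !scalerA; congr (_ + _ *: _).
by rewrite -e; case: (dx j); case: p1 {pa}; case: p2 {pb}; case: q0 {qc e}; sgn.
Qed.

(** Under the injective map [inA2], [lact (x i)] becomes the supercommutator with [delta (x i)], and
    a supercommutator is a superderivation of the associative algebra M ⊗ M. *)
Lemma lact_mA i q s t : par q s -> lact (x i) (tact mA mA s t) =
  tact mA mA (lact (x i) s) t +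
  (-1) ^+ (dx i * q) *: tact mA mA s (lact (x i) t).
Proof.
move=> qs; apply: inA2_inj; rewrite [in RHS]linearD linearZ /= !inA2_M.
elim/tens_hind: t => [p1 p2 a b pa pb|r u v Pu Pv]; last first.
  rewrite !linearPr !linearP /= Pu Pv !linearPr /= scalerDr.
  by rewrite !scalerDr !scalerA [_ * r]mulrC addrACA.
set t := a ⊗ b; have pt : par (p1 (+) p2) t by exact: par_tens.
have pst : par (q (+) (p1 (+) p2)) (tact mA mA s t).
  exact: (tact_even (smul_even smA) (smul_even smA)).
have := delta_x_inA2 i pst; rewrite inA2_M => e.
have {e} -> : inA2 (lact (x i) (tact mA mA s t)) =
  smash2 (smash2 (delta (x i)) (inA2 s)) (inA2 t) -
  (-1) ^+ (dx i * (q (+) (p1 (+) p2))) *: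
    smash2 (smash2 (inA2 s) (inA2 t)) (delta (x i)).
  by rewrite -smash2A e addrK.
rewrite (delta_x_inA2 _ qs) linearDl linearZl_LR /= -!smash2A.
rewrite (delta_x_inA2 _ pt) linearDr linearZr_LR /= scalerDr scalerA -!addrA.
congr (_ + _); rewrite -[RHS]addr0; congr (_ + _).
apply/eqP; rewrite subr_eq0; apply/eqP; congr (_ *: _).
by case: (dx i); case: q {qs pst}; case: (p1 (+) p2) {pt}; sgn.
Qed.

(** * Compatibility of the action with the coproduct and counit of A *)

Variables (J : Type) (y : J -> A) (dy : J -> bool).
Hypothesis par_y : forall j, par (dy j) (y j).
Hypothesis A_ind : forall K : A -> Prop,
  (forall r a b, K a -> K b -> K (r *: a + b)) -> K eA ->
  (forall j a, K a -> K (mA (y j) a)) -> forall a, K a.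
Hypothesis DA_act_xy : forall i j, DA (act (x i) (y j)) = lact (x i) (DA (y j)).
Hypothesis epsA_act_xy : forall i j, epsA (act (x i) (y j)) = 0.

Lemma epsH_x i : epsH (x i) = 0.
Proof.
have := scounitl (shopf_coalg hopfH) (x i).
rewrite -contrl_sw DH_x linearD /= !contrlE (scounit1 hopfH) scale1r.
(* The counit axiom on x ⊗ 1 + 1 ⊗ x leaves [epsH (x i) *: eH = 0]; applying the counit once more
   gives the claim. *)
move/(canRL (addrK _)); rewrite subrr => /(congr1 epsH).
by rewrite linearZ linear0 /= (scounit1 hopfH) mulr1.
Qed.

Lemma act_x_one i : act (x i) eA = 0.
Proof. by rewrite act_one epsH_x scale0r. Qed.

Lemma DA_act_x i a : DA (act (x i) a) = lact (x i) (DA a).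
Proof.
elim/A_ind: a i => [r a b Pa Pb i|i|j a Pa i].
- by rewrite linearPr !linearP linearPr /= Pa Pb.
- rewrite act_x_one (scomul1 hopfA) linear0 lact_x.
  rewrite (tactE (par_x i) par_eA) act_x_one linear0r scaler0 addr0.
  (* On the unit of A what remains is 1 ⊗ y, with y the contraction of [nabla (x i)] with [epsH]. It
     vanishes because the coaction respects the counit of H and [epsH (x i)] is 0. *)
  have := nabla_eps (x i); rewrite epsH_x scale0r.
  have -> : tact act mA (nabla (x i)) (eA ⊗ eA) = eA ⊗ contrl epsH (nabla (x i)).
    elim/tens_hind: (nabla _) => [p1 p2 h a ph pa|r u v Pu Pv].
      rewrite (tactE pa par_eA) muln0 scale1r act_one (smul1r smA) contrlE.
      by rewrite linearZl_LR linearZr.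
    by rewrite linearPl linearP linearPr /= Pu Pv.
  by move=> ->; rewrite linear0r.
- rewrite (act_x _ _ (par_y j)) linearD linearZ /= !DA_M.
  rewrite Pa DA_act_xy (@lact_mA i (dy j)) //.
  by rewrite /par -(scomul_even (shopf_coalg hopfA)) par_y.
Qed.

Lemma DA_act h a : DA (act h a) = lact h (DA a).
Proof.
elim/H_ind: h => [r g h Pg Ph||i h Ph].
- by rewrite !linearPl linearP /= Pg Ph.
- by rewrite act_1 lact_1.
- by rewrite act_M DA_act_x Ph lact_M.
Qed.

Lemma epsA_act_x i a : epsA (act (x i) a) = 0.
Proof.
elim/A_ind: a => [r a b Pa Pb||j a Pa].
- by rewrite linearPr linearP /= Pa Pb mulr0 addr0.
- by rewrite act_x_one linear0.
- rewrite (act_x _ _ (par_y j)) linearD linearZ /= !(scounitM hopfA).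
  by rewrite Pa epsA_act_xy mul0r !mulr0 addr0.
Qed.

Lemma epsA_act h a : epsA (act h a) = epsH h * epsA a.
Proof.
elim/H_ind: h => [r g h Pg Ph||i h Ph].
- by rewrite linearPl !linearP /= Pg Ph mulrDl mulrA.
- by rewrite act_1 (scounit1 hopfH) mul1r.
- by rewrite act_M epsA_act_x (scounitM hopfH) epsH_x !mul0r.
Qed.

(** * The coproduct of the bicrossproduct *)

Definition cop_pure a h : MM := smash2 (inA2 (DA a)) (delta h).
Lemma cop_bilinear : bilinear_for *:%R *:%R cop_pure.
Proof.
split=> [h r a a'|a r h h'] /=; rewrite /cop_pure.
  by rewrite !linearP linearPl.
by rewrite linearP linearPr.
Qed.
Definition cop (m : M) : MM := tlift cop_pure m.
Lemma cop_linear : linear cop. Proof. exact/tlift_linear/cop_bilinear. Qed.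
HB.instance Definition _ := GRing.isLinear.Build R M MM *:%R cop cop_linear.
Lemma copE a h : cop (a ⊗ h) = smash2 (inA2 (DA a)) (delta h).
Proof. exact: (tlift_tens cop_bilinear). Qed.

Lemma smash2_1r w : smash2 w one2 = w.
Proof.
elim/tensor_ind: w => [m n|r u v Pu Pv]; last by rewrite linearPl /= Pu Pv.
by rewrite -/(inR eH) smash2_inR smash1r.
Qed.

Lemma cop_inA a : cop (inA a) = inA2 (DA a).
Proof. by rewrite copE delta_1 smash2_1r. Qed.

Lemma cop_inH h : cop (inH h) = delta h.
Proof. by rewrite copE (scomul1 hopfA) tmapE smash2_1l. Qed.

(** The only relation to respect is the one between [x i] and [a]; its image is [delta_x_inA2]
    applied to [DA a], once [DA_act_x] identifies the twisted action on [DA a] with the coproduct of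
    x |> a. *)
Lemma cop_M m n : cop (smash m n) = smash2 (cop m) (cop n).
Proof.
have cA a n' : cop (smash (inA a) n') = smash2 (inA2 (DA a)) (cop n').
  elim/tensor_ind: n' => [b g|r u v Pu Pv].
    by rewrite smash_inA_tens !copE DA_M inA2_M smash2A.
  by rewrite linearPr !linearP linearPr /= Pu Pv.
have cx i n' : cop (smash (inH (x i)) n') = smash2 (delta (x i)) (cop n').
  elim/tens_hind: n' => [p1 p2 b g pb pg|r u v Pu Pv]; last first.
    by rewrite linearPr !linearP linearPr /= Pu Pv.
  rewrite (smash_x_tens _ _ pb) linearD linearZ /= !copE DA_act_x delta_M.
  have pD : par p1 (DA b) by rewrite /par -(scomul_even (shopf_coalg hopfA)) pb.
  by rewrite !smash2A (delta_x_inA2 _ pD) linearDl linearZl_LR.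
have cH h n' : cop (smash (inH h) n') = smash2 (delta h) (cop n').
  elim/H_ind: h n' => [r g h Pg Ph n'|n'|i h Ph n'].
  - by rewrite linearP linearPl !linearP linearPl /= Pg Ph.
  - by rewrite smash1l delta_1 smash2_1l.
  - by rewrite smash_inH_M cx Ph delta_M smash2A.
elim/tensor_ind: m => [a h|r u v Pu Pv].
  by rewrite (smash_tens a h n) cA cH copE smash2A.
by rewrite linearPl !linearP linearPl /= Pu Pv.
Qed.

Lemma smash_ind (K : M -> Prop) :
  (forall r m n, K m -> K n -> K (r *: m + n)) -> (forall a, K (inA a)) ->
  (forall i, K (inH (x i))) -> (forall m n, K m -> K n -> K (smash m n)) ->
  forall m, K m.
Proof.
move=> KD KA Kx KM; have KH h : K (inH h).
  elim/H_ind: h => [r g h Kg Kh||i h Kh].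
  - by rewrite linearP; exact: KD.
  - exact: (KA eA).
  - by rewrite inH_M; exact: KM.
elim/tensor_ind=> [a h|r u v Ku Kv]; last exact: KD.
by rewrite -smash_inAH; exact: KM.
Qed.

Lemma inA2_even : even_map inA2.
Proof. by apply: tmap_even; exact: inA_even. Qed.

Lemma delta_even : even_map delta.
Proof.
apply: even_mapP => p h ph.
have : par p (DH h) by rewrite /par -(scomul_even (shopf_coalg hopfH)) ph.
rewrite /= /delta; move: (DH h) => {ph}{}h.
move: h; apply: tens_pind => [p1 p2 g k pg pk <-|r u v Pu Pv]; last first.
  by rewrite linearP; exact: parP.
rewrite delta2E; apply: (tact_even smash_even smash_even).
  rewrite -(tmap_even inH_even inA_even) -nabla_even pg //.
by rewrite -[p2]addFb; apply: par_tens; [exact: par_one|exact: inH_par].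
Qed.

Lemma cop_even : even_map cop.
Proof.
apply: even_mapP => p; apply: tens_pind => [p1 p2 a h pa ph <-|r u v Pu Pv].
  rewrite /= copE; apply: (tact_even smash_even smash_even).
    by rewrite -inA2_even -(scomul_even (shopf_coalg hopfA)) pa.
  by rewrite -delta_even ph.
by rewrite linearP; exact: parP.
Qed.

(** * Coassociativity and the counit *)

Hypothesis DA_coassoc : forall a,
  tassoc (tmap DA idfun (DA a)) = tmap idfun DA (DA a).

Lemma tmap_cop_M u v : tmap cop idfun (smash2 u v) =
  tact smash2 smash (tmap cop idfun u) (tmap cop idfun v).
Proof. by apply: tmap_tact => //; [exact: cop_even|exact: cop_M]. Qed.

Lemma tmap_cop_Mr u v : tmap idfun cop (smash2 u v) =
  tact smash smash2 (tmap idfun cop u) (tmap idfun cop v).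
Proof. by apply: tmap_tact => //; [exact: cop_even|exact: cop_M]. Qed.

Lemma tmap_cop_inA2 s : tmap cop idfun (inA2 s) = tmap inA2 inA (tmap DA idfun s).
Proof.
elim/tensor_ind: s => [a b|r u v Pu Pv]; last by rewrite !linearP /= Pu Pv.
by rewrite !tmapE /= cop_inA.
Qed.

Lemma tmap_cop_inA2r s : tmap idfun cop (inA2 s) = tmap inA inA2 (tmap idfun DA s).
Proof.
elim/tensor_ind: s => [a b|r u v Pu Pv]; last by rewrite !linearP /= Pu Pv.
by rewrite !tmapE /= cop_inA.
Qed.

(** The H-legs of [nabla (x i)] are generators, on which the coproduct is the two-term expression of
    [delta_x]. *)
Lemma tmap_cop_inHA i : tmap cop idfun (inHA (nabla (x i))) =
  tmap inHA inA (tmap nabla idfun (nabla (x i))) + tmap inR inA (nabla (x i)).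
Proof.
pattern (nabla (x i)); apply: nabla_x_ind => [j q c _ _|r u v Pu Pv].
  by rewrite !tmapE /= cop_inH delta_x linearDl.
by rewrite !linearP /= Pu Pv scalerDr addrACA.
Qed.

Lemma tmap_cop_inHAr t : tmap idfun cop (inHA t) =
  tmap inH inA2 (tmap idfun DA t).
Proof.
elim/tensor_ind: t => [a b|r u v Pu Pv]; last by rewrite !linearP /= Pu Pv.
by rewrite !tmapE /= cop_inA.
Qed.

Lemma tassoc_inR t : tassoc (tmap inR inA t) = (eA ⊗ eH) ⊗ inHA t.
Proof.
elim/tensor_ind: t => [a b|r u v Pu Pv].
  by rewrite !tmapE /= tassocE.
by rewrite !linearP linearPr /= Pu Pv.
Qed.

Lemma cop_one : cop (eA ⊗ eH) = one2.
Proof. by rewrite -/(inH eH) cop_inH delta_1. Qed.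

(** On a generator, coassociativity of the coaction matches the terms that involve [nabla] twice or
    [nabla] and [DA]; the terms 1 ⊗ nabla(x) and 1 ⊗ 1 ⊗ x occur on both sides. *)
Lemma cop_coassoc m : tassoc (tmap cop idfun (cop m)) = tmap idfun cop (cop m).
Proof.
elim/smash_ind: m => [r m n Pm Pn|a|i|m n Pm Pn].
- by rewrite !linearP /= Pm Pn.
- by rewrite cop_inA tmap_cop_inA2 tmap_cop_inA2r tassoc_tmap DA_coassoc.
- rewrite cop_inH delta_x !linearD /= tmap_cop_inHA tmap_cop_inHAr linearD /=.
  rewrite tassoc_tmap nabla_coassoc tassoc_inR !tmapE /= cop_one tassocE.
  by rewrite cop_inH delta_x linearDr /= addrA.
- by rewrite cop_M tmap_cop_M tassoc_tact Pm Pn tmap_cop_Mr.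
Qed.

Definition epsM (m : M) : R := epsH (contrl epsA m).
Lemma epsM_scalar : scalar epsM.
Proof. by move=> r m n; rewrite /epsM !linearP. Qed.
HB.instance Definition _ := GRing.isLinear.Build R M R *%R epsM epsM_scalar.
Lemma epsM_tens a h : epsM (a ⊗ h) = epsA a * epsH h.
Proof. by rewrite /epsM contrlE linearZ. Qed.

Lemma eps_par (V : superModType R) (e : {scalar V}) v :
  even_form e -> par true v -> e v = 0.
Proof. by move=> ee <-; exact: ee. Qed.

Lemma epsM_even : even_form epsM.
Proof.
move=> m; elim/tens_hind: m => [p q a h pa qh|r u v Pu Pv].
  have e := par_tens pa qh; have [e1|/negbTE e1] := eqVneq (p (+) q) true.
    move: (e); rewrite e1 => ->; rewrite epsM_tens.
    case: p q pa qh e1 {e} => [] [] pa qh //= _.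
      by rewrite (eps_par (scounit_even (shopf_coalg hopfA)) pa) mul0r.
    by rewrite (eps_par (scounit_even (shopf_coalg hopfH)) qh) mulr0.
  have {}e1 : p (+) q = false by case: (p (+) q) e1.
  by move: (par_off e); rewrite e1 /= => ->; rewrite linear0.
by rewrite !linearP /= Pu Pv mulr0 addr0.
Qed.

Lemma epsM_M m n : epsM (smash m n) = epsM m * epsM n.
Proof.
have eA' a n' : epsM (smash (inA a) n') = epsA a * epsM n'.
  elim/tensor_ind: n' => [b g|r u v Pu Pv].
    by rewrite smash_inA_tens !epsM_tens (scounitM hopfA) mulrA.
  by rewrite linearPr !linearP /= Pu Pv mulrDr mulrCA.
have ex i n' : epsM (smash (inH (x i)) n') = 0.
  elim/tens_hind: n' => [p1 p2 b g pb pg|r u v Pu Pv]; last first.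
    by rewrite linearPr !linearP /= Pu Pv mulr0 addr0.
  rewrite (smash_x_tens _ _ pb) linearD linearZ /= !epsM_tens epsA_act_x.
  by rewrite (scounitM hopfH) epsH_x !(mul0r, mulr0) addr0.
have eH' h n' : epsM (smash (inH h) n') = epsH h * epsM n'.
  elim/H_ind: h n' => [r g h Pg Ph n'|n'|i h Ph n'].
  - by rewrite [inH _]linearP linearPl !linearP /= Pg Ph mulrDl mulrA.
  - by rewrite smash1l (scounit1 hopfH) mul1r.
  - by rewrite smash_inH_M ex (scounitM hopfH) epsH_x !mul0r.
elim/tensor_ind: m => [a h|r u v Pu Pv].
  by rewrite (smash_tens a h n) eA' eH' epsM_tens mulrA.
by rewrite linearPl !linearP /= Pu Pv mulrDl mulrA.
Qed.

(** A sign can arise only when the first leg [m'] of [v] is odd, and then [epsM m'] is 0 and both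
    sides vanish. *)
Lemma contrl_smash2 u v :
  contrl epsM (smash2 u v) = smash (contrl epsM u) (contrl epsM v).
Proof.
elim/tens_hind: u => [p1 p2 m n pm pn|r u u' Pu Pu']; last first.
  by rewrite linearPl !linearP linearPl /= Pu Pu'.
elim/tens_hind: v => [q1 q2 m' n' qm qn|r v v' Pv Pv']; last first.
  by rewrite linearPr !linearP linearPr /= Pv Pv'.
rewrite (tactE pn qm) linearZ /= !contrlE /= epsM_M linearZl_LR linearZr /=.
rewrite !scalerA; case: q1 qm => qm; last by rewrite muln0 mul1r.
by rewrite (eps_par epsM_even qm) !mulr0 !scale0r.
Qed.

Lemma contrr_smash2 u v :
  contrr epsM (smash2 u v) = smash (contrr epsM u) (contrr epsM v).
Proof.
elim/tens_hind: u => [p1 p2 m n pm pn|r u u' Pu Pu']; last first.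
  by rewrite linearPl !linearP linearPl /= Pu Pu'.
elim/tens_hind: v => [q1 q2 m' n' qm qn|r v v' Pv Pv']; last first.
  by rewrite linearPr !linearP linearPr /= Pv Pv'.
rewrite (tactE pn qm) linearZ /= !contrrE /= epsM_M linearZl_LR linearZr /=.
rewrite !scalerA; case: p2 pn => pn; last by rewrite mul0n mul1r.
by rewrite (eps_par epsM_even pn) !(mul0r, mulr0) !scale0r.
Qed.

Lemma contrl_inHA t : contrl epsM (inHA t) = inA (contrl epsH t).
Proof.
elim/tensor_ind: t => [h a|r u v Pu Pv]; last by rewrite !linearP /= Pu Pv.
by rewrite tmapE !contrlE /= epsM_tens (scounit1 hopfA) mul1r linearZ.
Qed.

Lemma contrr_inHA t : contrr epsM (inHA t) = inH (contrr epsA t).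
Proof.
elim/tensor_ind: t => [h a|r u v Pu Pv]; last by rewrite !linearP /= Pu Pv.
by rewrite tmapE !contrrE /= epsM_tens (scounit1 hopfH) mulr1 linearZ.
Qed.

Lemma contrl_inA2 t : contrl epsM (inA2 t) = inA (contrl epsA t).
Proof.
elim/tensor_ind: t => [h a|r u v Pu Pv]; last by rewrite !linearP /= Pu Pv.
by rewrite tmapE !contrlE /= epsM_tens (scounit1 hopfH) mulr1 linearZ.
Qed.

Lemma contrr_inA2 t : contrr epsM (inA2 t) = inA (contrr epsA t).
Proof.
elim/tensor_ind: t => [h a|r u v Pu Pv]; last by rewrite !linearP /= Pu Pv.
by rewrite tmapE !contrrE /= epsM_tens (scounit1 hopfH) mulr1 linearZ.
Qed.

Lemma cop_counitl m : contrl epsM (cop m) = m.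
Proof.
elim/smash_ind: m => [r m n Pm Pn|a|i|m n Pm Pn].
- by rewrite !linearP /= Pm Pn.
- by rewrite cop_inA contrl_inA2 contrl_sw (scounitl (shopf_coalg hopfA)).
- rewrite cop_inH delta_x linearD /= contrl_inHA nabla_eps epsH_x scale0r linear0.
  by rewrite add0r contrlE /= epsM_tens (scounit1 hopfA) (scounit1 hopfH) mulr1 scale1r.
- by rewrite cop_M contrl_smash2 Pm Pn.
Qed.

Lemma cop_counitr m : contrr epsM (cop m) = m.
Proof.
elim/smash_ind: m => [r m n Pm Pn|a|i|m n Pm Pn].
- by rewrite !linearP /= Pm Pn.
- by rewrite cop_inA contrr_inA2 contrr_sw (scounitr (shopf_coalg hopfA)).
- rewrite cop_inH delta_x linearD /= contrr_inHA nabla_counit contrrE /= epsM_tens.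
  by rewrite epsH_x mulr0 scale0r addr0.
- by rewrite cop_M contrr_smash2 Pm Pn.
Qed.

(** * The antipode *)

Hypothesis SH_SA_antipode : forall h a,
  [/\ tl mH (tmap SH idfun (DH h)) = epsH h *: eH,
      tl mH (tmap idfun SH (DH h)) = epsH h *: eH,
      tl mA (tmap SA idfun (DA a)) = epsA a *: eA &
      tl mA (tmap idfun SA (DA a)) = epsA a *: eA].

(** The diagonal coaction on H ⊗ H, with the A-legs multiplied; [nabla_comul] then says that [DH] is
    colinear. *)
Definition ncomul_pure g h : (H ⊗ (H ⊗ A))%type :=
  tassoc (tact (@tens R H H) mA (nabla g) (nabla h)).
Lemma ncomul_bilinear : bilinear_for *:%R *:%R ncomul_pure.
Proof.
by split=> [h r g g'|g r h h'] /=; rewrite /ncomul_pure linearP ?linearPl ?linearPr linearP.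
Qed.
Definition ncomul (t : (H ⊗ H)%type) : (H ⊗ (H ⊗ A))%type := tlift ncomul_pure t.
Lemma ncomul_linear : linear ncomul. Proof. exact/tlift_linear/ncomul_bilinear. Qed.
HB.instance Definition _ := GRing.isLinear.Build R (H ⊗ H)%type
  (H ⊗ (H ⊗ A))%type *:%R ncomul ncomul_linear.
Lemma ncomulE g h : ncomul (g ⊗ h) =
  tassoc (tact (@tens R H H) mA (nabla g) (nabla h)).
Proof. exact: (tlift_tens ncomul_bilinear). Qed.

Hypothesis nabla_comul : forall h,
  tassoc (tmap DH idfun (nabla h)) = ncomul (DH h).

Definition theta (t : (H ⊗ A)%type) : M := tl smash (tmap inH inA (tmap SH SA t)).
Lemma theta_linear : linear theta.
Proof. by move=> r s t; rewrite /theta !linearP. Qed.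
HB.instance Definition _ := GRing.isLinear.Build R (H ⊗ A)%type M *:%R theta
  theta_linear.
Lemma thetaE h a : theta (h ⊗ a) = smash (inH (SH h)) (inA (SA a)).
Proof. by rewrite /theta !tmapE tlE. Qed.

Definition theta1 (t : (H ⊗ A)%type) : M :=
  tl smash (tmap inH inA (tmap idfun SA t)).
Lemma theta1_linear : linear theta1.
Proof. by move=> r s t; rewrite /theta1 !linearP. Qed.
HB.instance Definition _ := GRing.isLinear.Build R (H ⊗ A)%type M *:%R theta1
  theta1_linear.
Lemma theta1E h a : theta1 (h ⊗ a) = smash (inH h) (inA (SA a)).
Proof. by rewrite /theta1 !tmapE tlE. Qed.

Definition antiM_pure a h : M := theta (tact mH mA (eH ⊗ a) (nabla h)).
Lemma antiM_bilinear : bilinear_for *:%R *:%R antiM_pure.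
Proof.
split=> [h r a a'|a r h h'] /=; rewrite /antiM_pure.
  by rewrite linearPr linearPl linearP.
by rewrite linearP linearPr linearP.
Qed.
Definition antiM (m : M) : M := tlift antiM_pure m.
Lemma antiM_linear : linear antiM.
Proof. exact/tlift_linear/antiM_bilinear. Qed.
HB.instance Definition _ := GRing.isLinear.Build R M M *:%R antiM antiM_linear.
Lemma antiME a h : antiM (a ⊗ h) = theta (tact mH mA (eH ⊗ a) (nabla h)).
Proof. exact: (tlift_tens antiM_bilinear). Qed.

Lemma SH_even : even_map SH. Proof. exact: santipode_even hopfH. Qed.
Lemma SA_even : even_map SA. Proof. exact: santipode_even hopfA. Qed.

Lemma antiM_even : even_map antiM.
Proof.
apply: even_mapP => p; apply: tens_pind => [p1 p2 a h pa ph <-|r u v Pu Pv].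
  rewrite /= antiME; have : par (p1 (+) p2) (tact mH mA (eH ⊗ a) (nabla h)).
    apply: (tact_even (smul_even smH) (smul_even smA)).
      by rewrite -[p1]addFb; exact: (par_tens par_eH pa).
    by rewrite -nabla_even ph.
  move: (tact _ _ _ _); apply: tens_pind => [q1 q2 g b qg qb <-|r u v Pu Pv].
    rewrite thetaE; apply: smash_even.
      by apply: inH_par; rewrite /par -SH_even qg.
    by apply: inA_par; rewrite /par -SA_even qb.
  by rewrite linearP; exact: parP.
by rewrite linearP; exact: parP.
Qed.

Lemma antil_inR u h :
  tl smash (tmap antiM idfun (smash2 u (inR h))) =
  smash (tl smash (tmap antiM idfun u)) (inH h).
Proof.
elim/tensor_ind: u => [m n|r u v Pu Pv].
  by rewrite smash2_inR !tmapE !tlE /= smashA.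
by rewrite linearPl !linearP linearPl /= Pu Pv.
Qed.

Definition antl (w : (A ⊗ A)%type) : A := tl mA (tmap SA idfun w).
Lemma antl_linear : linear antl.
Proof. by move=> r s t; rewrite /antl !linearP. Qed.
HB.instance Definition _ := GRing.isLinear.Build R (A ⊗ A)%type A *:%R antl
  antl_linear.

(* Convolution of the antipode with the identity, before coassociativity of
   the coaction is used. *)
Lemma antil_inHA s t : tl smash (tmap antiM idfun (smash2 (inA2 s) (inHA t))) =
  tl smash (tmap inH inA (tmap SH antl
    (tact mH (tact mA mA) (eH ⊗ s) (tassoc (tmap nabla idfun t))))).
Proof.
elim/tens_hind: s => [p1 p2 a b pa pb|r u v Pu Pv]; last first.
  by rewrite [tmap _ _ (r *: u + v)]linearP linearPr !linearPl !linearP /= Pu Pv.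
elim/tens_hind: t => [p q k c pk qc|r u v Pu Pv]; last first.
  by rewrite !(linearP, linearPr) /= Pu Pv.
rewrite !tmapE (tactE (inA_par pb) (inH_par pk)) /= smash_inAH -inA_M.
rewrite linearZ /= tmapE linearZ /= tlE antiME /=.
have : par p (nabla k) by rewrite /par -nabla_even pk.
move: (nabla k); apply: tens_pind => [q1 q2 l m ql qm e|r u v Pu Pv]; last first.
  rewrite !(linearP, linearPr, linearPl) /=.
  by rewrite Pu Pv.
rewrite tassocE (tactE pa ql) (tactE (par_tens pa pb) ql) /= (tactE pb qm).
rewrite !(smul1l smH) !linearZ linearZl_LR linearZr /= !linearZ /= thetaE !tmapE tlE /=.
rewrite !linearZ /= /antl tmapE !tlE /= !inA_M -!smashA !scalerA.
congr (_ *: _); rewrite -e.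
by case: p1 {pa}; case: p2 {pb}; case: q1 {ql e}; case: q2 {qm}; sgn.
Qed.

(** Coassociativity of the coaction brings the second and third legs into the form DA(a h^(2)), and
    the antipode of A collapses them to a counit. What is left of the coaction is S(h1), by its
    counit axiom, and S(h1) h2 is the counit of h. *)
Lemma antilr a h : tl smash (tmap antiM idfun (cop (a ⊗ h))) =
  epsM (a ⊗ h) *: (eA ⊗ eH).
Proof.
have main k : tl smash (tmap antiM idfun (smash2 (inA2 (DA a)) (inHA (nabla k)))) =
    epsA a *: inH (SH k).
  rewrite antil_inHA nabla_coassoc.
  have -> : eH ⊗ DA a = tmap idfun DA (eH ⊗ a) by rewrite tmapE.
  have DAe := scomul_even (shopf_coalg hopfA).
  rewrite -(@tmap_tact _ _ _ _ _ _ _ _ _ _ _ _ _ mH mA mH (tact mA mA)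
    idfun idfun idfun DA DA DA) //; last exact: DA_M.
  rewrite -[in RHS](nabla_counit k).
  elim/tens_hind: (nabla k) => [p q g c pg qc|r u v Pu Pv]; last first.
    by rewrite !(linearP, linearPr) /= Pu Pv.
  have aE a' : antl (DA (mA a' c)) = (epsA a' * epsA c) *: eA.
    rewrite /antl; have [_ _ -> _] := SH_SA_antipode eH (mA a' c).
    by rewrite (scounitM hopfA).
  (* [a] is not homogeneous here, so the sign is kept as a splitting of [a]; its odd part dies
     because [epsA] is even. *)
  rewrite tact_pureE /tact_pure !linearD /= !tmapE /= !aE.
  rewrite (scounit_even (shopf_coalg hopfA)) mul0r scale0r.
  rewrite [inA 0]linear0 linear0r [tl _ 0]linear0 addr0.
  have -> : epsA (hpart false a) = epsA a.
    by rewrite -[in RHS](hpartD a) linearD /= (scounit_even (shopf_coalg hopfA)) addr0.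
  rewrite !(smul1l smH) [inA _]linearZ linearZr linearZ /= tlE /= contrrE.
  by rewrite [SH (_ *: _)]linearZ [inH (_ *: _)]linearZ /= smash1r !scalerA.
have sub t : tl smash (tmap antiM idfun (smash2 (inA2 (DA a)) (delta2 t))) =
    epsA a *: inH (tl mH (tmap SH idfun t)).
  elim/tensor_ind: t => [g k|r u v Pu Pv]; last first.
    by rewrite !(linearP, linearPr) /= Pu Pv.
  by rewrite delta2E smash2A antil_inR main linearZl_LR /= -inH_M tmapE tlE.
rewrite copE /delta sub epsM_tens; have [-> _ _ _] := SH_SA_antipode h eA.
by rewrite [inH _]linearZ /= scalerA.
Qed.

Definition tens1 (h : H) : (H ⊗ A)%type := h ⊗ eA.
Lemma tens1_linear : linear tens1. Proof. by move=> r g h; rewrite /tens1 linearPl. Qed.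
HB.instance Definition _ := GRing.isLinear.Build R H (H ⊗ A)%type *:%R tens1
  tens1_linear.

Definition antr (t : (H ⊗ (H ⊗ A))%type) : (H ⊗ A)%type :=
  tl (tact mH mA) (tmap tens1 (tmap SH idfun) t).
Lemma antr_linear : linear antr.
Proof. by move=> r s t; rewrite /antr !linearP. Qed.
HB.instance Definition _ := GRing.isLinear.Build R (H ⊗ (H ⊗ A))%type
  (H ⊗ A)%type *:%R antr antr_linear.
Lemma antrE g h a : antr (g ⊗ (h ⊗ a)) = mH g (SH h) ⊗ a.
Proof.
by rewrite /antr !tmapE tlE /= tmapE (tactE0 _ _ _ _ _ par_eA) (smul1l smA).
Qed.

(** The antipode of the second factor contributes S(h2^(1)) and S(b h1^(2) h2^(2)). The H-factors
    thus meet as h1^(1) S(h2^(1)) next to h1^(2) h2^(2), which is [antr] applied to the diagonal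
    coaction. *)
Lemma antir_pure p a b t : par p b ->
  tl smash (tmap idfun antiM (smash2 (inA a ⊗ inA b) (delta2 t))) =
  smash (inA a) (theta1 (tact mH mA (eH ⊗ b) (antr (ncomul t)))).
Proof.
move=> pb; elim/tensor_ind: t => [g h|r u v Pu Pv]; last first.
  by rewrite !(linearP, linearPr) /= Pu Pv.
rewrite delta2E ncomulE.
elim/tens_hind: (nabla g) => [p1 p2 k c pk pc|r u v Pu Pv]; last first.
  by rewrite !(linearP, linearPr, linearPl) /= Pu Pv.
rewrite tmapE smash2_inR smash_inAH (tactE (inA_par pb) (inH_par pk)) /=.
rewrite smash_inA_tens linearZ /= tmapE linearZ /= tlE /= antiME.
elim/tens_hind: (nabla h) => [q1 q2 l d ql qd|r u v Pu Pv]; last first.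
  by rewrite !(linearP, linearPr) /= Pu Pv.
rewrite (tactE pc ql) (tactE (smul_even smA pb pc) ql) (smul1l smH) !linearZ /=.
rewrite tassocE antrE thetaE 2!linearZr /=.
have qsl : par q1 (SH l) by rewrite /par -SH_even ql.
rewrite (tactE pb (smul_even smH pk qsl)) (smul1l smH) [_ *: (_ *: (_ ⊗ _))]scalerA
  [theta1 _]linearZ /= [smash _ (_ *: theta1 _)]linearZr /= theta1E.
rewrite inH_M -!smashA mAA !scalerA; congr (_ *: _).
by case: p {pb}; case: p1 {pk}; case: p2 {pc}; case: q1 {ql qsl}; sgn.
Qed.

(** Colinearity of [DH] replaces the diagonal coaction by [DH] on the H-leg of [nabla h], where the
    antipode of H applies; [nabla_eps] reduces the rest to [epsH h], and a1 S(a2) remains. *)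
Lemma antirr a h : tl smash (tmap idfun antiM (cop (a ⊗ h))) =
  epsM (a ⊗ h) *: (eA ⊗ eH).
Proof.
have antr_nabla : antr (ncomul (DH h)) = eH ⊗ (epsH h *: eA).
  rewrite -nabla_comul -nabla_eps.
  have aE g c : antr (tassoc (DH g ⊗ c)) = eH ⊗ (epsH g *: c).
    have -> : antr (tassoc (DH g ⊗ c)) = tl mH (tmap idfun SH (DH g)) ⊗ c.
      elim/tensor_ind: (DH g) => [k l|r u v Pu Pv].
        by rewrite tassocE antrE tmapE tlE.
      by rewrite !(linearPl, linearP) /= Pu Pv.
    by have [_ -> _ _] := SH_SA_antipode g eA; rewrite linearZl_LR linearZr.
  elim/tensor_ind: (nabla h) => [g c|r u v Pu Pv].
    by rewrite tmapE aE contrlE.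
  by rewrite !linearP linearPr /= Pu Pv.
have sub s : tl smash (tmap idfun antiM (smash2 (inA2 s) (delta h))) =
    epsH h *: inA (tl mA (tmap idfun SA s)).
  elim/tens_hind: s => [p q b c pb qc|r u v Pu Pv]; last first.
    rewrite [tmap _ _ (r *: u + v)]linearP linearPl !linearP /= Pu Pv.
    by rewrite ?linearP.
  rewrite !tmapE /delta (antir_pure _ _ qc) antr_nabla.
  rewrite (tactE qc par_eH) muln0 scale1r (smul1l smH) linearZr /= (smul1r smA).
  by rewrite linearZr linearZ linearZr /= theta1E smash1l -inA_M tlE.
rewrite copE sub epsM_tens; have [_ _ _ ->] := SH_SA_antipode eH a.
by rewrite [inA _]linearZ /= scalerA mulrC.
Qed.

Lemma smash_super_hopf : is_super_hopf smash (eA ⊗ eH) cop epsM antiM.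
Proof.
have antl_m m : tl smash (tmap antiM idfun (cop m)) = epsM m *: (eA ⊗ eH).
  elim/tensor_ind: m => [a h|r u v Pu Pv]; first exact: antilr.
  by rewrite !linearP /= Pu Pv scalerDl scalerA.
have antr_m m : tl smash (tmap idfun antiM (cop m)) = epsM m *: (eA ⊗ eH).
  elim/tensor_ind: m => [a h|r u v Pu Pv]; first exact: antirr.
  by rewrite !linearP /= Pu Pv scalerDl scalerA.
split.
- exact: smash_superalgebra.
- split.
  + move=> m; rewrite -[LHS]tassoc_tmap_sw -[RHS]tmap_id_sw; exact: cop_coassoc.
  + by move=> m; rewrite -contrl_sw cop_counitl.
  + by move=> m; rewrite -contrr_sw cop_counitr.
  + exact: cop_even.
  + exact: epsM_even.
- by move=> m n; rewrite -tact_sw; exact: cop_M.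
- exact: cop_one.
- exact: epsM_M.
- by rewrite /= epsM_tens (scounit1 hopfA) (scounit1 hopfH) mulr1.
- by move=> m; rewrite -[RHS]antl_m tl_sw_l.
- by move=> m; rewrite -[RHS]antr_m tl_sw_r.
- exact: antiM_even.
Qed.

(** * Sweedler forms of the structure maps *)

Lemma smash_sw a h b g p : par p b -> smash (a ⊗ h) (b ⊗ g) =
  \sw_(h1, h2 <- DH h)
    (-1) ^+ (deg h2 * deg b) *: (mA a (act h1 b) ⊗ mH h2 g).
Proof.
move=> /deg_par pb; rewrite smashE (@swE _ _ _ _ (fun t => tact mA mH (a ⊗ eH)
  (tact act mH t (b ⊗ g)))); last by move=> r u v; rewrite linearPl linearPr.
apply: eq_sw => h1 h2 _ ph2.
by rewrite (tactE ph2 pb) linearZr /= (tactE0 _ _ _ _ _ par_eH) (smul1l smH).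
Qed.

Lemma cop_sw a h : cop (a ⊗ h) =
  \sw_(a1, a2 <- DA a) \sw_(h1, h2 <- DH h) \sw_(k1, k2 <- nabla h1)
    (-1) ^+ (deg k1 * deg a2) *: ((a1 ⊗ k1) ⊗ (mA a2 k2 ⊗ h2)).
Proof.
rewrite copE (@swE _ _ _ _ (fun s => smash2 (inA2 s) (delta h))); last first.
  by move=> r u v; rewrite linearP linearPl.
apply: eq_sw => a1 a2 _ pa2.
rewrite /delta (@swE _ _ _ _ (fun t => smash2 (inA2 (a1 ⊗ a2)) (delta2 t))).
  apply: eq_sw => h1 h2 _ _; rewrite delta2E.
  rewrite (@swE _ _ _ _ (fun t => smash2 (inA2 (a1 ⊗ a2)) (smash2 (inHA t) (inR h2)))).
    apply: eq_sw => k1 k2 pk1 _; rewrite !tmapE smash2_inR /= smash_inAH.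
    rewrite (tactE (inA_par pa2) (inH_par pk1)) /= smash_inAH smash_inA_tens.
    by rewrite mulnC.
  by move=> r u v; rewrite linearP linearPl linearPr.
by move=> r u v; rewrite linearP linearPr.
Qed.

Lemma antiM_sw a h p : par p a -> antiM (a ⊗ h) =
  \sw_(k1, k2 <- nabla h)
    (-1) ^+ (deg k1 * deg a) *: smash (inH (SH k1)) (inA (SA (mA a k2))).
Proof.
move=> /deg_par pa; rewrite antiME.
rewrite (@swE _ _ _ _ (fun t => theta (tact mH mA (eH ⊗ a) t))); last first.
  by move=> r u v; rewrite linearPr linearP.
apply: eq_sw => k1 k2 pk1 _.
by rewrite (tactE pa pk1) linearZ /= thetaE (smul1l smH) mulnC.
Qed.

Lemma lact_sw h s : lact h s =
  \sw_(h1, h2 <- DH h) \sw_(k1, k2 <- nabla h1) \sw_(a1, a2 <- s)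
    (-1) ^+ (deg a1 * (deg k2 + deg h2)) *: (act k1 a1 ⊗ mA k2 (act h2 a2)).
Proof.
rewrite /lact /delta (@swE _ _ _ _ (fun t => tact mact mact (delta2 t) s)).
  apply: eq_sw => h1 h2 _ ph2; rewrite delta2E.
  rewrite (@swE _ _ _ _ (fun t => tact mact mact (smash2 (inHA t) (inR h2)) s)).
    apply: eq_sw => k1 k2 _ pk2; rewrite tmapE smash2_inR /= smash_inAH tact_sw_r.
    apply: eq_sw => a1 a2 pa1 _; rewrite (tactE (par_tens pk2 ph2) pa1) /= !mactE.
    rewrite (smul1l smA); congr (_ *: _).
    by case: (deg k2); case: (deg h2); case: (deg a1); sgn.
  by move=> r u v; rewrite linearP !linearPl.
by move=> r u v; rewrite linearP linearPl.
Qed.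

(** Super cocommutativity: the flip is an algebra map of H ⊗ H and fixes the coproducts of the
    primitive generators. *)
Lemma tswap_DH h : tswap (DH h) = DH h.
Proof.
elim/H_ind: h => [r g h Pg Ph||i h Ph].
- by rewrite !linearP /= Pg Ph.
- by rewrite (scomul1 hopfH) (tswapE par_eH par_eH) scale1r.
- rewrite DH_M (tswap_tact _ _ (smul_even smH) (smul_even smH)) Ph DH_x linearD /=.
  rewrite (tswapE (par_x i) par_eH) (tswapE par_eH (par_x i)) muln0 mul0n !scale1r.
  by rewrite [X in tact _ _ X]addrC.
Qed.

Lemma act_nabla_compat a h p : par p a ->
  \sw_(h1, h2 <- DH h) \sw_(k1, k2 <- nabla h2)
     (-1) ^+ (deg h1 * deg k1 + deg a * deg k2) *: (k1 ⊗ mA (act h1 a) k2) =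
  \sw_(h1, h2 <- DH h) \sw_(k1, k2 <- nabla h1) k1 ⊗ mA k2 (act h2 a).
Proof.
move=> /deg_par pa.
(* [F h1 h2] is the summand of the right-hand side. The left-hand side is the same sum over the
   flipped coproduct, after moving the A-leg past h |> a. *)
pose F g h := tact mH mA (nabla g) (eH ⊗ act h a).
have Fb : bilinear_for *:%R *:%R F.
  split=> [k r g g'|g r k k'] /=; rewrite /F; first by rewrite linearP linearPl.
  by rewrite linearPl !linearPr.
have FE g k : F g k = \sw_(k1, k2 <- nabla g) k1 ⊗ mA k2 (act k a).
  rewrite /F (@swE _ _ _ _ (fun t => tact mH mA t (eH ⊗ act k a))).
    by apply: eq_sw => k1 k2 _ pk2; rewrite (tactE pk2 par_eH) muln0 scale1r
      (smul1r smH).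
  by move=> r u v; rewrite linearPl.
transitivity (tlift F (DH h)); last first.
  rewrite (swE _ (tlift_linear Fb)); apply: eq_sw => h1 h2 _ _.
  by rewrite (tlift_tens Fb) FE.
rewrite -tswap_DH (@swE _ _ _ _ (fun t => tlift F (tswap t))); last first.
  by move=> r u v; rewrite linearP (tlift_linear Fb).
rewrite tswap_DH; apply: eq_sw => h1 h2 p1 p2.
rewrite (tswapE p1 p2) -[_ *: _]addr0 (tlift_linear Fb).
have -> : tlift F 0 = 0.
  have := tlift_linear Fb (-1) 0 0; rewrite scaler0 addr0 scaleN1r addNr.
  by [].
rewrite addr0 (tlift_tens Fb) FE.
(* The parities of the legs of [nabla h2] add up to that of [h2]; the signs on the two sides agree
   only modulo this relation. *)
have pn : par (deg h2) (nabla h2) by rewrite /par -nabla_even p2.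
have pha := act_even p1 pa.
pose F1 (q1 q2 : bool) (v : H) (w : A) :=
  (-1) ^+ (deg h1 * q1 + deg a * q2) *: (v ⊗ mA (act h1 a) w).
pose F2 (q1 q2 : bool) (v : H) (w : A) :=
  (-1) ^+ (deg h1 * deg h2) *: (v ⊗ mA w (act h1 a)).
have F1b q1 q2 : bilinear_for *:%R *:%R (F1 q1 q2).
  split=> [k r g g'|g r k k'] /=; rewrite /F1 ?linearPl ?linearPr ?linearPr /=;
    by rewrite scalerDr !scalerA mulrC.
have F2b q1 q2 : bilinear_for *:%R *:%R (F2 q1 q2).
  split=> [k r g g'|g r k k'] /=; rewrite /F2 ?linearPl ?linearPr /=;
    by rewrite scalerDr !scalerA mulrC.
have lF2 : linear (fun u : (H ⊗ A)%type => (-1) ^+ (deg h1 * deg h2) *: u).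
  by move=> r u v; rewrite scalerDr !scalerA mulrC.
rewrite [RHS](sw_linear _ _ lF2).
apply: (eq_sw_par F1b F2b _ pn) => q1 q2 v w qv qw e.
rewrite /F1 /F2 (mA_comm pha qw) linearZr /= scalerA; congr (_ *: _).
rewrite -e; case: (deg h1); case: (deg a); case: q1 {qv e}; case: q2 {qw}; sgn.
Qed.

End Smash.
(** * Formal power series *)

Section Series.
Variable A : nzRingType.

(** The coefficient ring is not assumed commutative, because F(G) is only supercommutative. *)
Definition series : Type := nat -> A.
HB.instance Definition _ := gen_eqMixin series.
HB.instance Definition _ := gen_choiceMixin series.

Implicit Types f g h : series.

Definition series0 : series := fun=> 0.
Definition series1 : series := fun n => (n == 0)%:R.
Definition series_opp f : series := fun n => - f n.
Definition series_add f g : series := fun n => f n + g n.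
Definition series_mul f g : series := fun n => \sum_(i < n.+1) f i * g (n - i)%N.

Lemma series_addA : associative series_add.
Proof. by move=> f g h; apply/funext => n; exact: addrA. Qed.
Lemma series_addC : commutative series_add.
Proof. by move=> f g; apply/funext => n; exact: addrC. Qed.
Lemma series_add0 : left_id series0 series_add.
Proof. by move=> f; apply/funext => n; exact: add0r. Qed.
Lemma series_addN : left_inverse series0 series_opp series_add.
Proof. by move=> f; apply/funext => n; exact: addNr. Qed.
HB.instance Definition _ := GRing.isZmodule.Build series
  series_addA series_addC series_add0 series_addN.

(** In degrees at most [n] a product of series only sees the truncations at [n], so ring identities
    are inherited from polynomials. *)
Definition trunc n f : {poly A} := \poly_(i < n.+1) f i.

Lemma trunc_mul n m f g : (m <= n)%N ->
  series_mul f g m = (trunc n f * trunc n g)`_m.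
Proof.
move=> mn; rewrite coefM; apply: eq_bigr => i _; rewrite !coef_poly.
have im : (i <= m)%N by rewrite -ltnS.
by rewrite !ltnS (leq_trans im mn) (leq_trans (leq_subr i m) mn).
Qed.

Lemma coef_trunc n m f : (m <= n)%N -> (trunc n f)`_m = f m.
Proof. by move=> mn; rewrite coef_poly ltnS mn. Qed.

Lemma coefM_le (p q p' q' : {poly A}) n :
  (forall m, (m <= n)%N -> p`_m = p'`_m) -> (forall m, (m <= n)%N -> q`_m = q'`_m) ->
  (p * q)`_n = (p' * q')`_n.
Proof.
move=> pp qq; rewrite !coefM; apply: eq_bigr => i _.
by rewrite pp -1?ltnS // qq // leq_subr.
Qed.

Lemma series_mulA : associative series_mul.
Proof.
move=> f g h; apply/funext => n; rewrite !(@trunc_mul n) //.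
rewrite (@coefM_le _ _ (trunc n f) (trunc n g * trunc n h)) //; last first.
  by move=> m mn; rewrite coef_trunc // (@trunc_mul n).
rewrite mulrA; apply: coefM_le => // m mn.
by rewrite coef_trunc // (@trunc_mul n).
Qed.

Lemma series_mul1l : left_id series1 series_mul.
Proof.
move=> f; apply/funext => n; rewrite /series_mul big_ord_recl /series1 /= mul1r subn0.
by rewrite big1 ?addr0 // => i _; rewrite mul0r.
Qed.

Lemma series_mul1r : right_id series1 series_mul.
Proof.
move=> f; apply/funext => n; rewrite /series_mul big_ord_recr /series1 /=.
rewrite subnn eqxx mulr1 big1 ?add0r // => i _.
by rewrite subn_eq0 leqNgt ltn_ord mulr0.
Qed.

Lemma series_mulDl : left_distributive series_mul +%R.
Proof.
move=> f g h; apply/funext => n; rewrite /series_mul [RHS]/(series_add _ _ n) /series_add.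
by rewrite -big_split; apply: eq_bigr => i _; rewrite mulrDl.
Qed.

Lemma series_mulDr : right_distributive series_mul +%R.
Proof.
move=> f g h; apply/funext => n; rewrite /series_mul [RHS]/(series_add _ _ n) /series_add.
by rewrite -big_split; apply: eq_bigr => i _; rewrite mulrDr.
Qed.

HB.instance Definition _ := GRing.Zmodule_isPzRing.Build series
  series_mulA series_mul1l series_mul1r series_mulDl series_mulDr.

Lemma seriesD f g n : (f + g) n = f n + g n. Proof. by []. Qed.
Lemma seriesN f n : (- f) n = - f n. Proof. by []. Qed.
Lemma series0E n : (0 : series) n = 0. Proof. by []. Qed.
Lemma series1E n : (1 : series) n = (n == 0)%:R. Proof. by []. Qed.
Lemma seriesM f g n : (f * g) n = \sum_(i < n.+1) f i * g (n - i)%N.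
Proof. by []. Qed.
Lemma seriesMn f k n : (f *+ k) n = f n *+ k.
Proof. by elim: k => [//|k IH]; rewrite !mulrS seriesD IH. Qed.

Definition cst (c : A) : series := fun n => if n is 0%N then c else 0.
(** In terms of the variable t, [shift] is multiplication by t, [deriv_s] is d/dt and [euler] is t
    d/dt. *)
Definition shift f : series := fun n => if n is m.+1 then f m else 0.
Definition deriv_s f : series := fun n => f n.+1 *+ n.+1.
Definition euler f : series := fun n => f n *+ n.

Lemma cst_mul c f n : (cst c * f) n = c * f n.
Proof.
rewrite seriesM big_ord_recl /= subn0 big1 ?addr0 // => i _.
by rewrite mul0r.
Qed.

Lemma shift_mull f g : shift f * g = shift (f * g).
Proof.
apply/funext => -[|n]; rewrite seriesM big_ord_recl /= mul0r add0r.
  by rewrite big_ord0.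
by apply: eq_bigr => i _.
Qed.

Lemma shift_mulr f g : f * shift g = shift (f * g).
Proof.
apply/funext => -[|n].
  by rewrite seriesM big_ord_recr big_ord0 /= mulr0 addr0.
rewrite seriesM big_ord_recr /= subnn mulr0 addr0.
by apply: eq_bigr => i _; rewrite subSn // -ltnS.
Qed.

Lemma euler_mul f g : euler (f * g) = euler f * g + f * euler g.
Proof.
apply/funext => n; rewrite /euler seriesD !seriesM -sumrMnl -big_split.
apply: eq_bigr => i _ /=; rewrite mulrnAl mulrnAr -mulrnDr subnKC //.
by rewrite -ltnS.
Qed.

Definition order_ge k f := forall n, (n < k)%N -> f n = 0.
Lemma order_geM k l f g : order_ge k f -> order_ge l g -> order_ge (k + l) (f * g).
Proof.
move=> fk gl n nkl; rewrite seriesM big1 // => i _.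
have [ik|ki] := ltnP i k; first by rewrite fk ?mul0r.
have im : (i <= n)%N by rewrite -ltnS.
by rewrite gl ?mulr0 // ltn_subLR // (leq_trans nkl) // leq_add2r.
Qed.

Lemma order_geX k f : f 0%N = 0 -> order_ge k (f ^+ k).
Proof.
move=> f0; elim: k => [|k IH] //; rewrite exprS -add1n.
by apply: order_geM => // -[].
Qed.

(** Obtained by expanding a k-fold product of polynomials; zero parts are still allowed here, unlike
    in the definition of [p_]. *)
Lemma series_exp f k n : (f ^+ k) n =
  \sum_(l : {ffun 'I_k -> 'I_n.+1} | (\sum_j l j == n)%N) \prod_j f (l j).
Proof.
have E m : (m <= n)%N -> (f ^+ k) m = (trunc n f ^+ k)`_m.
  elim: k m => [|k IH] m mn; first by rewrite !expr0 coef1.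
  rewrite !exprS [LHS](@trunc_mul n) //; apply: coefM_le => // i im.
  by rewrite coef_trunc ?IH // (leq_trans im mn).
rewrite E // -[X in _ ^+ X](card_ord k) -prodr_const.
rewrite (eq_bigr (fun=> \sum_(i < n.+1) f i *: 'X^i)); last first.
  by move=> i _; rewrite /trunc poly_def.
rewrite bigA_distr_bigA coef_sum [RHS]big_mkcond; apply: eq_bigr => l _ /=.
have -> : \prod_(i < k) (f (l i) *: 'X^(l i)) =
    (\prod_j f (l j)) *: 'X^(\sum_j l j).
  elim/big_rec3: _ => [|i x y z _ ->]; first by rewrite scale1r expr0.
  rewrite -scalerAl -scalerA; congr (_ *: _).
  by rewrite -!mul_polyC mulrA -(commr_polyXn z%:P) -mulrA -exprD.
by rewrite coefZ coefXn eq_sym; case: eqP; rewrite ?mulr1 ?mulr0.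
Qed.

End Series.
(** * The super Hopf algebras [U(g)] and [F(G)] *)

Section Presented.
Variables (R : comNzRingType) (P : superPresentation R).
Local Notation B := (palg P).

Lemma par_pgen g : par (sgdeg g) (@pgen R P g).
Proof. by rewrite /par [LHS](palg_hpart_pi _ (AGen g)) /= eqxx. Qed.

Lemma palg_pind (K : B -> Prop) :
  (forall r a b, K a -> K b -> K (r *: a + b)) -> K 1 ->
  (forall g a, K a -> K (pgen g * a)) -> forall a, K a.
Proof.
move=> KD K1 Kg.
have K0 : K 0 by rewrite -(addNr 1) -scaleN1r; exact: KD.
have KN a : K a -> K (- a) by move=> Ka; rewrite -scaleN1r -[_ *: _]addr0; exact: KD.
have KDD a b : K a -> K b -> K (a + b).
  by move=> Ka Kb; rewrite -[a]scale1r; exact: KD.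
(* The free right factor [a] makes the product case a composition: the left multipliers that
   preserve [K] are closed under every term constructor. *)
suff H t a : K a -> K (aterm_eval (@pgen R P) t * a).
  by elim/quotW=> t; rewrite pi_aterm -[aterm_eval _ _]mulr1; exact: H.
elim: t a => /= [g|||t IH|s IHs t IHt|s IHs t IHt|r t IH] a Ka.
- exact: Kg.
- by rewrite mul0r.
- by rewrite mul1r.
- by rewrite mulNr; exact/KN/IH.
- by rewrite mulrDl; apply: KDD; [exact: IHs|exact: IHt].
- by rewrite -mulrA; exact/IHs/IHt.
- by rewrite -scalerAl -[_ *: _]addr0; apply: KD => //; exact: IH.
Qed.

Lemma par1 : par false (1 : B).
Proof. by rewrite /par [LHS](palg_hpart_pi _ AOne). Qed.

Lemma hpart_mull p q (a b : B) : par p a -> hpart q (a * b) = a * hpart (p (+) q) b.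
Proof.
move=> pa; have -> : hpart q (a * b) =
  hpart false a * hpart q b + hpart true a * hpart (~~ q) b by exact: palg_hpartM.
move: (par_off pa) (pa); rewrite /par.
by case: p {pa} => /= -> ->; rewrite mul0r ?addr0 ?add0r.
Qed.

Lemma par_mul p q (a b : B) : par p a -> par q b -> par (p (+) q) (a * b).
Proof. by move=> pa qb; rewrite /par (hpart_mull _ _ pa) addbA addbb qb. Qed.

Lemma par_sum (V : superModType R) p (J : Type) (r : seq J) (Q : pred J)
    (F : J -> V) :
  (forall j, Q j -> par p (F j)) -> par p (\sum_(j <- r | Q j) F j).
Proof.
by move=> PF; elim/big_ind: _ => [|u v|//]; [exact: par0|exact: parD].
Qed.

Hypothesis genC : forall g h : sgen P,
  pgen g * pgen h = (-1) ^+ (sgdeg g * sgdeg h) *: (pgen h * pgen g) :> B.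

(** A generator is first commuted with an arbitrary element, then two arbitrary elements. Both
    inductions are on words and leave the homogeneous elements, hence the use of [hpart] on each
    factor. *)
Lemma palg_supercomm p q (a b : B) : par p a -> par q b ->
  a * b = (-1) ^+ (p * q) *: (b * a).
Proof.
have gC g q' b' : pgen g * hpart q' b' =
    (-1) ^+ (sgdeg g * q') *: (hpart q' b' * pgen g) :> B.
  elim/palg_pind: b' q' => [r u v Pu Pv q'||h c Pc q'].
  - by rewrite linearP mulrDr mulrDl -scalerAl -scalerAr Pu Pv scalerDr !scalerA
      [r * _]mulrC.
  - case=> /=; first by rewrite (par_off par1) mulr0 mul0r scaler0.
    by rewrite par1 mulr1 mul1r muln0 scale1r.
  - rewrite (hpart_mull _ _ (par_pgen h)) mulrA genC -scalerAl -!mulrA Pc.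
    rewrite -scalerAr scalerA; congr (_ *: _).
    by case: (sgdeg g); case: (sgdeg h); case: q'; sgn.
move=> <- <-.
elim/palg_pind: a p => [r u v Pu Pv p|p|h c Pc p].
- by rewrite linearP mulrDl mulrDr -scalerAl -scalerAr Pu Pv scalerDr !scalerA
    [r * _]mulrC.
- case: p => /=; first by rewrite (par_off par1) mul0r mulr0 scaler0.
  by rewrite par1 mulr1 mul1r mul0n scale1r.
- rewrite (hpart_mull _ _ (par_pgen h)) -mulrA Pc -scalerAr [in LHS]mulrA (gC h q b) -scalerAl.
  rewrite scalerA -mulrA; congr (_ *: _).
  by case: (sgdeg h); case: (p); case: (q); sgn.
Qed.

End Presented.

Lemma FG2_supercomm (R : comNzRingType) p q (a b : FG2 R) :
  par p a -> par q b -> a * b = (-1) ^+ (p * q) *: (b * a).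
Proof.
apply: palg_supercomm => g h.
by have /eqP := @pgen_rel R (G2presentation R) _ _ (G2comm R g h); rewrite /= subr_eq0 => /eqP.
Qed.

(** * Generating series of F(G) and of its coproducts *)

Section FG2Series.
Variable R : numFieldType.
Local Notation A := (FG2 R).
Local Notation S := (series A).

Lemma par_g2 g : par (G2deg g) (g2 R g).
Proof. exact: (@par_pgen R (G2presentation R)). Qed.

Definition aS : S := @a_ R.
Definition bS : S := @b_ R.
Definition cS : S := @c_ R.
Definition dS : S := @d_ R.

Definition spar p (s : S) := forall n, par p (s n).

Lemma spar_a : spar false aS.
Proof. by case=> [|[|n]]; [exact: par0|exact: par1|exact: par_g2]. Qed.
Lemma spar_b : spar true bS.
Proof. by case=> [|n]; [exact: par0|exact: par_g2]. Qed.
Lemma spar_c : spar true cS.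
Proof. by case=> [|[|n]]; [exact: par0|exact: par0|exact: par_g2]. Qed.
Lemma spar_d : spar false dS.
Proof. by case=> [|n]; [exact: par1|exact: par_g2]. Qed.

Lemma spar1 : spar false 1.
Proof. by case=> [|n]; [exact: par1|exact: par0]. Qed.

Lemma spar_mul p q s t : spar p s -> spar q t -> spar (p (+) q) (s * t).
Proof.
by move=> ps qt n; rewrite seriesM; apply: par_sum => i _; exact: par_mul.
Qed.

Lemma spar_aX k : spar false (aS ^+ k).
Proof.
elim: k => [|k IH]; first exact: spar1.
by rewrite exprS; apply: (spar_mul spar_a IH).
Qed.

Lemma series_even_comm s t : spar false s -> s * t = t * s.
Proof.
move=> ps; apply/funext => n; rewrite !seriesM (reindex_inj rev_ord_inj) /=.
apply: eq_bigr => i _; rewrite subSS subKn -1?ltnS //.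
rewrite -[t i](hpartD (t i)) mulrDr mulrDl.
have e p : s (n - i)%N * hpart p (t i) = hpart p (t i) * s (n - i)%N.
  by rewrite (FG2_supercomm (ps _) (par_hpart p (t i))) scale1r.
by rewrite !e.
Qed.

(** Reversing the Cauchy sum changes its sign, since the coefficients anticommute, and 2 is
    invertible. *)
Lemma series_odd_sqr s : spar true s -> s * s = 0.
Proof.
move=> ps; apply/funext => n; rewrite seriesM series0E.
set x := \sum_(i < _) _; have e : x = - x.
  rewrite {1}/x (reindex_inj rev_ord_inj) /= -sumrN; apply: eq_bigr => i _.
  by rewrite subSS subKn -1?ltnS // (FG2_supercomm (ps _) (ps _)) scaleN1r.
have : 2%:R *: x = 0 by rewrite scaler_nat mulr2n {1}e addNr.
by move/(congr1 (fun y => 2%:R^-1 *: y)); rewrite scalerA mulVf ?pnatr_eq0 // scale1r scaler0.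
Qed.

(** Compositions with a zero part contribute nothing because a_0 = 0. *)
Lemma p_E k n : p_ R k n = (aS ^+ k) n.
Proof.
rewrite series_exp /p_ [RHS](bigID (fun l : {ffun 'I_k -> 'I_n.+1} =>
  [forall j, 0 < l j]%N)) /= [X in _ + X]big1 ?addr0.
  by apply: eq_bigl => l; rewrite andbC.
move=> l /andP[_ /forallPn[j]]; rewrite -leqNgt leqn0 => /eqP lj.
have : j \in index_enum 'I_k by exact: mem_index_enum.
elim: (index_enum 'I_k) => [//|i r IH]; rewrite in_cons big_cons.
by case/orP=> [/eqP<-|/IH->]; rewrite ?mulr0 // lj mul0r.
Qed.

(** As the series a has no constant term, the sum defining [comp_t] may be cut off anywhere beyond
    [n]. This is what makes reindexing in k possible. *)
Lemma aX_order k s n : (n < k)%N -> (aS ^+ k * s) n = 0.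
Proof.
move=> nk; have ok : order_ge k (aS ^+ k) by exact: order_geX.
by have := order_geM ok (fun=> fun h : (_ < 0)%N => False_ind _ (notF h));
  rewrite addn0 => /(_ s n nk).
Qed.

(* The series [\sum_k f_k ⊗ a ^ k s], the shape of all the coproducts. *)
Definition comp_t (f s : S) (n : nat) : (A ⊗ A)%type :=
  \sum_(k < n.+1) f k ⊗ (aS ^+ k * s) n.

Lemma comp_tE N f s n : (n < N)%N ->
  comp_t f s n = \sum_(k < N) f k ⊗ (aS ^+ k * s) n.
Proof.
move=> nN; rewrite /comp_t -!(big_mkord xpredT (fun k => f k ⊗ (aS ^+ k * s) n)).
rewrite [RHS](big_cat_nat (n := n.+1)) //= [X in _ + X]big_nat_cond.
rewrite [X in _ + X]big1 ?addr0 // => k /andP[/andP[nk _] _].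
by rewrite aX_order // linear0r.
Qed.

Lemma comp_tDl f g s n : comp_t (f + g) s n = comp_t f s n + comp_t g s n.
Proof. by rewrite /comp_t -big_split; apply: eq_bigr => k _; rewrite linearDl. Qed.
Lemma comp_tDr f s t n : comp_t f (s + t) n = comp_t f s n + comp_t f t n.
Proof.
by rewrite /comp_t -big_split; apply: eq_bigr => k _; rewrite mulrDr linearDr.
Qed.
Lemma comp_tNl f s n : comp_t (- f) s n = - comp_t f s n.
Proof. by rewrite /comp_t -sumrN; apply: eq_bigr => k _; rewrite linearNl. Qed.
Lemma comp_tNr f s n : comp_t f (- s) n = - comp_t f s n.
Proof.
by rewrite /comp_t -sumrN; apply: eq_bigr => k _; rewrite mulrN linearNr.
Qed.
Lemma comp_t0l s n : comp_t 0 s n = 0.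
Proof. by rewrite /comp_t big1 // => k _; rewrite linear0l. Qed.
Lemma comp_t0r f n : comp_t f 0 n = 0.
Proof. by rewrite /comp_t big1 // => k _; rewrite mulr0 linear0r. Qed.

(** With [comp_t f s] read as f(a) s, the coefficients of f sitting in the left leg, a factor a on
    the right is a factor t of f. *)
Lemma comp_t_a f s n : comp_t f (aS * s) n = comp_t (shift f) s n.
Proof.
rewrite (@comp_tE n.+2 (shift f) _ _ (leqnSn _)) big_ord_recl linear0l add0r.
by apply: eq_bigr => k _; rewrite mulrA -exprSr.
Qed.

Lemma comp_t_shift f s n :
  comp_t f (shift s) n = if n is m.+1 then comp_t f s m else 0.
Proof.
case: n => [|n].
  by rewrite /comp_t big1 // => k _; rewrite shift_mulr linear0r.
rewrite (@comp_tE n.+2 _ s) //.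
by apply: eq_bigr => k _; rewrite shift_mulr.
Qed.

Lemma comp_t_euler f s n : comp_t (euler f) s n = comp_t (deriv_s f) (aS * s) n.
Proof.
rewrite (@comp_tE n.+2 (euler f) _ _ (leqnSn _)) big_ord_recl /euler mulr0n linear0l add0r.
by apply: eq_bigr => k _; rewrite mulrA -exprSr.
Qed.

Lemma comp_t11 n : comp_t 1 1 n = (n == 0)%:R *: (1 ⊗ 1).
Proof.
rewrite /comp_t big_ord_recl big1 ?addr0; last by move=> k _; rewrite linear0l.
by rewrite expr0 mulr1 series1E; case: n => [|n]; rewrite ?scale1r // linear0r scale0r.
Qed.

(* [D] is a derivation up to a sign that is trivial on even series. *)
Lemma comp_t_deriv (D : S -> S) (f s : S) n :
  (forall u v, spar false u -> D (u * v) = D u * v + u * D v) -> D 1 = 0 ->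
  \sum_(k < n.+2) f k ⊗ D (aS ^+ k * s) n =
  comp_t (deriv_s f) (D aS * s) n + comp_t f (D s) n.
Proof.
move=> DM D1.
have DX k : D (aS ^+ k.+1) = (aS ^+ k * D aS) *+ k.+1.
  elim: k => [|k IH]; first by rewrite expr1 expr0 mul1r.
  rewrite exprSr DM ?IH; last exact: spar_aX.
  rewrite mulrnAl -mulrA -(series_even_comm _ spar_a) mulrA -exprSr [RHS]mulrSr.
  by [].
rewrite [in RHS](@comp_tE n.+2 f) // (eq_bigr (fun k : 'I_n.+2 =>
  f k ⊗ (D (aS ^+ k) * s) n + f k ⊗ (aS ^+ k * D s) n)); last first.
  by move=> k _; rewrite -linearDr -seriesD -DM //; exact: spar_aX.
rewrite big_split /=; congr (_ + _).
rewrite big_ord_recl expr0 D1 mul0r linear0r add0r; apply: eq_bigr => k _.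
by rewrite DX mulrnAl -mulrA seriesMn linearMnr /deriv_s linearMnl.
Qed.

Lemma comp_t_split f s n :
  \sum_(1 <= i < n.+1) \sum_(1 <= k < i.+1) f k ⊗ (p_ R k i * s (n - i)%N) =
  comp_t f s n - f 0%N ⊗ s n.
Proof.
rewrite /comp_t big_ord_recl expr0 mul1r addrC addKr.
transitivity (\sum_(1 <= k < n.+1) f k ⊗ (aS ^+ k * s) n); last first.
  by rewrite big_add1 big_mkord.
rewrite (eq_big_nat _ _ (F2 := fun i => \sum_(1 <= k < n.+1)
   f k ⊗ (p_ R k i * s (n - i)%N))); last first.
  move=> i /andP[i1 ni]; rewrite [RHS](big_cat_nat (n := i.+1)) //=.
  rewrite [X in _ + X]big_nat_cond [X in _ + X]big1 ?addr0 // => k.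
  case/andP=> /andP[ik _] _; rewrite p_E -[aS ^+ k]mulr1 aX_order //.
  by rewrite mul0r linear0r.
rewrite exchange_big_nat; apply: eq_big_nat => k /andP[k1 _].
have -> : (aS ^+ k * s) n = \sum_(1 <= i < n.+1) p_ R k i * s (n - i)%N.
  rewrite seriesM -(big_mkord xpredT (fun i => (aS ^+ k) i * s (n - i)%N)).
  have z : (aS ^+ k) 0%N = 0 by rewrite -[aS ^+ k]mulr1 aX_order.
  rewrite big_ltn // z mul0r add0r.
  by apply: eq_bigr => i _; rewrite p_E.
by rewrite linear_sumr.
Qed.

Lemma comp_t_split1 f n : \sum_(1 <= k < n.+1) f k ⊗ p_ R k n =
  comp_t f 1 n - f 0%N ⊗ (1 : S) n.
Proof.
rewrite /comp_t big_ord_recl expr0 mul1r addrC addKr big_add1 big_mkord.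
by apply: eq_bigr => k _; rewrite p_E mulr1.
Qed.

Lemma mul_cst (s : S) (e : A) n : (s * cst e) n = s n * e.
Proof.
rewrite seriesM big_ord_recr /= subnn big1 ?add0r // => i _.
have : (0 < n - i)%N by rewrite subn_gt0.
by case: (n - i)%N => // m _; rewrite mulr0.
Qed.

(** The isolated term with [f 0] is the missing term k = 0, since a^0 = 1, so nothing is left
    over. *)
Lemma comp_t_split3 f n :
  \sum_(1 <= i < n.+1) (f 0%N ⊗ (b_ R i * c_ R (n - i)) +
    \sum_(1 <= j < i.+1) \sum_(1 <= k < j.+1)
      f k ⊗ (p_ R k j * b_ R (i - j) * c_ R (n - i))) =
  comp_t f (bS * cS) n.
Proof.
have E i : (0 < i)%N && (i < n.+1)%N ->
    f 0%N ⊗ (b_ R i * c_ R (n - i)) +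
    \sum_(1 <= j < i.+1) \sum_(1 <= k < j.+1)
      f k ⊗ (p_ R k j * b_ R (i - j) * c_ R (n - i)) =
    \sum_(k < n.+1) f k ⊗ ((aS ^+ k * bS) i * c_ R (n - i)).
  case/andP=> _ ni; rewrite -[b_ R i * _]mul_cst.
  (* The factor c_{n-i} is carried along as a constant series, which makes the inner double sum an
     instance of [comp_t_split]. *)
  transitivity (comp_t f (bS * cst (c_ R (n - i))) i).
    rewrite -[comp_t _ _ _](subrK (f 0%N ⊗ (bS * cst (c_ R (n - i))) i)).
    rewrite -comp_t_split addrC; congr (_ + _).
    apply: eq_bigr => j _; apply: eq_bigr => k _.
    by rewrite mul_cst mulrA.
  rewrite (@comp_tE n.+1) //; apply: eq_bigr => k _.
  by rewrite mulrA mul_cst.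
rewrite (eq_big_nat _ _ E) exchange_big /=; apply: eq_bigr => k _.
rewrite -linear_sumr /= mulrA; congr (_ ⊗ _).
rewrite [RHS]seriesM -(big_mkord xpredT (fun i => (aS ^+ k * bS) i * cS (n - i)%N)).
rewrite [RHS]big_ltn // seriesM big_ord_recl big_ord0 /= mulr0 addr0 mul0r add0r.
by [].
Qed.

End FG2Series.

(** * Compatibility of U(g) with F(G) *)

Section Bicrossproduct.
Variable R : numFieldType.
Local Notation H := (UG1 R).
Local Notation A := (FG2 R).
Variables (DeltaH : {linear H -> (H ⊗ H)%type}) (epsH : {scalar H}) (SH : {linear H -> H}).
Variables (DeltaA : {linear A -> (A ⊗ A)%type}) (epsA : {scalar A}) (SA : {linear A -> A}).
Variables (act : {bilinear H -> A -> A}) (nabla : {linear H -> (H ⊗ A)%type}).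
Hypothesis hH : is_UG1_hopf DeltaH epsH SH.
Hypothesis hA : is_FG2_hopf DeltaA epsA SA.
Hypothesis hact : is_G1_action DeltaH epsH act.
Hypothesis hnabla : is_G2_coaction DeltaH epsH DeltaA epsA act nabla.

Local Notation mulHA := (@tact R H A H A H A *%R *%R).
Local Notation mulH_act := (@tact R H H H A H A *%R act).
Local Notation mulAA := (@tact R A A A A A A *%R *%R).
Local Notation act_mulA := (@tact R H A A A A A act *%R).
Local Notation act_act := (@tact R H H A A A A act act).

Let hopfH := UG1_hopf hH.
Let hopfA := FG2_hopf hA.
Let modA := G1_module_algebra hact.
Let comodH := G2_comodule_coalgebra hnabla.
Let act_even := sact_even modA.
Let act_1 := sact1 modA.
Let act_M := sactM modA.
Let act_one := sact_one modA.
Let nabla_even := scoact_even comodH.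
Let nabla_one := nabla_1 hnabla.
Let DH_x := UG1_primitive hH.

Lemma par_g1 i : par (g1deg i) (g1 R i).
Proof. exact: (@par_pgen R (G1presentation R)). Qed.

Lemma UG1_ind (K : H -> Prop) :
  (forall r g h, K g -> K h -> K (r *: g + h)) -> K 1 ->
  (forall i h, K h -> K (g1 R i * h)) -> forall h, K h.
Proof. exact: (@palg_pind R (G1presentation R)). Qed.

Lemma FG2_ind (K : A -> Prop) :
  (forall r a b, K a -> K b -> K (r *: a + b)) -> K 1 ->
  (forall j a, K a -> K (g2 R j * a)) -> forall a, K a.
Proof. exact: (@palg_pind R (G2presentation R)). Qed.

Lemma act_mul_tact (h : H) (a b : A) : homogeneous a ->
  act h (a * b) = @tl R A A A *%R (act_act (DeltaH h) (a ⊗ b)).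
Proof.
move=> ha; rewrite (sact_mul modA) //; symmetry.
rewrite (@swE _ _ _ _ (fun t => @tl R A A A *%R (act_act t (a ⊗ b)))); last first.
  by move=> r u v; rewrite linearPl linearP.
apply: eq_sw => h1 h2 _ ph2; rewrite (tactE ph2 (homogP ha)) linearZ /= tlE.
by rewrite mulnC.
Qed.

Lemma act_g1_mul i p (a b : A) : par p a -> act (g1 R i) (a * b) =
  act (g1 R i) a * b + (-1) ^+ (g1deg i * p) *: (a * act (g1 R i) b).
Proof.
move=> pa; rewrite act_mul_tact; last by exists p.
rewrite DH_x linearDl linearD /= (tactE (@par1 _ _) pa) (tactE (par_g1 i) pa).
by rewrite mul0n scale1r linearZ /= !tlE !act_1.
Qed.

Lemma nabla_mul_tact g h : nabla ((g : H) * h) =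
  tlift (fun u v => mulHA (nabla u) (mulH_act (1 ⊗ v) (nabla h)))
    (DeltaH g).
Proof.
set G := fun u v => _.
have Gb : bilinear_for *:%R *:%R G.
  split=> [v r u u'|u r v v'] /=; rewrite /G.
    by rewrite linearP linearPl.
  by rewrite linearPr linearPl linearPr.
rewrite (nabla_M hnabla) (swE _ (tlift_linear Gb)); apply: eq_sw => g1 g2 _ pg2.
rewrite (tlift_tens Gb) /G.
rewrite (@swE _ _ _ _ (fun t => mulHA t (mulH_act (1 ⊗ g2) (nabla h)))).
  apply: eq_sw => k1 k2 _ pk2.
  rewrite (@swE _ _ _ _ (fun t => mulHA (k1 ⊗ k2) (mulH_act (1 ⊗ g2) t))).
    apply: eq_sw => h1 h2 ph1 _; rewrite (tactE pg2 ph1) linearZr /= mul1r.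
    rewrite (tactE pk2 ph1) scalerA; congr (_ *: _).
    by case: (deg h1); case: (deg k2); case: (deg g2); sgn.
  by move=> r u v; rewrite !linearPr.
by move=> r u v; rewrite linearPl.
Qed.

Lemma nabla_g1_mul i h : nabla (g1 R i * h) =
  mulHA (nabla (g1 R i)) (nabla h) + mulH_act (1 ⊗ g1 R i) (nabla h).
Proof.
rewrite nabla_mul_tact; set G := fun u v => _.
have Gb : bilinear_for *:%R *:%R G.
  split=> [v r u u'|u r v v'] /=; rewrite /G.
    by rewrite linearP linearPl.
  by rewrite linearPr linearPl linearPr.
rewrite DH_x -[g1 R i ⊗ 1]scale1r (tlift_linear Gb) scale1r !(tlift_tens Gb) /G.
congr (_ + _).
  congr (tact _ _ _ _); elim/tensor_ind: (nabla h) => [k a|r u v Pu Pv].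
    by rewrite (tactE0 _ _ _ _ _ (@par1 _ _)) /= mul1r act_1.
  by rewrite linearPr /= Pu Pv.
rewrite nabla_one; elim/tensor_ind: (mulH_act _ _) => [k a|r u v Pu Pv].
  by rewrite (tactE0 _ _ _ _ _ (@par1 _ _)) /= !mul1r.
by rewrite linearPr /= Pu Pv.
Qed.

Lemma nabla_g1_ind i (K : (H ⊗ A)%type -> Prop) :
  (forall j q b, par q b -> g1deg j (+) q = g1deg i -> K (g1 R j ⊗ b)) ->
  (forall r s t, K s -> K t -> K (r *: s + t)) -> K (nabla (g1 R i)).
Proof.
move=> Kg KD; have KDD s t : K s -> K t -> K (s + t).
  by move=> Ks Kt; rewrite -[s]scale1r; exact: KD.
have pg g : par (G2deg g) (g2 R g) by exact: par_g2.
have K2 s : K s -> K (s *+ 2) by move=> Ks; rewrite mulr2n; exact: KDD.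
case: i Kg => Kg.
- rewrite (nabla_X hnabla) !linearMnl /=.
  apply: (KDD _ _ (KDD _ _ (KDD _ _ (KDD _ _ _ _) _) _) _).
  + by apply: K2; apply: (Kg GY false) => //; exact: (pg (Ga 0)).
  + by apply: (Kg GX false) => //; exact: par1.
  + by apply: (Kg GZ false) => //; exact: (pg (Gd 0)).
  + by apply: (Kg GU true) => //; exact: (pg (Gb 0)).
  + by apply: K2; apply: (Kg GV true) => //; exact: (pg (Gc 0)).
- by rewrite (nabla_Y hnabla); apply: (Kg GY false) => //; exact: par1.
- by rewrite (nabla_Z hnabla); apply: (Kg GZ false) => //; exact: par1.
- by rewrite (nabla_U hnabla); apply: (Kg GU false) => //; exact: par1.
- by rewrite (nabla_V hnabla); apply: (Kg GV false) => //; exact: par1.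
- rewrite (nabla_W hnabla).
  apply: (KDD _ _ (KDD _ _ _ _) _).
  + by apply: (Kg GY true) => //; exact: (pg (Gb 0)).
  + by apply: (Kg GV false) => //; exact: (pg (Gd 0)).
  + by apply: (Kg GW false) => //; exact: par1.
Qed.

Local Notation L := (@lact R H A *%R 1 DeltaH *%R 1 act nabla).
Local Notation X := (g1 R GX).
Local Notation Y := (g1 R GY).
Local Notation Z := (g1 R GZ).
Local Notation U := (g1 R GU).
Local Notation V := (g1 R GV).
Local Notation W := (g1 R GW).

Lemma L_mul g h s : L (g * h) s = L g (L h s).
Proof.
exact: (@lact_M R H A *%R 1 DeltaH epsH SH *%R 1 DeltaA epsA SA hopfH hopfA act
  nabla g1gen (g1 R) g1deg par_g1 DH_x UG1_ind act_even act_1 act_M act_g1_mul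
  act_one nabla_even nabla_one nabla_g1_mul g h s).
Qed.

Lemma L_g1 i s : L (g1 R i) s =
  act_mulA (nabla (g1 R i)) s + act_act (1 ⊗ g1 R i) s.
Proof.
exact: (@lact_x R H A *%R 1 DeltaH epsH SH *%R 1 DeltaA epsA SA hopfH hopfA act
  nabla g1gen (g1 R) g1deg par_g1 DH_x act_1 act_one nabla_one i s).
Qed.

Lemma L_g1_mul i q s t : par q s -> L (g1 R i) (mulAA s t) =
  mulAA (L (g1 R i) s) t +
  (-1) ^+ (g1deg i * q) *: mulAA s (L (g1 R i) t).
Proof.
exact: (@lact_mA R H A *%R 1 DeltaH epsH SH *%R 1 DeltaA epsA SA hopfH hopfA act
  nabla g1gen (g1 R) g1deg par_g1 DH_x UG1_ind act_even act_1 act_M act_g1_mul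
  act_one nabla_one nabla_g1_ind (@FG2_supercomm R) i q s t).
Qed.

(** The conventions a_0 = 0 and a_1 = 1 extend the formula to n = 0 and n = 1, where it becomes 0
    and 1 ⊗ 1; only then is it an identity of series. *)
Lemma DA_a n : DeltaA (aS R n) = comp_t (aS R) 1 n + comp_t (bS R) (cS R) n.
Proof.
have [n2|] := leqP 2 n.
  rewrite (FG2_comul_a hA n2) comp_t_split1 (comp_t_split (bS R) (cS R)).
  by rewrite !linear0l !subr0.
case: n => [|[|//]] _.
  by rewrite linear0 /comp_t !big_ord_recl !big_ord0 !linear0l !addr0.
rewrite (scomul1 hopfA) -[comp_t (aS R) 1 1](subrK (aS R 0%N ⊗ (1 : series A) 1%N)).
rewrite -[comp_t (bS R) _ _](subrK (bS R 0%N ⊗ cS R 1%N)) -comp_t_split1.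
rewrite -comp_t_split !big_nat1 !linear0l !addr0 p_E mulr0 linear0r addr0.
by rewrite expr1.
Qed.

Lemma DA_c n : DeltaA (cS R n) = comp_t (cS R) 1 n + comp_t (dS R) (cS R) n.
Proof.
have [n2|] := leqP 2 n.
  rewrite (FG2_comul_c hA n2) comp_t_split1 (comp_t_split (dS R) (cS R)).
  rewrite linear0l subr0 [X in X + _]addrC -addrA; congr (_ + _).
  by rewrite addrC addrNK.
case: n => [|[|//]] _; rewrite linear0.
  rewrite /comp_t !big_ord_recl !big_ord0 !linear0l !addr0 expr0 mul1r linear0r.
  by rewrite addr0.
rewrite -[comp_t (cS R) 1 1](subrK (cS R 0%N ⊗ (1 : series A) 1%N)).
rewrite -[comp_t (dS R) _ _](subrK (dS R 0%N ⊗ cS R 1%N)) -comp_t_split1.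
by rewrite -comp_t_split !big_nat1 !linear0l mulr0 !linear0r !addr0.
Qed.

(** The summand 1 ⊗ b_n is the term k = 0 of the first series, because the constant coefficient of
    a' is a_1 = 1. *)
Lemma DA_b n : DeltaA (bS R n) =
  comp_t (deriv_s (aS R)) (bS R) n + comp_t (bS R) (dS R) n -
  comp_t (deriv_s (bS R)) (bS R * cS R) n.
Proof.
case: n => [|n].
  rewrite linear0 /comp_t !big_ord_recl !big_ord0 !expr0 !mul1r !linear0l.
  by rewrite seriesM big_ord_recl big_ord0 !mul0r ?(linear0r, addr0, oppr0, linear0).
rewrite (FG2_comul_b hA (ltn0Sn n)) (comp_t_split (deriv_s (aS R)) (bS R)).
rewrite (comp_t_split (bS R) (dS R)) -(comp_t_split3 (deriv_s (bS R))).
rewrite linear0l subr0; congr (_ + _ - _).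
by rewrite addrC [deriv_s _ 0%N]mulr1n addrNK.
Qed.

(** Here 1 ⊗ d_n is the term k = 0 of the second series, because d_0 = 1, while the first has none
    since c_1 = 0. *)
Lemma DA_d n : DeltaA (dS R n) =
  comp_t (deriv_s (cS R)) (bS R) n + comp_t (dS R) (dS R) n -
  comp_t (deriv_s (dS R)) (bS R * cS R) n.
Proof.
case: n => [|n].
  rewrite (scomul1 hopfA) /comp_t !big_ord_recl !big_ord0 !expr0 !mul1r !linear0l.
  have -> : (bS R * cS R) 0%N = 0 by rewrite seriesM big_ord_recl big_ord0 mul0r addr0.
  by rewrite linear0r !addr0 add0r subr0.
rewrite (FG2_comul_d hA (ltn0Sn n)) (comp_t_split (deriv_s (cS R)) (bS R)).
rewrite (comp_t_split (dS R) (dS R)) -(comp_t_split3 (deriv_s (dS R))).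
have -> : deriv_s (cS R) 0%N = 0 by rewrite /deriv_s mul0rn.
rewrite linear0l subr0; congr (_ - _).
by rewrite [X in X + _]addrC -addrA; congr (_ + _); rewrite addrC addrNK.
Qed.

Lemma act_g1_one i : act (g1 R i) 1 = 0.
Proof.
exact: (@act_x_one R H A *%R 1 DeltaH epsH SH 1 hopfH act g1gen (g1 R) DH_x act_one i).
Qed.

(** * The action on the generating series *)

Definition xact i (s : series A) : series A := fun n => act (g1 R i) (s n).

Lemma xact1 i : xact i 1 = 0.
Proof.
by apply/funext => -[|n]; rewrite /xact; [exact: act_g1_one|rewrite linear0r].
Qed.

Lemma xact_mul i s t : spar false s -> xact i (s * t) = xact i s * t + s * xact i t.
Proof.
move=> es; apply/funext => n; rewrite seriesD !seriesM /xact linear_sumr -big_split.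
apply: eq_bigr => k _ /=; rewrite (act_g1_mul _ _ (es k)).
by rewrite muln0 scale1r.
Qed.

Lemma xact_Va : xact GV (aS R) = shift (bS R).
Proof.
apply/funext => -[|[|n]]; rewrite /xact ?linear0r ?act_g1_one //.
by rewrite (act_Va hact).
Qed.
Lemma xact_Vb : xact GV (bS R) = 0.
Proof.
apply/funext => -[|n]; rewrite /xact ?linear0r //.
by rewrite (act_Vb hact).
Qed.
Lemma xact_Vc : xact GV (cS R) = aS R - shift (dS R).
Proof.
apply/funext => -[|[|n]]; rewrite /xact ?linear0r seriesD seriesN.
- exact: (esym (subr0 0)).
- exact: (esym (subrr 1)).
- by rewrite (act_Vc hact) // subn1.
Qed.
Lemma xact_Vd : xact GV (dS R) = bS R.
Proof.
apply/funext => -[|n]; rewrite /xact ?act_g1_one //.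
by rewrite (act_Vd hact).
Qed.

Lemma xact_Ua : xact GU (aS R) = cS R.
Proof.
apply/funext => -[|[|n]]; rewrite /xact ?linear0r ?act_g1_one //.
by rewrite (act_Ua hact).
Qed.
Lemma xact_Ub : xact GU (bS R) = - deriv_s (aS R) + dS R.
Proof.
apply/funext => -[|n]; rewrite /xact ?linear0r seriesD seriesN.
  by rewrite /deriv_s mulr1n addNr.
by rewrite (act_Ub hact).
Qed.
Lemma xact_Uc : xact GU (cS R) = 0.
Proof.
apply/funext => -[|[|n]]; rewrite /xact ?linear0r //.
by rewrite (act_Uc hact).
Qed.
Local Notation b1 := (cst (b_ R 1)).
Local Notation d1 := (cst (d_ R 1)).

Lemma xact_Wa : xact GW (aS R) = - (b1 * aS R) + bS R.
Proof.
apply/funext => -[|[|n]]; rewrite /xact ?linear0r ?act_g1_one seriesD seriesN cst_mul.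
- by rewrite mulr0 oppr0 addr0.
- by rewrite mulr1 addNr.
- by rewrite (act_Wa hact).
Qed.
Lemma xact_Wb : xact GW (bS R) = - (b1 * bS R).
Proof.
apply/funext => -[|n]; rewrite /xact ?linear0r seriesN cst_mul.
  by rewrite mulr0 oppr0.
by rewrite (act_Wb hact).
Qed.
(** The summand 1 corrects degree 0, where d_1 a_0 - d_0 is -1 while c_0 = 0. *)
Lemma xact_Wc : xact GW (cS R) = d1 * aS R - dS R + 1.
Proof.
apply/funext => -[|[|n]]; rewrite /xact ?linear0r !seriesD seriesN cst_mul series1E.
- by rewrite mulr0 add0r addNr.
- by rewrite mulr1 subrr addr0.
- by rewrite (act_Wc hact) // addr0.
Qed.
Lemma xact_Wd : xact GW (dS R) = d1 * bS R.
Proof.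
apply/funext => -[|n]; rewrite /xact cst_mul.
  by rewrite mulr0 act_g1_one.
by rewrite (act_Wd hact).
Qed.

Lemma xact_Ya : xact GY (aS R) = euler (aS R) - aS R.
Proof.
apply/funext => -[|[|n]]; rewrite /xact ?linear0r ?act_g1_one seriesD seriesN /euler.
- by rewrite subr0.
- by rewrite subrr.
- by rewrite (act_Ya hact) // [in RHS]mulrS addrAC subrr add0r subn1.
Qed.
Lemma xact_Yb : xact GY (bS R) = euler (bS R) - bS R.
Proof.
apply/funext => -[|n]; rewrite /xact ?linear0r seriesD seriesN /euler.
  by rewrite subr0.
by rewrite (act_Yb hact) // [in RHS]mulrS addrAC subrr add0r subn1.
Qed.
Lemma xact_Yc : xact GY (cS R) = euler (cS R).
Proof.
apply/funext => -[|[|n]]; rewrite /xact ?linear0r /euler ?mul0rn //.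
by rewrite (act_Yc hact).
Qed.
Lemma xact_Yd : xact GY (dS R) = euler (dS R).
Proof.
apply/funext => -[|n]; rewrite /xact /euler; first by rewrite act_g1_one.
by rewrite (act_Yd hact).
Qed.

Lemma xact_Za : xact GZ (aS R) = 0.
Proof.
apply/funext => -[|[|n]]; rewrite /xact ?linear0r ?act_g1_one //.
by rewrite (act_Za hact).
Qed.
Lemma xact_Zb : xact GZ (bS R) = bS R.
Proof.
apply/funext => -[|n]; rewrite /xact ?linear0r //.
by rewrite (act_Zb hact).
Qed.
Lemma xact_Zc : xact GZ (cS R) = - cS R.
Proof.
apply/funext => -[|[|n]]; rewrite /xact ?linear0r seriesN ?oppr0 //.
by rewrite (act_Zc hact).
Qed.

(** * The diagonal action on the coproduct series *)

Lemma act_act_comp_t i p f s n : spar p f ->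
  act_act (1 ⊗ g1 R i) (comp_t f s n) = (-1) ^+ (g1deg i * p) *:
    (comp_t (deriv_s f) (xact i (aS R) * s) n + comp_t f (xact i s) n).
Proof.
move=> pf; rewrite -(comp_t_deriv _ _ _ (@xact_mul i) (xact1 i)).
rewrite (@comp_tE _ n.+2) // linear_sumr scaler_sumr; apply: eq_bigr => k _.
by rewrite /= (tactE (par_g1 i) (pf k)) act_1.
Qed.

Lemma act_mulA_comp_t i p q (e : A) f s n : par q e -> spar p f ->
  act_mulA (g1 R i ⊗ e) (comp_t f s n) =
  (-1) ^+ (q * p) *: comp_t (xact i f) (cst e * s) n.
Proof.
move=> qe pf; rewrite /comp_t linear_sumr scaler_sumr; apply: eq_bigr => k _.
rewrite /= (tactE qe (pf k)) /= mulrA (series_even_comm (cst e) (spar_aX _ k)) -mulrA.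
by rewrite cst_mul.
Qed.

Lemma mul_right_comp_t p q (e : A) f s n : par q e -> spar p f ->
  mulAA (1 ⊗ e) (comp_t f s n) = (-1) ^+ (q * p) *: comp_t f (cst e * s) n.
Proof.
move=> qe pf; rewrite /comp_t linear_sumr scaler_sumr; apply: eq_bigr => k _.
rewrite /= (tactE qe (pf k)) /= mul1r mulrA (series_even_comm (cst e) (spar_aX _ k)) -mulrA.
by rewrite cst_mul.
Qed.

Lemma mul_left_comp_t (e : A) f s n :
  mulAA (e ⊗ 1) (comp_t f s n) = comp_t (cst e * f) s n.
Proof.
rewrite /comp_t linear_sumr; apply: eq_bigr => k _.
by rewrite /= (tactE0 _ _ _ _ _ (@par1 _ _)) /= mul1r cst_mul.
Qed.

Lemma cst1_mul (s : series A) : cst 1 * s = s.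
Proof. by apply/funext => n; rewrite cst_mul mul1r. Qed.

(** With trivial coaction the diagonal action is the Leibniz rule: the generator acts on the
    coefficients of f, then on f(a) s by the chain rule, with the sign of passing f. *)
Lemma L_comp_t i p f s n : nabla (g1 R i) = g1 R i ⊗ 1 -> spar p f ->
  L (g1 R i) (comp_t f s n) = comp_t (xact i f) s n + (-1) ^+ (g1deg i * p) *:
    (comp_t (deriv_s f) (xact i (aS R) * s) n + comp_t f (xact i s) n).
Proof.
move=> ni pf; rewrite L_g1 ni (act_mulA_comp_t _ _ _ (@par1 _ _) pf) mul0n scale1r.
by rewrite cst1_mul (act_act_comp_t _ _ _ pf).
Qed.

Lemma L_W_comp_t p f s n : spar p f ->
  L W (comp_t f s n) = (-1) ^+ p *: comp_t (xact GY f) (b1 * s) n +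
    comp_t (xact GV f) (d1 * s) n + comp_t (xact GW f) s n + (-1) ^+ p *:
    (comp_t (deriv_s f) (xact GW (aS R) * s) n + comp_t f (xact GW s) n).
Proof.
have [pb pd] : par true (b_ R 1) /\ par false (d_ R 1).
  by split; exact: par_g2.
move=> pf; rewrite L_g1 (nabla_W hnabla) !linearDl /=.
rewrite (act_mulA_comp_t _ _ _ pb pf) (act_mulA_comp_t _ _ _ pd pf).
rewrite (act_mulA_comp_t _ _ _ (@par1 _ _) pf) mul0n scale1r cst1_mul.
by rewrite (act_act_comp_t _ _ _ pf) !mul1n scale1r.
Qed.

Ltac zcancel t := rewrite ?(addrAC _ t) ?(addrAC _ (- t)) ?addrK ?addrNK.
Ltac zmod_solve := apply/eqP; rewrite -subr_eq0; apply/eqP;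
  rewrite -[LHS]add0r !(opprD, opprK, oppr0, addr0, addrA);
  repeat match goal with |- context [- ?t] => zcancel t end; rewrite ?addr0; try by [].

Local Notation a := (aS R).
Local Notation b := (bS R).
Local Notation c := (cS R).
Local Notation d := (dS R).

Definition comul_act_on i (s : series A) : Prop :=
  forall n, DeltaA (act (g1 R i) (s n)) = L (g1 R i) (DeltaA (s n)).

Definition comp_t_linE := (@comp_tDl R, @comp_tDr R, @comp_tNl R, @comp_tNr R,
  @comp_t0l R, @comp_t0r R).

Lemma DA_shift_b n : DeltaA (shift b n) = comp_t (deriv_s a) (shift b) n +
  comp_t b (shift d) n - comp_t (deriv_s b) (shift (b * c)) n.
Proof.
rewrite !comp_t_shift; case: n => [|n]; last exact: DA_b.
by rewrite /= linear0 subr0 addr0.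
Qed.

Lemma DA_shift_d n : DeltaA (shift d n) = comp_t (deriv_s c) (shift b) n +
  comp_t d (shift d) n - comp_t (deriv_s d) (shift (b * c)) n.
Proof.
rewrite !comp_t_shift; case: n => [|n]; last exact: DA_d.
by rewrite /= linear0 subr0 addr0.
Qed.

(** V turns the left-leg a into t b, giving [comp_t b a], which cancels the a of V |> c = a - t d;
    the remaining three terms form the coproduct of t b. *)
Lemma comul_V_a : comul_act_on GV a.
Proof.
move=> n; rewrite -[act _ _]/(xact GV a n) xact_Va DA_shift_b DA_a linearDr /=.
rewrite (L_comp_t _ _ (nabla_V hnabla) (@spar_a R)).
rewrite (L_comp_t _ _ (nabla_V hnabla) (@spar_b R)).
rewrite xact_Va xact_Vb xact_Vc xact1 /= muln0 muln1 expr0 expr1 scale1r scaleN1r.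
rewrite !comp_t_linE mulr1 -comp_t_a mulr1 -shift_mull.
zmod_solve.
Qed.

Lemma comul_V_c : comul_act_on GV c.
Proof.
move=> n; rewrite -[act _ _]/(xact GV c n) xact_Vc seriesD seriesN linearB /=.
rewrite DA_a DA_shift_d DA_c linearDr /=.
rewrite (L_comp_t _ _ (nabla_V hnabla) (@spar_c R)).
rewrite (L_comp_t _ _ (nabla_V hnabla) (@spar_d R)).
rewrite xact_Va xact_Vd xact_Vc xact1 /= muln0 muln1 expr0 expr1 scale1r scaleN1r.
rewrite !comp_t_linE mulr1 -comp_t_a mulr1 -shift_mull.
zmod_solve.
Qed.

(** The two terms in a' cancel, and the term in b' contains c c, which is 0 because c is odd. *)
Lemma comul_U_a : comul_act_on GU a.
Proof.
move=> n; rewrite -[act _ _]/(xact GU a n) xact_Ua DA_c DA_a linearDr /=.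
rewrite (L_comp_t _ _ (nabla_U hnabla) (@spar_a R)).
rewrite (L_comp_t _ _ (nabla_U hnabla) (@spar_b R)).
rewrite xact_Ua xact_Ub xact_Uc xact1 /= muln0 muln1 expr0 expr1 scale1r scaleN1r.
rewrite (series_odd_sqr (@spar_c R)) !comp_t_linE mulr1.
zmod_solve.
Qed.

Lemma euler_comp_t f s n : comp_t f s n *+ n =
  comp_t (deriv_s f) (euler a * s) n + comp_t f (euler s) n.
Proof.
rewrite -(comp_t_deriv (D := @euler A)); first last.
- by apply/funext => -[|m]; rewrite /euler ?mulr0n // mul0rn.
- by move=> u v _; exact: euler_mul.
rewrite (@comp_tE _ n.+2) // -sumrMnl; apply: eq_bigr => k _.
by rewrite /euler linearMnr.
Qed.

Lemma DA_euler_a n : DeltaA (euler a n) =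
  comp_t (deriv_s a) (euler a) n + comp_t (deriv_s b) (euler a * c) n +
  comp_t b (euler c) n.
Proof.
rewrite /euler linearMn DA_a mulrnDl !euler_comp_t mulr1.
have -> : euler (1 : series A) = 0.
  by apply/funext => -[|m]; rewrite /euler ?mulr0n // mul0rn.
by rewrite !comp_t_linE addr0 addrA.
Qed.

(** The Euler operator on the left leg equals f' against a ([comp_t_euler]), which cancels the -a of
    Y |> a in the chain rule. *)
Lemma comul_Y_a : comul_act_on GY a.
Proof.
move=> n; rewrite -[act _ _]/(xact GY a n) xact_Ya seriesD seriesN linearB /=.
rewrite DA_euler_a DA_a linearDr /=.
rewrite (L_comp_t _ _ (nabla_Y hnabla) (@spar_a R)).
rewrite (L_comp_t _ _ (nabla_Y hnabla) (@spar_b R)).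
rewrite xact_Ya xact_Yb xact_Yc xact1 /= !mul0n expr0 !scale1r.
rewrite !comp_t_linE !comp_t_euler !mulr1 !(mulrDl, mulNr) !comp_t_linE.
zmod_solve.
Qed.

Lemma comul_Z_a : comul_act_on GZ a.
Proof.
move=> n; rewrite -[act _ _]/(xact GZ a n) xact_Za linear0 DA_a linearDr /=.
rewrite (L_comp_t _ _ (nabla_Z hnabla) (@spar_a R)).
rewrite (L_comp_t _ _ (nabla_Z hnabla) (@spar_b R)).
rewrite xact_Za xact_Zb xact_Zc xact1 /= !mul0n expr0 !scale1r.
rewrite !mul0r !comp_t_linE.
zmod_solve.
Qed.

Lemma DA_mul u v : DeltaA (u * v) = mulAA (DeltaA u) (DeltaA v).
Proof. exact: (@DA_M R A *%R 1 DeltaA epsA SA hopfA u v). Qed.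

Lemma DA_b1 : DeltaA (b_ R 1) = 1 ⊗ b_ R 1 + b_ R 1 ⊗ 1.
Proof.
rewrite (FG2_comul_b hA (leqnn 1)) !big_nat1 subnn /= mulr0 !linear0r !addr0.
by rewrite subr0 p_E expr1 mulr1.
Qed.

Lemma DA_d1 : DeltaA (d_ R 1) = 1 ⊗ d_ R 1 + d_ R 1 ⊗ 1.
Proof.
rewrite (FG2_comul_d hA (leqnn 1)) !big_nat1 subnn /= mulr0 !linear0r !addr0.
by rewrite subr0 p_E expr1 mulr1.
Qed.

Lemma aS_cst_comm (e : A) : a * cst e = cst e * a.
Proof. exact/series_even_comm/spar_a. Qed.

(** The coaction terms Y ⊗ b_1 and V ⊗ d_1 absorb the terms -b_1 a and d_1 a that W creates in the
    right leg: there a factor a amounts to t on the left, and t f' is the Euler operator contained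
    in Y, t b the value V |> a. *)
Lemma comul_W_a : comul_act_on GW a.
Proof.
move=> n; rewrite -[act _ _]/(xact GW a n) xact_Wa seriesD seriesN cst_mul.
have [pb pd] : par true (b_ R 1) /\ par false (d_ R 1) by split; exact: par_g2.
rewrite linearD linearN /= DA_mul DA_b1 DA_a linearDl !linearDr /=.
rewrite !mul_left_comp_t (mul_right_comp_t _ _ pb (@spar_a R)).
rewrite (mul_right_comp_t _ _ pb (@spar_b R)).
rewrite (L_W_comp_t _ _ (@spar_a R)) (L_W_comp_t _ _ (@spar_b R)).
rewrite xact_Ya xact_Yb xact_Va xact_Vb xact_Wa xact_Wb xact_Wc xact1.
rewrite /= muln0 muln1 expr0 expr1 !scale1r !scaleN1r DA_b.
rewrite !comp_t_linE !comp_t_euler !mulrA !aS_cst_comm !mulr1.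
rewrite -!(comp_t_a b) ?mulrA ?aS_cst_comm.
rewrite !(mulrDl, mulNr) !comp_t_linE.
zmod_solve.
Qed.

Lemma comul_W_c : comul_act_on GW c.
Proof.
move=> n; rewrite -[act _ _]/(xact GW c n) xact_Wc !seriesD seriesN cst_mul.
have [pb pd] : par true (b_ R 1) /\ par false (d_ R 1) by split; exact: par_g2.
rewrite !linearD linearN /= DA_mul DA_d1 DA_a DA_c linearDl !linearDr /=.
rewrite !mul_left_comp_t (mul_right_comp_t _ _ pd (@spar_a R)).
rewrite (mul_right_comp_t _ _ pd (@spar_b R)).
rewrite (L_W_comp_t _ _ (@spar_c R)) (L_W_comp_t _ _ (@spar_d R)).
rewrite xact_Yc xact_Yd xact_Vc xact_Vd xact_Wa xact_Wc xact_Wd xact1.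
rewrite /= mul0n expr0 expr1 !scale1r !scaleN1r DA_d.
(* The corrective summand 1 of W |> c contributes the coproduct of 1, matched on the other side by W
   acting on the left leg c. *)
have -> : DeltaA ((1 : series A) n) = comp_t 1 1 n.
  rewrite comp_t11; case: n => [|n]; first by rewrite (scomul1 hopfA) scale1r.
  by rewrite linear0 scale0r.
rewrite !comp_t_linE !comp_t_euler !mulrA !aS_cst_comm !mulr1.
rewrite -!(comp_t_a d) ?mulrA ?aS_cst_comm.
rewrite !(mulrDl, mulNr) !comp_t_linE.
zmod_solve.
Qed.

(** * Propagation of the compatibility along brackets and products *)

Definition comul_act (h : H) (u : A) : Prop := DeltaA (act h u) = L h (DeltaA u).

Lemma comul_actl r g h u :
  comul_act g u -> comul_act h u -> comul_act (r *: g + h) u.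
Proof.
by rewrite /comul_act => Pg Ph; rewrite linearPl !linearP linearPl /= Pg Ph.
Qed.

Lemma comul_actr r h u v :
  comul_act h u -> comul_act h v -> comul_act h (r *: u + v).
Proof.
by rewrite /comul_act => Pu Pv; rewrite linearPr !linearP linearPr /= Pu Pv.
Qed.

Lemma comul_act0l u : comul_act 0 u.
Proof. by rewrite /comul_act !linear0l linear0. Qed.

Lemma comul_act0r h : comul_act h 0.
Proof. by rewrite /comul_act linear0r !linear0 linear0r. Qed.

Lemma comul_actDr h u v : comul_act h u -> comul_act h v -> comul_act h (u + v).
Proof. by move=> Pu Pv; rewrite -[u]scale1r; exact: comul_actr. Qed.

Lemma comul_actNr h u : comul_act h u -> comul_act h (- u).
Proof.
move=> Pu; rewrite -scaleN1r -[_ *: _]addr0.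
by apply: comul_actr => //; exact: comul_act0r.
Qed.

Lemma comul_actNl h u : comul_act h u -> comul_act (- h) u.
Proof.
move=> Pu; rewrite -scaleN1r -[_ *: _]addr0.
by apply: comul_actl => //; exact: comul_act0l.
Qed.

Lemma comul_actDl g h u : comul_act g u -> comul_act h u -> comul_act (g + h) u.
Proof. by move=> Pg Ph; rewrite -[g]scale1r; exact: comul_actl. Qed.

Lemma comul_actMn h u k : comul_act h u -> comul_act h (u *+ k).
Proof.
move=> Pu; elim: k => [|k IH]; first exact: comul_act0r.
by rewrite mulrS; exact: comul_actDr.
Qed.

Lemma comul_act_mul i p u v : par p u -> comul_act (g1 R i) u ->
  comul_act (g1 R i) v -> comul_act (g1 R i) (u * v).
Proof.
rewrite /comul_act => pu Pu Pv; rewrite (act_g1_mul _ _ pu) linearD linearZ /=.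
rewrite !DA_mul Pu Pv (@L_g1_mul i p) //.
by rewrite /par -(scomul_even (shopf_coalg hopfA)) pu.
Qed.

Lemma comul_actM g h u : comul_act h u -> comul_act g (act h u) ->
  DeltaA (act (g * h) u) = L (g * h) (DeltaA u).
Proof. by rewrite /comul_act act_M L_mul => <- <-. Qed.

(** Both sides of the compatibility are module actions, so the relation between x and y lets x |> (y
    |> u) be computed from y |> (x |> u) and z |> u. *)
Lemma comul_act_bracket (x y z : H) r u : x * y = r *: (y * x) + z ->
  comul_act x u -> comul_act y u -> comul_act z u -> comul_act y (act x u) ->
  comul_act x (act y u).
Proof.
move=> e Px Py Pz Pyx; rewrite {1}/comul_act Py -act_M -L_mul e.
by apply: comul_actl => //; exact: comul_actM.
Qed.

Lemma comul_act_sqr (x : H) u : x * x = 0 -> comul_act x u ->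
  comul_act x (act x u).
Proof.
by rewrite {2}/comul_act => xx Px; rewrite Px -act_M -L_mul xx !linear0l linear0.
Qed.

Lemma g1_rel i j z : g1bracket R i j = Some z ->
  g1 R i * g1 R j = (-1) ^+ (g1deg i * g1deg j) *: (g1 R j * g1 R i) +
    aterm_eval (g1 R) z.
Proof.
move=> e; have /= := @pgen_rel R (G1presentation R) _ _ (@G1rel R i j z e).
by move/(canRL (subrK _)); rewrite addrC.
Qed.

(** For odd x the relation [x, x] = 0 reads 2 x x = 0, and 2 is invertible. *)
Lemma g1_sqr i : g1deg i -> g1bracket R i i = Some AZero -> g1 R i * g1 R i = 0.
Proof.
move=> di /g1_rel; rewrite di expr1 scaleN1r addr0 => e.
have : 2%:R *: (g1 R i * g1 R i) = 0 by rewrite scaler_nat mulr2n {1}e addNr.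
move/(congr1 (fun y => 2%:R^-1 *: y)).
by rewrite scalerA mulVf ?pnatr_eq0 // scale1r scaler0.
Qed.

Lemma b_Va n : b n = act V (a n.+1).
Proof. by rewrite -[act _ _]/(xact GV a n.+1) xact_Va. Qed.
Lemma c_Ua n : c n = act U (a n).
Proof. by rewrite -[act _ _]/(xact GU a n) xact_Ua. Qed.
Lemma d_Vc n : d n = a n.+1 - act V (c n.+1).
Proof.
rewrite -[act _ _]/(xact GV c n.+1) xact_Vc seriesD seriesN opprB addrC.
by rewrite addrNK.
Qed.

Lemma comul_d i n : comul_act (g1 R i) (a n.+1) ->
  comul_act (g1 R i) (act V (c n.+1)) -> comul_act (g1 R i) (d n).
Proof.
by move=> Pa Pc; rewrite d_Vc; apply: comul_actDr => //; exact: comul_actNr.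
Qed.

Lemma actY_a n : act Y (a n) = a n *+ n - a n.
Proof. by rewrite -[act _ _]/(xact GY a n) xact_Ya. Qed.
Lemma actY_c n : act Y (c n) = c n *+ n.
Proof. by rewrite -[act _ _]/(xact GY c n) xact_Yc. Qed.
Lemma actZ_a n : act Z (a n) = 0.
Proof. by rewrite -[act _ _]/(xact GZ a n) xact_Za. Qed.
Lemma actZ_c n : act Z (c n) = - c n.
Proof. by rewrite -[act _ _]/(xact GZ c n) xact_Zc. Qed.

Lemma comul_Y_b n : comul_act Y (b n).
Proof.
rewrite b_Va; apply: (comul_act_bracket (@g1_rel GY GV _ erefl)).
- exact: comul_Y_a.
- exact: comul_V_a.
- by apply: comul_actNl; exact: comul_V_a.
- rewrite actY_a; apply: comul_actDr; first by apply: comul_actMn; exact: comul_V_a.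
  by apply: comul_actNr; exact: comul_V_a.
Qed.

Lemma comul_Y_c n : comul_act Y (c n).
Proof.
rewrite c_Ua; apply: (comul_act_bracket (@g1_rel GY GU _ erefl)).
- exact: comul_Y_a.
- exact: comul_U_a.
- exact: comul_U_a.
- rewrite actY_a; apply: comul_actDr; first by apply: comul_actMn; exact: comul_U_a.
  by apply: comul_actNr; exact: comul_U_a.
Qed.

Lemma comul_Y_d n : comul_act Y (d n).
Proof.
apply: comul_d; first exact: comul_Y_a.
apply: (comul_act_bracket (@g1_rel GY GV _ erefl)).
- exact: comul_Y_c.
- exact: comul_V_c.
- by apply: comul_actNl; exact: comul_V_c.
- by rewrite actY_c; apply: comul_actMn; exact: comul_V_c.
Qed.

Lemma comul_Z_b n : comul_act Z (b n).
Proof.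
rewrite b_Va; apply: (comul_act_bracket (@g1_rel GZ GV _ erefl)).
- exact: comul_Z_a.
- exact: comul_V_a.
- exact: comul_V_a.
- by rewrite actZ_a; exact: comul_act0r.
Qed.

Lemma comul_Z_c n : comul_act Z (c n).
Proof.
rewrite c_Ua; apply: (comul_act_bracket (@g1_rel GZ GU _ erefl)).
- exact: comul_Z_a.
- exact: comul_U_a.
- by apply: comul_actNl; exact: comul_U_a.
- by rewrite actZ_a; exact: comul_act0r.
Qed.

Lemma comul_Z_d n : comul_act Z (d n).
Proof.
apply: comul_d; first exact: comul_Z_a.
apply: (comul_act_bracket (@g1_rel GZ GV _ erefl)).
- exact: comul_Z_c.
- exact: comul_V_c.
- exact: comul_V_c.
- by rewrite actZ_c; apply: comul_actNr; exact: comul_V_c.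
Qed.

Lemma comul_V_b n : comul_act V (b n).
Proof.
by rewrite b_Va; apply: comul_act_sqr; [exact: g1_sqr|exact: comul_V_a].
Qed.

Lemma comul_V_d n : comul_act V (d n).
Proof.
apply: comul_d; first exact: comul_V_a.
by apply: comul_act_sqr; [exact: g1_sqr|exact: comul_V_c].
Qed.

Lemma comul_U_c n : comul_act U (c n).
Proof.
by rewrite c_Ua; apply: comul_act_sqr; [exact: g1_sqr|exact: comul_U_a].
Qed.

(** The bracket [U, V] involves Y + Z, and exchanging U and V leaves V on U |> a = c; this is where
    the direct computation for (V, c) is consumed. *)
Lemma comul_U_b n : comul_act U (b n).
Proof.
rewrite b_Va; apply: (comul_act_bracket (@g1_rel GU GV _ erefl)).
- exact: comul_U_a.
- exact: comul_V_a.
- by apply/comul_actNl/comul_actDl; [exact: comul_Y_a|exact: comul_Z_a].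
- by rewrite -c_Ua; exact: comul_V_c.
Qed.

Lemma comul_U_d n : comul_act U (d n).
Proof.
apply: comul_d; first exact: comul_U_a.
apply: (comul_act_bracket (@g1_rel GU GV _ erefl)).
- exact: comul_U_c.
- exact: comul_V_c.
- by apply/comul_actNl/comul_actDl; [exact: comul_Y_c|exact: comul_Z_c].
- rewrite -[act _ _]/(xact GU c n.+1) xact_Uc; exact: comul_act0r.
Qed.

(** The presentation lists this relation in the order V, W; the opposite order is what moves W past
    V. *)
Lemma g1_WV : W * V = -1 *: (V * W) + 0.
Proof.
have := @g1_rel GV GW _ erefl; rewrite /= expr1 addr0 => ->.
by rewrite addr0 scalerA mulrNN mulr1 scale1r.
Qed.

Lemma comul_W_b n : comul_act W (b n).
Proof.
rewrite b_Va; apply: (comul_act_bracket g1_WV).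
- exact: comul_W_a.
- exact: comul_V_a.
- exact: comul_act0l.
- rewrite -[act _ _]/(xact GW a n.+1) xact_Wa seriesD seriesN cst_mul.
  apply: comul_actDr; last exact: comul_V_b.
  by apply/comul_actNr/(comul_act_mul (@spar_b R 1%N)); [exact: (comul_V_b 1)|
    exact: comul_V_a].
Qed.

Lemma comul_W_d n : comul_act W (d n).
Proof.
apply: comul_d; first exact: comul_W_a.
apply: (comul_act_bracket g1_WV).
- exact: comul_W_c.
- exact: comul_V_c.
- exact: comul_act0l.
- rewrite -[act _ _]/(xact GW c n.+1) xact_Wc !seriesD seriesN cst_mul addr0.
  apply: comul_actDr; last by apply: comul_actNr; exact: comul_V_d.
  by apply: (comul_act_mul (@spar_d R 1%N)); [exact: (comul_V_d 1)|
    exact: comul_V_a].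
Qed.

Lemma g1_X : X = - (U * W + W * U).
Proof.
have := @g1_rel GU GW _ erefl; rewrite /= expr1 scaleN1r => ->.
by rewrite addrAC addNr add0r opprK.
Qed.

(** Since both sides are module actions, compatibility for U and W passes to their products, hence
    to X; the five-term coaction of X is not expanded. *)
Lemma comul_X u : comul_act U u -> comul_act W u -> comul_act U (act W u) ->
  comul_act W (act U u) -> comul_act X u.
Proof.
move=> PU PW PUW PWU; rewrite g1_X; apply/comul_actNl/comul_actDl.
  exact: comul_actM.
exact: comul_actM.
Qed.

Lemma comul_act_all i : comul_act_on i a -> comul_act_on i b ->
  comul_act_on i c -> comul_act_on i d -> forall u, comul_act (g1 R i) u.
Proof.
move=> Pa Pb Pc Pd u; elim/FG2_ind: u => [r u v Pu Pv||j u Pu].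
- exact: comul_actr.
- exact: (Pa 1%N).
- apply: (comul_act_mul (par_g2 R j)) => //.
  by case: j => m; [exact: (Pa m.+2)|exact: (Pb m.+1)|exact: (Pc m.+2)|exact: (Pd m.+1)].
Qed.

Lemma comul_g1 i u : comul_act (g1 R i) u.
Proof.
have PU := comul_act_all comul_U_a comul_U_b comul_U_c comul_U_d.
have PW := comul_act_all comul_W_a comul_W_b comul_W_c comul_W_d.
case: i.
- exact: comul_X.
- exact: (comul_act_all comul_Y_a comul_Y_b comul_Y_c comul_Y_d).
- exact: (comul_act_all comul_Z_a comul_Z_b comul_Z_c comul_Z_d).
- exact: PU.
- exact: (comul_act_all comul_V_a comul_V_b comul_V_c comul_V_d).
- exact: PW.
Qed.

(** * The counit and the action on generators *)

Lemma epsA_a n : epsA (a_ R n) = (n == 1%N)%:R.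
Proof.
by case: n => [|[|n]]; [exact: linear0|exact: (scounit1 hopfA)|exact: (FG2_counit hA)].
Qed.
Lemma epsA_b n : epsA (b_ R n) = 0.
Proof. by case: n => [|n]; [exact: linear0|exact: (FG2_counit hA)]. Qed.
Lemma epsA_c n : epsA (c_ R n) = 0.
Proof. by case: n => [|[|n]]; [exact: linear0|exact: linear0|exact: (FG2_counit hA)]. Qed.
Lemma epsA_d n : epsA (d_ R n) = (n == 0%N)%:R.
Proof. by case: n => [|n]; [exact: (scounit1 hopfA)|exact: (FG2_counit hA)]. Qed.

(** Among the series coefficients only a_1 and d_0 have nonzero counit, and neither occurs in the
    values of the action on generators: even in V |> c_n = a_n - d_{n-1} one has n >= 2. *)
Lemma epsA_act_g1 i j : epsA (act (g1 R i) (g2 R j)) = 0.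
Proof.
have eD u v : epsA (u + v) = epsA u + epsA v by exact: linearD.
have eN u : epsA (- u) = - epsA u by exact: linearN.
have eMn u k : epsA (u *+ k) = epsA u *+ k by exact: linearMn.
have e0 : epsA 0 = 0 by exact: linear0.
have eM := scounitM hopfA.
pose E := (eMn, eN, eM, eD, e0, epsA_a, epsA_b, epsA_c, epsA_d).
pose simpl0 := (mul0r, mulr0, mul0rn, oppr0, addr0).
case: j => m; rewrite -?[g2 R (Ga m)]/(a_ R m.+2) -?[g2 R (Gb m)]/(b_ R m.+1)
  -?[g2 R (Gc m)]/(c_ R m.+2) -?[g2 R (Gd m)]/(d_ R m.+1); case: i;
  rewrite ?(act_Xa hact, act_Xb hact, act_Xc hact, act_Xd hact) //
    ?(act_Ya hact, act_Yb hact, act_Yc hact, act_Yd hact) //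
    ?(act_Za hact, act_Zb hact, act_Zc hact, act_Zd hact) //
    ?(act_Ua hact, act_Ub hact, act_Uc hact, act_Ud hact) //
    ?(act_Va hact, act_Vb hact, act_Vc hact, act_Vd hact) //
    ?(act_Wa hact, act_Wb hact, act_Wc hact, act_Wd hact) //
    ?E /= ?simpl0 //.
Qed.

End Bicrossproduct.

(** * The bicrossproduct super Hopf algebra of F(G) and U(g) *)

Lemma ncomul_sw (R : comNzRingType) (H A : superModType R)
    (mA : {bilinear A -> A -> A}) (nabla : {linear H -> (H ⊗ A)%type})
    (t : (H ⊗ H)%type) :
  ncomul mA nabla t = \sw_(h1, h2 <- t) \sw_(k1, k2 <- nabla h1)
    \sw_(l1, l2 <- nabla h2) (-1) ^+ (deg k2 * deg l1) *: (k1 ⊗ (l1 ⊗ mA k2 l2)).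
Proof.
rewrite (swE t (ncomul_linear mA nabla)); apply: eq_sw => h1 h2 _ _.
rewrite ncomulE tact_sw (sw_linear _ _ (@tassoc_linear _ _ _ _)).
apply: eq_sw => k1 k2 _ _; rewrite (sw_linear _ _ (@tassoc_linear _ _ _ _)).
by apply: eq_sw => l1 l2 _ _; rewrite linearZ /= tassocE.
Qed.

Theorem theorem6p3 (R : realType)
    (DeltaH : {linear UG1 R -> (UG1 R ⊗ UG1 R)%type})
    (epsH : {scalar UG1 R}) (SH : {linear UG1 R -> UG1 R})
    (DeltaA : {linear FG2 R -> (FG2 R ⊗ FG2 R)%type})
    (epsA : {scalar FG2 R}) (SA : {linear FG2 R -> FG2 R})
    (act : {bilinear UG1 R -> FG2 R -> FG2 R})
    (nabla : {linear UG1 R -> (UG1 R ⊗ FG2 R)%type})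
    (hH : is_UG1_hopf DeltaH epsH SH)
    (hA : is_FG2_hopf DeltaA epsA SA)
    (hact : is_G1_action DeltaH epsH act)
    (hnabla : is_G2_coaction DeltaH epsH DeltaA epsA act nabla) :
  (forall (a : FG2 R) (g h : UG1 R),
    homogeneous a -> homogeneous g -> homogeneous h ->
    [/\ DeltaA (act h a) =
          \sw_(h1, h2 <- DeltaH h) \sw_(k1, k2 <- nabla h1)
          \sw_(a1, a2 <- DeltaA a)
            (-1) ^+ (deg a1 * (deg k2 + deg h2)) *:
              (act k1 a1 ⊗ (k2 * act h2 a2)),
        epsA (act h a) = epsH h * epsA a,
        nabla (g * h) =
          \sw_(g1, g2 <- DeltaH g) \sw_(k1, k2 <- nabla g1)
          \sw_(h1, h2 <- nabla h)
            (-1) ^+ (deg h1 * (deg k2 + deg g2)) *: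
              ((k1 * h1) ⊗ (k2 * act g2 h2)),
        nabla 1 = 1 ⊗ 1
      & \sw_(h1, h2 <- DeltaH h) \sw_(k1, k2 <- nabla h2)
            (-1) ^+ (deg h1 * deg k1 + deg a * deg k2) *:
              (k1 ⊗ (act h1 a * k2)) =
          \sw_(h1, h2 <- DeltaH h) \sw_(k1, k2 <- nabla h1)
            k1 ⊗ (k2 * act h2 a)])
  /\
  (exists (mul : {bilinear (FG2 R ⊗ UG1 R)%type -> (FG2 R ⊗ UG1 R)%type ->
                           (FG2 R ⊗ UG1 R)%type})
          (Delta : {linear (FG2 R ⊗ UG1 R)%type ->
                           ((FG2 R ⊗ UG1 R) ⊗ (FG2 R ⊗ UG1 R))%type})
          (eps : {scalar (FG2 R ⊗ UG1 R)%type})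
          (S : {linear (FG2 R ⊗ UG1 R)%type -> (FG2 R ⊗ UG1 R)%type}),
    is_super_hopf mul (1 ⊗ 1) Delta eps S /\
    forall (a b : FG2 R) (g h : UG1 R),
      homogeneous a -> homogeneous b -> homogeneous g -> homogeneous h ->
      [/\ mul (a ⊗ h) (b ⊗ g) =
            \sw_(h1, h2 <- DeltaH h)
              (-1) ^+ (deg h2 * deg b) *: ((a * act h1 b) ⊗ (h2 * g)),
          Delta (a ⊗ h) =
            \sw_(a1, a2 <- DeltaA a) \sw_(h1, h2 <- DeltaH h)
            \sw_(k1, k2 <- nabla h1)
              (-1) ^+ (deg k1 * deg a2) *:
                ((a1 ⊗ k1) ⊗ ((a2 * k2) ⊗ h2)),
          eps (a ⊗ h) = epsA a * epsH h
        & S (a ⊗ h) =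
            \sw_(k1, k2 <- nabla h)
              (-1) ^+ (deg k1 * deg a) *:
                mul (1 ⊗ SH k1) (SA (a * k2) ⊗ 1)]).
Proof.
have hopfH := UG1_hopf hH.
have hopfA := FG2_hopf hA.
have modA := G1_module_algebra hact.
have comodH := G2_comodule_coalgebra hnabla.
have nabla_counit h : contrr epsA (nabla h) = h.
  by rewrite contrr_sw (scoact_counit comodH).
have nabla_eps h : contrl epsH (nabla h) = epsH h *: 1.
  by rewrite contrl_sw (scoact_eps comodH).
have DA_act_xy i j := comul_g1 hH hA hact hnabla i (g2 R j).
have epsA_act_xy i j := epsA_act_g1 hA hact i j.
have act_x i p a b := act_g1_mul hH hact i (p := p) (a := a) b.
have nabla_x i h := nabla_g1_mul hH hact hnabla i h.
split=> [a g h ha _ _|].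
  split.
  - rewrite (DA_act hopfH hopfA (@par_g1 R) (UG1_primitive hH) (@UG1_ind R)
      (sact_even modA) (sact1 modA) (sactM modA) act_x (sact_one modA)
      (scoact_even comodH) nabla_eps (nabla_1 hnabla) nabla_x
      (nabla_g1_ind hnabla) (@FG2_supercomm R) (@par_g2 R) (@FG2_ind R) DA_act_xy).
    exact: (lact_sw hopfH hopfA nabla (sact1 modA) (sact_one modA)).
  - exact: (epsA_act hopfH hopfA (UG1_primitive hH) (@UG1_ind R) (sact1 modA)
      (sactM modA) act_x (sact_one modA) (@par_g2 R) (@FG2_ind R) epsA_act_xy).
  - exact: (nabla_M hnabla).
  - exact: (nabla_1 hnabla).
  - exact: (act_nabla_compat hopfH (@par_g1 R) (UG1_primitive hH) (@UG1_ind R)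
      (sact_even modA) (scoact_even comodH) (@FG2_supercomm R) h (homogP ha)).
exists (@smash R (UG1 R) (FG2 R) *%R 1 DeltaH *%R act).
exists (@cop R (UG1 R) (FG2 R) *%R 1 DeltaH *%R 1 DeltaA act nabla).
exists (@epsM R (UG1 R) (FG2 R) epsH epsA).
exists (@antiM R (UG1 R) (FG2 R) *%R 1 DeltaH SH *%R 1 SA act nabla).
split.
  apply: (smash_super_hopf hopfH hopfA (@par_g1 R) (UG1_primitive hH) (@UG1_ind R)
    (sact_even modA) (sact1 modA) (sactM modA) act_x (sact_one modA)
    (scoact_even comodH) _ nabla_counit nabla_eps (nabla_1 hnabla) nabla_x
    (nabla_g1_ind hnabla) (@FG2_supercomm R) (@par_g2 R) (@FG2_ind R) DA_act_xy
    epsA_act_xy).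
  - by move=> h; rewrite tassoc_tmap_sw tmap_id_sw (scoact_coassoc comodH).
  - by move=> a; rewrite tassoc_tmap_sw tmap_id_sw (scoassoc (shopf_coalg hopfA)).
  - move=> h a; split.
    + by rewrite tl_sw_l (santipodel hopfH).
    + by rewrite tl_sw_r (santipoder hopfH).
    + by rewrite tl_sw_l (santipodel hopfA).
    + by rewrite tl_sw_r (santipoder hopfA).
  - by move=> h; rewrite tassoc_tmap_sw (scoact_comul comodH) ncomul_sw.
move=> a b g h ha hb _ _; split.
- exact: (smash_sw _ hopfH act a h g (homogP hb)).
- exact: (cop_sw hopfH hopfA nabla (sact1 modA) (sact_one modA) a h).
- exact: epsM_tens.
- exact: (antiM_sw _ _ SA hopfH act nabla h (homogP ha)).
Qed.
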